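(* Let $\mathcal{H}$ be a separable complex Hilbert space, let $1\leq p\leq\infty$, and let $T\in\mathfrak{C}_p(\mathcal{H})$. Let $f,g$ be non-negative continuous functions on $[0,\infty)$ such that $f(x)g(x)=x$ for all $x\geq 0$, and let $\widetilde{T}_{f,g}=f(|T|)Ug(|T|)$ be the $(f,g)$-Aluthge transform of $T$, where $T=U|T|$ is the polar decomposition of $T$. Then $$w_p(T)\leq 2^{\frac1p-1}\,w_p(\widetilde{T}_{f,g})+2^{\frac1p-2}\,\big\|f^2(|T|)+g^2(|T|)\big\|_p .$$
   Context: $\mathfrak{L}(\mathcal{H})$ is the space of bounded linear operators on $\mathcal{H}$, and $|T|=(T^*T)^{1/2}$. The polar decomposition $T=U|T|$ is the canonical one, with $U$ the partial isometry satisfying $\ker U=\ker T$. For $1\leq p<\infty$, the Schatten class $\mathfrak{C}_p(\mathcal{H})$ is the set of compact operators $T$ on $\mathcal{H}$ with $\operatorname{tr}(|T|^p)=\sum_j s_j(T)^p<\infty$ ($s_j$ the singular values), and $\|T\|_p=(\operatorname{tr}|T|^p)^{1/p}$. For $p=\infty$, $\|\cdot\|_\infty$ is the usual operator norm, $\mathfrak{C}_\infty(\mathcal{H})$ is read as $\mathfrak{L}(\mathcal{H})$, and $1/p$ is read as $0$. The norm $\|X\|_p$ of a bounded operator $X$ not in $\mathfrak{C}_p(\mathcal{H})$ is $+\infty$ (so the inequality is trivial if its right-hand side is infinite). The $p$-numerical radius is $w_p(T)=\sup_{\theta\in\mathbb{R}}\|\Re(e^{i\theta}T)\|_p$, where $\Re(X)=\frac{X+X^*}{2}$.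 Functions of the positive operator $|T|$ are defined by continuous functional calculus, and $f^2(|T|)=(f(|T|))^2$, and similarly for $g$. *)

(* Defs.v *)
From HB Require Import structures.
From mathcomp Require Import all_boot all_order all_algebra.
From mathcomp Require Import all_classical all_reals all_analysis.
From mathcomp Require Import sesquilinear complex.

Set Implicit Arguments.
Unset Strict Implicit.
Unset Printing Implicit Defensive.

Import Order.TTheory GRing.Theory Num.Theory.
Import numFieldNormedType.Exports.

Local Open Scope classical_set_scope.
Local Open Scope ring_scope.

(* [{dot H for Num.conj}] is linear in its first argument and conjugate-linear
   in the second; the norm of H takes its values in the nonnegative reals of
   R[i]. *)
Record hilbertSpace (R : realType) := HilbertSpace {
  hilbert_sort :> completeNormedModType R[i];
  inner : {dot hilbert_sort for (@Num.conj R[i])};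
  innerE : forall x, inner x x = `|x| ^+ 2 }.

Definition separable (T : topologicalType) : Prop :=
  exists2 S : set T, countable S & dense S.

Section Operators.
Context {R : realType} {H : hilbertSpace R}.
Implicit Types (T S A B U X : H -> H) (p : \bar R) (f g : R -> R).

Definition bounded_operator T : Prop :=
  linear T /\ exists M : R, forall x, `|T x| <= M%:C%C * `|x|.

Definition opnorm T : \bar R :=
  ereal_sup [set (complex.Re `|T x|)%:E | x in [set x : H | `|x| <= 1]].

Definition is_adjoint T S : Prop :=
  bounded_operator S /\ forall x y, inner H (T x) y = inner H x (S y).

Definition adjoint T : H -> H := xget (fun=> 0) (is_adjoint T).

(* In R[i], [0 <= z] means that z is real and nonnegative. *)
Definition positive_operator A : Prop :=
  bounded_operator A /\ forall x, 0 <= inner H (A x) x.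

Definition is_absop T A : Prop :=
  positive_operator A /\ A \o A = adjoint T \o T.

Definition absop T : H -> H := xget (fun=> 0) (is_absop T).

Definition partial_isometry U : Prop :=
  bounded_operator U /\
  forall x, (forall k, U k = 0 -> inner H x k = 0) -> `|U x| = `|x|.

Definition is_polar T U : Prop :=
  [/\ partial_isometry U, T = U \o absop T & forall x, U x = 0 <-> T x = 0].

Definition polar T : H -> H := xget (fun=> 0) (is_polar T).

Definition spectrum A : set R[i] := [set z : R[i] | ~ exists B : H -> H,
  [/\ bounded_operator B, cancel (fun x => A x - z *: x) B
    & cancel B (fun x => A x - z *: x)]].

Definition poly_op (q : {poly R}) A : H -> H :=
  fun x => \sum_(i < size q) (q`_i)%:C%C *: iter i A x.

(* Continuous functional calculus for self-adjoint A, whose spectrum is real: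
   f(A) is the norm limit of q_n(A) for real polynomials q_n converging to f
   uniformly on the spectrum. *)
Definition is_cfc f A B : Prop :=
  bounded_operator B /\ exists q : nat -> {poly R},
    {uniform [set t : R | spectrum A t%:C%C],
       (fun n t => (q n).[t]) @ \oo --> f} /\
    opnorm (poly_op (q n) A \- B) @[n --> \oo] --> 0%E.

Definition cfc f A : H -> H := xget (fun=> 0) (is_cfc f A).

Definition compact_operator T : Prop :=
  linear T /\ precompact (T @` [set x : H | `|x| <= 1]).

Definition orthonormal_basis (E : set H) : Prop :=
  (forall e e', E e -> E e' -> inner H e e' = (e == e')%:R) /\
  (forall x, (forall e, E e -> inner H x e = 0) -> x = 0).

Definition onb : set H := xget set0 orthonormal_basis.

(* Only used for positive A, for which the sum is in [0, +oo] and does not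
   depend on the basis. *)
Definition trace A : \bar R :=
  \esum_(e in onb) (complex.Re (inner H (A e) e))%:E.

Definition trace_pow (r : R) X : \bar R :=
  trace (cfc (fun t => t `^ r) (absop X)).

Definition schatten_class p : set (H -> H) :=
  match p with
  | r%:E => [set X | compact_operator X /\ (trace_pow r X < +oo)%E]
  | +oo%E => bounded_operator
  | -oo%E => set0
  end.

Definition inv_exponent p : R := if p is r%:E then r^-1 else 0.

Definition schatten_norm p X : \bar R :=
  if `[< schatten_class p X >] then
    (if p is r%:E then (trace_pow r X) `^ r^-1 else opnorm X)%E
  else +oo%E.

Definition re_op X : H -> H := fun x => 2^-1 *: (X x + adjoint X x).

Definition numerical_radius p T : \bar R :=
  ereal_sup [set schatten_norm p (re_op (fun x => (cos t +i* sin t)%C *: T x))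
            | t in [set: R]].

Definition aluthge f g T : H -> H :=
  cfc f (absop T) \o polar T \o cfc g (absop T).

End Operators.

(* Main.v *)
(* Put F = f(|T|), G = g(|T|), X = Re(e^{it} T), Y = Re(e^{it} T~) for the
   Aluthge transform T~ = F U G, and Z = F^2 + G^2. The operators
   A = e^{it} F + G U^* and B = e^{it} F - G U^* satisfy the polarization identity
   4 X = A^* A - B^* B, while A A^* <= Z + 2 Y and B B^* <= Z - 2 Y because
   U^* U <= 1. For finite p, let (e_j) be an orthonormal eigenbasis of the compact
   operator X. Then 4^p sum_j |<X e_j, e_j>|^p is at most
   sum_j |A e_j|^(2p) + sum_j |B e_j|^(2p). If A A^* <= N, where N is compact with
   eigenvalues nu_k, then sum_j |A e_j|^(2p) <= sum_k nu_k^p by Jensen's inequality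
   for a doubly substochastic matrix, and the right-hand side is at most
   (|Z|_p + 2 |Y|_p)^p by Minkowski's inequality applied in an eigenbasis of
   N = Z + 2 Y, since sum_k |<S u_k, u_k>|^p <= tr |S|^p for compact self-adjoint S
   and orthonormal (u_k). Hence
   |X|_p <= 2^(1/p) (|Z|_p + 2 |Y|_p) / 4. For p = oo the same identities bound the
   quadratic form of X. *)
Require Import Defs.
From mathcomp Require Import all_boot all_order all_algebra.
From mathcomp Require Import all_classical all_reals all_analysis.
From mathcomp Require Import sesquilinear complex ring lra.

Set Implicit Arguments.
Unset Strict Implicit.
Unset Printing Implicit Defensive.

Import Order.TTheory GRing.Theory Num.Theory.
Import numFieldNormedType.Exports.

Local Open Scope classical_set_scope.
Local Open Scope ring_scope.

(** The operators [adjoint], [absop], [polar], [cfc] and the basis [onb] are selected by [xget] from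
    a predicate, so their properties are available only after an existence proof: hence Riesz
    representation, square roots, the polar decomposition, the spectral theorem for compact
    operators and Weierstrass approximation. The existence of [cfc] rests on bounding q(A) by the
    supremum of |q| on the spectrum; for self-adjoint [A] this comes from factoring q^2 - m^2 over
    the complex numbers, m being the norm of q(A). Schatten norms are compared through scalars only:
    [trace] refers to the fixed basis [onb], and Tonelli's theorem moves it to an eigenbasis. The
    factor 2^(1/p) counts two equal sums, one for A and one for B: |c - d|^p <= c^p + d^p for
    nonnegative c and d, with no convexity constant. The case of an infinite right-hand side is
    split off first; for finite p, finiteness is what makes Z and Y compact. *)

Lemma inv_succ_small (R : realType) (e : R) : 0 < e ->
  exists N : nat, forall n, (N <= n)%N -> n.+1%:R^-1 <= e.
Proof.
move=> e0; exists (Num.truncn e^-1) => n Nn.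
rewrite -[e]invrK lef_pV2 ?posrE ?invr_gt0//.
by rewrite (le_trans (ltW (truncnS_gt _)))// ler_nat.
Qed.
Arguments inv_succ_small {R} e.

(** * Geometry of Hilbert spaces *)

Section HilbertSpace.
Context {R : realType} {H : hilbertSpace R}.
Implicit Types (x y z : H) (a : R[i]) (s t : R).

Definition hnorm x : R := complex.Re `|x|.
Definition hre x y : R := complex.Re (inner H x y).

Lemma innerC x y : inner H x y = (inner H y x)^*%C.
Proof. by rewrite (@hermC _ _ _ _ (inner H)) expr0 mul1r. Qed.

Lemma innerDl x y z : inner H (x + y) z = inner H x z + inner H y z.
Proof. exact: linearDl. Qed.

Lemma innerZl a x y : inner H (a *: x) y = a * inner H x y.
Proof. exact: linearZl_LR. Qed.

Lemma innerDr x y z : inner H x (y + z) = inner H x y + inner H x z.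
Proof. by rewrite innerC innerDl rmorphD /= -!innerC. Qed.

Lemma innerZr a x y : inner H x (a *: y) = (a^*)%C * inner H x y.
Proof. by rewrite innerC innerZl rmorphM /= -innerC. Qed.

Lemma normE x : `|x| = (hnorm x)%:C%C.
Proof.
have := normr_ge0 x; rewrite /hnorm; case: `|x| => a b.
by rewrite lecE /= => /andP[/eqP -> _].
Qed.

Lemma hnorm_ge0 x : 0 <= hnorm x.
Proof. by have := normr_ge0 x; rewrite normE ler0c. Qed.

Lemma hnormE x : hre x x = hnorm x ^+ 2.
Proof. by rewrite /hre innerE normE -rmorphXn. Qed.

Lemma hreC x y : hre x y = hre y x.
Proof. by rewrite /hre innerC; case: (inner _ _ _). Qed.

Lemma hreDl x y z : hre (x + y) z = hre x z + hre y z.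
Proof. by rewrite /hre innerDl raddfD. Qed.

Lemma hreDr x y z : hre x (y + z) = hre x y + hre x z.
Proof. by rewrite hreC hreDl ![hre _ x]hreC. Qed.

Lemma hreZl s x y : hre (s%:C%C *: x) y = s * hre x y.
Proof. by rewrite /hre innerZl; case: (inner _ _ _) => u v /=; rewrite mul0r subr0. Qed.

Lemma hreZr s x y : hre x (s%:C%C *: y) = s * hre x y.
Proof. by rewrite hreC hreZl hreC. Qed.

Lemma hreNl x y : hre (- x) y = - hre x y.
Proof. by rewrite -scaleN1r -(rmorphN1 (real_complex R)) hreZl mulN1r. Qed.

Lemma hreNr x y : hre x (- y) = - hre x y.
Proof. by rewrite hreC hreNl hreC. Qed.

Lemma hreBl x y z : hre (x - y) z = hre x z - hre y z.
Proof. by rewrite hreDl hreNl. Qed.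

Lemma hreBr x y z : hre x (y - z) = hre x y - hre x z.
Proof. by rewrite hreDr hreNr. Qed.

Lemma hre0l y : hre 0 y = 0.
Proof. by rewrite -(subrr (0 : H)) hreBl subrr. Qed.

Lemma hre0r y : hre y 0 = 0.
Proof. by rewrite hreC hre0l. Qed.

(** Estimates use only the real form [hre]; its values at y and i y recover the complex inner
    product. *)
Lemma innerRI x y : inner H x y = (hre x y +i* hre x ('i%C *: y))%C.
Proof.
rewrite /hre innerZr; case: (inner _ _ _) => u v /=.
by rewrite mul0r sub0r mulN1r opprK.
Qed.

Lemma inner_eq0P x y : inner H x y = 0 <-> hre x y = 0 /\ hre x ('i%C *: y) = 0.
Proof. by rewrite innerRI; split=> [[-> ->]|[-> ->]]. Qed.

Lemma hnorm0 : hnorm 0 = 0.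
Proof. by rewrite /hnorm normr0. Qed.

Lemma hnorm_eq0 x : hnorm x = 0 -> x = 0.
Proof. by move=> x0; apply/eqP; rewrite -normr_eq0 normE x0. Qed.

Lemma hnorm_gt0 x : x != 0 -> 0 < hnorm x.
Proof. by rewrite -normr_gt0 normE ltcR. Qed.

Lemma hnormD x y : hnorm (x + y) <= hnorm x + hnorm y.
Proof. by have := ler_normD x y; rewrite !normE -rmorphD lecR. Qed.

Lemma hnormN x : hnorm (- x) = hnorm x.
Proof. by rewrite /hnorm normrN. Qed.

Lemma hnormB x y : hnorm (x - y) <= hnorm x + hnorm y.
Proof. by rewrite -(hnormN y) hnormD. Qed.

Lemma hnormBC x y : hnorm (x - y) = hnorm (y - x).
Proof. by rewrite -hnormN opprB. Qed.

Lemma hnormBT x y z : hnorm (x - z) <= hnorm (x - y) + hnorm (y - z).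
Proof. by rewrite -[x - z](subrKA y) hnormD. Qed.

Lemma hnormZ a x : hnorm (a *: x) = complex.Re `|a| * hnorm x.
Proof.
by rewrite /hnorm normrZ; rewrite normE normc_def /= mul0r subr0.
Qed.

Lemma hnormZr s x : hnorm (s%:C%C *: x) = `|s| * hnorm x.
Proof. by rewrite hnormZ normc_def /= expr0n /= addr0 sqrtr_sqr. Qed.

Lemma hnorm_i x : hnorm ('i%C *: x) = hnorm x.
Proof. by rewrite hnormZ normc_def /= expr0n expr1n add0r sqrtr1 mul1r. Qed.

Lemma hnormD_sqr x y : hnorm (x + y) ^+ 2 = hnorm x ^+ 2 + 2 * hre x y + hnorm y ^+ 2.
Proof. rewrite -!hnormE hreDl !hreDr [hre y x]hreC; ring. Qed.

Lemma hnormB_sqr x y : hnorm (x - y) ^+ 2 = hnorm x ^+ 2 - 2 * hre x y + hnorm y ^+ 2.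
Proof. by rewrite hnormD_sqr hreNr hnormN mulrN. Qed.

Lemma hre_le x y : hre x y <= hnorm x * hnorm y.
Proof.
have /orP[/eqP x0|x0] := orbN (x == 0); first by rewrite x0 hre0l hnorm0 mul0r.
have /orP[/eqP y0|y0] := orbN (y == 0); first by rewrite y0 hre0r hnorm0 mulr0.
have xp := hnorm_gt0 x0; have yp := hnorm_gt0 y0.
have := sqr_ge0 (hnorm ((hnorm y)%:C%C *: x - (hnorm x)%:C%C *: y)).
rewrite hnormB_sqr hreZl hreZr !hnormZr !ger0_norm ?hnorm_ge0//.
move=> h; have {}h : 0 <= (hnorm x * hnorm y) * (hnorm x * hnorm y - hre x y) by nra.
by move: h; rewrite pmulr_rge0 ?mulr_gt0// subr_ge0.
Qed.

Lemma hre_abs_le x y : `|hre x y| <= hnorm x * hnorm y.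
Proof.
rewrite ler_norml hre_le andbT -(opprK (hre x y)) lerN2 -hreNl.
by rewrite (le_trans (hre_le _ _))// hnormN.
Qed.

Lemma hre_eq0P x : (forall y, hre x y = 0) -> x = 0.
Proof.
by move=> /(_ x); rewrite hnormE => /eqP; rewrite sqrf_eq0 => /eqP/hnorm_eq0.
Qed.

Lemma le_sqr_hnorm x y (c : R) : 0 <= c -> hnorm x ^+ 2 <= (c * hnorm y) ^+ 2 ->
  hnorm x <= c * hnorm y.
Proof.
by move=> c0; rewrite ler_sqr ?nnegrE ?hnorm_ge0// mulr_ge0// hnorm_ge0.
Qed.

(** Balls of [H] have radii in [R[i]], whose positive elements are real; this is completeness with
    real tolerances. *)
Lemma hilbert_complete (u : nat -> H) :
  (forall e : R, 0 < e -> exists N, forall m n, (N <= m)%N -> (N <= n)%N ->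
     hnorm (u m - u n) <= e) ->
  exists l, forall e : R, 0 < e -> exists N, forall n, (N <= n)%N ->
     hnorm (u n - l) <= e.
Proof.
move=> uc.
have /cauchy_cvg/cvg_ex[l ul] : cauchy (u @ \oo).
  apply/cauchy_ballP => e e0.
  have er : e = (complex.Re e)%:C%C.
    by apply/esym; rewrite RRe_real// realE (ltW e0).
  have e0' : 0 < complex.Re e by move: e0; rewrite er ltcR.
  have [N Ns] := uc (complex.Re e / 2) ltac:(by rewrite divr_gt0).
  exists ([set u n | n in [set n | (N <= n)%N]], [set u n | n in [set n | (N <= n)%N]]).
    by split; exists N => // n /= Nn; exists n.
  move=> [_ _] [[m /= Nm <-] [n /= Nn <-]].
  rewrite -ball_normE /= normE er ltcR (le_lt_trans (Ns _ _ Nm Nn))//.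
  by rewrite ltr_pdivrMr// mulr_natr mulr2n ltrDl.
exists l => e e0.
have e0' : 0 < e%:C%C by rewrite ltcR.
move/cvgrPdist_le: ul => /(_ _ e0') [N _ Ns]; exists N => n Nn.
by have := Ns n Nn; rewrite /= normE lecR hnormBC.
Qed.

End HilbertSpace.

(** * Orthogonal projection onto a closed subspace *)

Section Projection.
Context {R : realType} {H : hilbertSpace R}.
Implicit Types (x y z : H) (a : R[i]) (s t : R) (M : set H).

Definition closed_subspace M :=
  [/\ M 0, forall a x y, M x -> M y -> M (a *: x + y)
    & forall x, (forall e : R, 0 < e -> exists2 y, M y & hnorm (x - y) <= e) -> M x].

Lemma minimal_distance M x : closed_subspace M ->
  exists2 p, M p & forall y, M y -> hnorm (x - p) <= hnorm (x - y).
Proof.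
move=> [M0 ML Mc].
pose S := [set hnorm (x - y) ^+ 2 | y in M].
have Slb : has_lbound S by exists 0 => _ [y _ <-]; rewrite sqr_ge0.
have Sn0 : S !=set0 by exists (hnorm (x - 0) ^+ 2), 0.
pose d := inf S.
have dle y : M y -> d <= hnorm (x - y) ^+ 2.
  by move=> My; apply: ge_inf => //; exists y.
have apx (n : nat) : exists y, M y /\ hnorm (x - y) ^+ 2 < d + n.+1%:R^-1.
  have [_ [y My <-] h] := @inf_adherent R S n.+1%:R^-1
    ltac:(by rewrite invr_gt0) (conj Sn0 Slb).
  by exists y.
have {apx}[u /all_and2[uM ud]] := choice apx.
(* Parallelogram law: the midpoint of [u m] and [u n] is in [M], so its squared distance to x is at
   least [d]. *)
have par m n : hnorm (u m - u n) ^+ 2 <= 2 * (m.+1%:R^-1 + n.+1%:R^-1).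
  have Mmn : M ((2^-1 : R)%:C%C *: (u m + u n)).
    have := ML 1 _ _ (uM m) (uM n); rewrite scale1r => h.
    by have := ML (2^-1 : R)%:C%C _ _ h M0; rewrite addr0.
  have hd := dle _ Mmn.
  have e1 : hnorm (u m - u n) ^+ 2 + 4 * hnorm (x - (2^-1 : R)%:C%C *: (u m + u n)) ^+ 2
     = 2 * hnorm (x - u m) ^+ 2 + 2 * hnorm (x - u n) ^+ 2.
    rewrite -!hnormE !(hreDl, hreDr, hreNl, hreNr, hreZl, hreZr).
    rewrite ![hre (u m) x]hreC ![hre (u n) x]hreC [hre (u n) (u m)]hreC.
    by field.
  move: e1 hd (ud m) (ud n); move: m.+1%:R^-1 n.+1%:R^-1 => rm rn *; lra.
have [p hp] : exists l, forall e : R, 0 < e -> exists N, forall n, (N <= n)%N ->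
     hnorm (u n - l) <= e.
  apply: hilbert_complete => e e0.
  have [N Ne] : exists N : nat, 4 / N.+1%:R <= e ^+ 2.
    exists (Num.truncn (4 / e ^+ 2)); rewrite ler_pdivrMr// mulrC -ler_pdivrMr ?exprn_gt0//.
    exact/ltW/truncnS_gt.
  exists N => m n Nm Nn.
  rewrite -(@ler_sqr _ (hnorm _)) ?nnegrE ?hnorm_ge0 ?(ltW e0)//.
  apply: le_trans (par m n) (le_trans _ Ne).
  have h k : (N <= k)%N -> k.+1%:R^-1 <= N.+1%:R^-1 :> R.
    by move=> Nk; rewrite lef_pV2 ?posrE// ler_nat.
  move: (h _ Nm) (h _ Nn); move: m.+1%:R^-1 n.+1%:R^-1 N.+1%:R^-1 => rm rn rN *; lra.
have pM : M p.
  apply: Mc => e e0; have [N hN] := hp e e0.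
  by exists (u N) => //; rewrite hnormBC; apply: hN.
exists p => // y My; rewrite leNgt; apply/negP => lt.
have d0 : 0 < hnorm (x - p) ^+ 2 - hnorm (x - y) ^+ 2.
  by rewrite subr_gt0 ltr_sqr ?nnegrE ?hnorm_ge0.
set D := hnorm (x - p) ^+ 2 - hnorm (x - y) ^+ 2 in d0.
have dy := dle y My.
pose b := hnorm (x - p).
have b0 : 0 <= b by apply: hnorm_ge0.
(* If y were closer by [D] in squared distance, this [e] would give [(b - e)^2 >= b^2 - D/2],
   whereas late terms of [u] lie at squared distance below [b^2 - 3/4 D]. *)
pose e := Num.min 1 (D / (4 * (b + 1))).
have e0 : 0 < e by rewrite lt_min ltr01 divr_gt0// mulr_gt0// ltr_wpDl.
have [N hN] := hp e e0.
have [K hK] : exists K : nat, K.+1%:R^-1 <= D / 4.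
  exists (Num.truncn (4 / D)); rewrite -[leRHS]invrK lef_pV2 ?posrE ?invr_gt0 ?divr_gt0//.
  by rewrite invf_div; exact/ltW/truncnS_gt.
have hn := hN (maxn N K) (leq_maxl _ _).
have hk : (maxn N K).+1%:R^-1 <= D / 4.
  by apply: le_trans hK; rewrite lef_pV2 ?posrE// ler_nat ltnS leq_maxr.
have hu := ud (maxn N K).
have tri : b <= hnorm (x - u (maxn N K)) + e.
  by apply: le_trans (hnormBT _ (u (maxn N K)) _) _; rewrite lerD2l.
have e1 : e <= 1 by rewrite ge_min lexx.
have eb : e * (4 * (b + 1)) <= D.
  by rewrite -ler_pdivlMr ?ge_min ?lexx ?orbT// mulr_gt0// ltr_wpDl.
have bD : b ^+ 2 = D + hnorm (x - y) ^+ 2 by rewrite /D /b; ring.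
have h0 := hnorm_ge0 (x - u (maxn N K)).
have h1 : hnorm (x - u (maxn N K)) ^+ 2 < b ^+ 2 - 3 / 4 * D.
  by move: hu hk; move: (_.+1%:R^-1) => r *; lra.
have [be|eb'] := leP e b; last by nra.
have : (b - e) ^+ 2 <= hnorm (x - u (maxn N K)) ^+ 2.
  by rewrite ler_sqr ?nnegrE ?subr_ge0// lerBlDr.
by have := sqr_ge0 e; nra.
Qed.

(** Moving p along a direction y of [M] cannot decrease the distance to x, so the linear term of a
    real quadratic in the step [s] vanishes. *)
Lemma projection M x : closed_subspace M ->
  exists2 p, M p & forall y, M y -> inner H (x - p) y = 0.
Proof.
move=> cM; have [p Mp pmin] := minimal_distance x cM; exists p => //.
have [M0 ML _] := cM.
have key y : M y -> hre (x - p) y = 0.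
  move=> My.
  have h s : 0 <= - (2 * s * hre (x - p) y) + s ^+ 2 * hnorm y ^+ 2.
    have := pmin _ (ML s%:C%C _ _ My Mp).
    rewrite opprD addrCA addrC -(@ler_sqr _ (hnorm _)) ?nnegrE ?hnorm_ge0//.
    rewrite [X in _ <= X -> _]hnormB_sqr hreZr hnormZr exprMn real_normK ?num_real// -subr_ge0.
    by move=> /le_trans; apply; lra.
  have [/eqP y0|yn0] := eqVneq (hnorm y ^+ 2) 0.
    by move: y0; rewrite sqrf_eq0 => /eqP/hnorm_eq0 ->; rewrite hre0r.
  have n0 : 0 < hnorm y ^+ 2 by rewrite lt_def yn0 sqr_ge0.
  have := h (hre (x - p) y / hnorm y ^+ 2).
  set c := hre _ _; set n := hnorm y ^+ 2 in yn0 n0 *.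
  have -> : - (2 * (c / n) * c) + (c / n) ^+ 2 * n = - (c ^+ 2 / n) by field.
  rewrite oppr_ge0 pmulr_lle0 ?invr_gt0// => c0.
  by apply/eqP; rewrite -sqrf_eq0 eq_le c0 sqr_ge0.
move=> y My; apply/inner_eq0P; split; first exact: key.
by apply: key; have := ML 'i%C _ _ My M0; rewrite addr0.
Qed.

End Projection.

(** * Bounded operators, adjoints and inverses *)

Section BoundedOperators.
Context {R : realType} {H : hilbertSpace R}.
Implicit Types (x y z : H) (a : R[i]) (s t : R) (S T U A B : H -> H).

Lemma linopD T : linear T -> forall x y, T (x + y) = T x + T y.
Proof. by move=> lT x y; rewrite -[x in LHS]scale1r lT scale1r. Qed.

Lemma linop0 T : linear T -> T 0 = 0.
Proof. by move=> lT; apply: (@addrI _ (T 0)); rewrite -linopD// !addr0. Qed.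

Lemma linopZ T : linear T -> forall a x, T (a *: x) = a *: T x.
Proof. by move=> lT a x; rewrite -[a *: x]addr0 lT linop0// addr0. Qed.

Lemma linopN T : linear T -> forall x, T (- x) = - T x.
Proof. by move=> lT x; rewrite -scaleN1r linopZ// scaleN1r. Qed.

Lemma linopB T : linear T -> forall x y, T (x - y) = T x - T y.
Proof. by move=> lT x y; rewrite linopD// linopN. Qed.

Lemma linop_sum T (I : Type) (r : seq I) (P : pred I) (F : I -> H) : linear T ->
  T (\sum_(i <- r | P i) F i) = \sum_(i <- r | P i) T (F i).
Proof.
by move=> lT; apply: (big_morph T (linopD lT)); apply: linop0.
Qed.

Lemma boundedP T : bounded_operator T <->
  linear T /\ exists2 M : R, 0 <= M & forall x, hnorm (T x) <= M * hnorm x.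
Proof.
split=> [[lT [M hM]]|[lT [M M0 hM]]]; split=> //.
  exists `|M| => // x; have := hM x; rewrite !normE -rmorphM lecR => /le_trans; apply.
  by rewrite ler_wpM2r ?hnorm_ge0// ler_norm.
by exists M => x; rewrite !normE -rmorphM lecR.
Qed.

Lemma bounded_lin T : bounded_operator T -> linear T.
Proof. by case. Qed.

Lemma bounded_comp S T :
  bounded_operator S -> bounded_operator T -> bounded_operator (S \o T).
Proof.
move=> /boundedP[lS [M M0 hM]] /boundedP[lT [N N0 hN]]; apply/boundedP; split.
  by move=> a x y /=; rewrite lT lS.
exists (M * N); first exact: mulr_ge0.
by move=> x /=; rewrite (le_trans (hM _))// -mulrA ler_wpM2l.
Qed.

Lemma bounded_add S T :
  bounded_operator S -> bounded_operator T -> bounded_operator (S \+ T).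
Proof.
move=> /boundedP[lS [M M0 hM]] /boundedP[lT [N N0 hN]]; apply/boundedP; split.
  by move=> a x y /=; rewrite lT lS scalerDr addrACA.
exists (M + N); first exact: addr_ge0.
by move=> x /=; rewrite (le_trans (hnormD _ _))// mulrDl lerD.
Qed.

Lemma bounded_scale a T : bounded_operator T -> bounded_operator (fun x => a *: T x).
Proof.
move=> /boundedP[lT [N N0 hN]]; apply/boundedP; split.
  by move=> b x y /=; rewrite lT scalerDr !scalerA mulrC.
have a0 : 0 <= complex.Re `|a| by rewrite normc_def /= sqrtr_ge0.
exists (complex.Re `|a| * N); first exact: mulr_ge0.
by move=> x /=; rewrite hnormZ -mulrA ler_wpM2l.
Qed.

Lemma bounded_id : bounded_operator (@id H).
Proof. by apply/boundedP; split=> //; exists 1 => // x; rewrite mul1r. Qed.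

Lemma inner_ext x y : (forall z, inner H z x = inner H z y) -> x = y.
Proof.
move=> h; apply/eqP; rewrite -subr_eq0; apply/eqP; apply: hre_eq0P => z.
by rewrite hreC hreBr /hre h subrr.
Qed.

Lemma innerNr x y : inner H x (- y) = - inner H x y.
Proof. by rewrite -scaleN1r innerZr rmorphN1 mulN1r. Qed.

Lemma innerNl x y : inner H (- x) y = - inner H x y.
Proof. by rewrite -scaleN1r innerZl mulN1r. Qed.

Lemma inner0r x : inner H x 0 = 0.
Proof. by rewrite -(scale0r (0 : H)) innerZr rmorph0 mul0r. Qed.

Lemma inner0l x : inner H 0 x = 0.
Proof. by rewrite -(scale0r (0 : H)) innerZl mul0r. Qed.

Lemma riesz T y : bounded_operator T -> exists z, forall x, inner H (T x) y = inner H x z.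
Proof.
move=> /boundedP[lT [C C0 hC]].
(* The kernel of the functional, closed because [T] is bounded. A nonzero [v] orthogonal to it
   represents the functional after rescaling. *)
pose M := [set x | inner H (T x) y = 0].
have cM : closed_subspace M.
  split; rewrite /M /=.
  - by rewrite linop0// inner0l.
  - by move=> a u v hu hv; rewrite lT innerDl innerZl hu hv mulr0 addr0.
  - move=> x hx.
    have key z : (forall v, M v -> hre (T v) z = 0) -> hre (T x) z = 0.
      move=> hz; apply/eqP; rewrite -normr_le0; apply/ler_addgt0Pr => e e0.
      have K0 : 0 < C * hnorm z + 1 by rewrite ltr_wpDl// mulr_ge0// hnorm_ge0.
      have [v Mv hv] := hx (e / (C * hnorm z + 1)) ltac:(by rewrite divr_gt0).
      have -> : hre (T x) z = hre (T (x - v)) z by rewrite linopB// hreBl (hz v)// subr0.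
      rewrite add0r (le_trans (hre_abs_le _ _))//.
      have h1 := hC (x - v); have h2 := hnorm_ge0 z.
      apply: le_trans (ler_wpM2r h2 h1) _; rewrite mulrAC.
      have := ler_wpM2l (mulr_ge0 C0 h2) hv => /le_trans; apply.
      rewrite mulrCA ger_pMr// ler_pdivrMr// mul1r; lra.
    apply/inner_eq0P; split; apply: key => v /inner_eq0P; by case.
have [all0|/existsNP[x0 nMx0]] := pselect (forall x, M x).
  by exists 0 => x; rewrite all0 inner0r.
have [p Mp hp] := projection x0 cM.
set v := x0 - p in hp.
have Tv : inner H (T v) y != 0.
  apply/eqP => h; apply: nMx0; rewrite /M /= -(subrK p x0) -/v linopD//.
  by rewrite innerDl h Mp addr0.
have v0 : inner H v v != 0.
  apply/eqP => /inner_eq0P[/eqP + _]; rewrite hnormE sqrf_eq0 => /eqP/hnorm_eq0 v0.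
  by move: Tv; rewrite v0 linop0// inner0l eqxx.
exists ((inner H (T v) y / inner H v v)^*%C *: v) => x.
have Mx : M (x - (inner H (T x) y / inner H (T v) y) *: v).
  by rewrite /M /= linopB// linopZ// innerDl innerNl innerZl divfK// subrr.
have := hp _ Mx; rewrite innerC => /(congr1 conjc); rewrite conjcK conjc0.
rewrite innerDl innerNl innerZl => /eqP; rewrite subr_eq0 => /eqP h.
by rewrite innerZr conjcK h; field; rewrite Tv v0.
Qed.

Lemma adjointP T : bounded_operator T -> is_adjoint T (adjoint T).
Proof.
move=> bT; apply: xgetPex.
have /choice[S hS] y : exists z, forall x, inner H (T x) y = inner H x z by exact: riesz.
exists S; split=> //.
move/boundedP: (bT) => [lT [C C0 hC]]; apply/boundedP; split.
  move=> a x y; apply: inner_ext => z.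
  by rewrite -hS !innerDr !innerZr -!hS.
exists C => // x.
have [/eqP h0|n0] := eqVneq (hnorm (S x)) 0.
  by rewrite (eqP h0) mulr_ge0// hnorm_ge0.
have p0 : 0 < hnorm (S x) by rewrite lt_def n0 hnorm_ge0.
(* |S x|^2 = <T (S x), x> <= C |S x| |x|, and one factor |S x| cancels. *)
rewrite -(ler_pM2l p0) -expr2 -hnormE /hre -hS -/(hre _ _).
apply: le_trans (hre_le _ _) _; rewrite mulrCA mulrA.
by rewrite ler_wpM2r ?hnorm_ge0// hC.
Qed.

Lemma adjoint_bounded T : bounded_operator T -> bounded_operator (adjoint T).
Proof. by move=> /adjointP[]. Qed.

Lemma adjoint_inner T x y : bounded_operator T ->
  inner H (T x) y = inner H x (adjoint T y).
Proof. by move=> /adjointP[_]; apply. Qed.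

Lemma adjoint_unique T S : bounded_operator T ->
  (forall x y, inner H (T x) y = inner H x (S y)) -> adjoint T = S.
Proof.
move=> bT hS; apply/funext => y; apply: inner_ext => x.
by rewrite -adjoint_inner.
Qed.

Definition selfadj A := bounded_operator A /\ forall x y, inner H (A x) y = inner H x (A y).

Lemma selfadjP A : linear A -> (forall x y, hre (A x) y = hre x (A y)) ->
  forall x y, inner H (A x) y = inner H x (A y).
Proof.
by move=> lA h x y; rewrite innerRI [RHS]innerRI !h linopZ.
Qed.

Lemma selfadj_hre A x y : selfadj A -> hre (A x) y = hre x (A y).
Proof. by case=> _ h; rewrite /hre h. Qed.

Lemma selfadj_adjoint A : selfadj A -> adjoint A = A.
Proof. by case=> bA hA; apply: adjoint_unique. Qed.

(** Expanding the real form <A x, x> at x + y makes the imaginary part of <A x, y> antisymmetric in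
    x and y; replacing x by i x turns this into symmetry of the real part. *)
Lemma positive_selfadj A : positive_operator A -> selfadj A.
Proof.
move=> [bA pA]; have lA := bounded_lin bA; split=> //.
have im0 x : complex.Im (inner H (A x) x) = 0 by apply: ger0_Im.
have sym x y : complex.Im (inner H (A x) y) = - complex.Im (inner H (A y) x).
  have := im0 (x + y); rewrite linopD// innerDl !innerDr !raddfD /= !im0 add0r addr0.
  by move=> /eqP; rewrite addr_eq0 => /eqP.
have ImI x y : complex.Im (inner H ('i%C *: x) y) = complex.Re (inner H x y).
  by rewrite innerZl; case: (inner _ _ _) => u v /=; rewrite mul0r mul1r add0r.
have ImIr x y : complex.Im (inner H x ('i%C *: y)) = - complex.Re (inner H x y).
  by rewrite innerZr; case: (inner _ _ _) => u v /=; rewrite mul0r mulN1r add0r.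
apply: selfadjP => // x y.
have := sym ('i%C *: x) y; rewrite linopZ// ImI ImIr opprK => h.
by rewrite /hre h [in RHS]innerC; case: (inner _ _ _).
Qed.

Lemma positive_hre A x : positive_operator A -> 0 <= hre (A x) x.
Proof. by case=> _ /(_ x); rewrite lecE => /andP[]. Qed.

(* The range of [A] is closed and has trivial orthogonal complement. *)
Lemma selfadj_invertible A (d : R) : selfadj A -> 0 < d ->
  (forall x, d * hnorm x <= hnorm (A x)) ->
  exists B, [/\ bounded_operator B, cancel A B & cancel B A].
Proof.
move=> [bA hA] d0 hd; have lA := bounded_lin bA.
have Ainj x y : A x = A y -> x = y.
  move=> e; apply/eqP; rewrite -subr_eq0; apply/eqP; apply: hnorm_eq0.
  have := hd (x - y); rewrite linopB// e subrr hnorm0 pmulr_rle0// => h.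
  by apply/eqP; rewrite eq_le h hnorm_ge0.
have cR : closed_subspace (range A).
  split; first by exists 0 => //; rewrite linop0.
  - by move=> a _ _ [x _ <-] [y _ <-]; exists (a *: x + y) => //; rewrite lA.
  - move=> y hy.
    have apx (n : nat) : exists x, hnorm (y - A x) <= n.+1%:R^-1.
      by have [_ [x _ <-] h] := hy n.+1%:R^-1 ltac:(by rewrite invr_gt0); exists x.
    have {apx}[u hu] := choice apx.
    have [l hl] : exists l, forall e : R, 0 < e -> exists N, forall n, (N <= n)%N ->
         hnorm (u n - l) <= e.
      apply: hilbert_complete => e e0.
      have [N hN] := inv_succ_small (d * e / 2) ltac:(by rewrite divr_gt0// mulr_gt0).
      exists N => m n Nm Nn; rewrite -(ler_pM2l d0) (le_trans (hd _))// linopB//.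
      rewrite (le_trans (hnormBT _ y _))// hnormBC.
      move: (hu m) (hu n) (hN m Nm) (hN n Nn).
      by move: m.+1%:R^-1 n.+1%:R^-1 => rm rn *; lra.
    exists l => //; apply/eqP; rewrite -subr_eq0; apply/eqP; apply: hnorm_eq0.
    apply/eqP; rewrite eq_le hnorm_ge0 andbT; apply/ler_addgt0Pr => e e0.
    move/boundedP: bA => [_ [C C0 hC]].
    have [N1 hN1] := inv_succ_small (e / 2) ltac:(by rewrite divr_gt0).
    have [N2 hN2] := hl (e / (2 * (C + 1))) ltac:(by rewrite divr_gt0// mulr_gt0// ltr_wpDl).
    pose n := maxn N1 N2.
    rewrite add0r (le_trans (hnormBT _ (A (u n)) _))// -linopB//.
    have h1 := hN1 n (leq_maxl _ _); have h2 := hN2 n (leq_maxr _ _).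
    have h3 := hu n; have h4 := hC (l - u n); rewrite hnormBC in h3.
    rewrite hnormBC in h2; have h5 := ler_wpM2l C0 h2.
    have h6 : C * (e / (2 * (C + 1))) <= e / 2.
      rewrite mulrA ler_pdivrMr ?mulr_gt0// ?ltr_wpDl//; nra.
    by rewrite [leRHS]splitr lerD// ?(le_trans h3 h1)// (le_trans h4 (le_trans h5 h6)).
have sur y : exists x, A x = y.
  have [_ [x _ <-] hp] := projection y cR; exists x.
  apply/esym/eqP; rewrite -subr_eq0; apply/eqP; apply: Ainj; rewrite linop0//.
  apply: inner_ext => z; rewrite inner0r -hA innerC hp ?conjc0//; by exists z.
have [B hB] := choice sur; exists B; split=> //; last by move=> x; apply: Ainj.
apply/boundedP; split; first by move=> a x y; apply: Ainj; rewrite hB lA !hB.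
exists d^-1; first by rewrite invr_ge0 ltW.
by move=> x; rewrite ler_pdivlMl// -[leRHS]/(hnorm x) -[x in leRHS]hB.
Qed.

End BoundedOperators.

(** * Functional calculus of self-adjoint operators *)

Section PolynomialCalculus.
Context {R : realType} {H : hilbertSpace R}.
Implicit Types (x y z : H) (a : R[i]) (s t c : R) (A B : H -> H) (p q r : {poly R[i]}).

(** Complex coefficients permit the splitting into linear factors in [cpoly_op_bounded_below];
    [poly_opE] embeds the real case. *)
Definition cpoly_op p A : H -> H := fun x => \sum_(i < size p) p`_i *: iter i A x.

Lemma cpoly_op_widen p A x n : (size p <= n)%N ->
  cpoly_op p A x = \sum_(i < n) p`_i *: iter i A x.
Proof.
move=> pn; rewrite /cpoly_op (big_ord_widen n (fun i => p`_i *: iter i A x))//.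
rewrite big_mkcond; apply: eq_bigr => i _; case: ltnP => // h.
by rewrite nth_default// scale0r.
Qed.

Lemma poly_opE (q : {poly R}) A : poly_op q A = cpoly_op (map_poly (real_complex R) q) A.
Proof.
apply/funext => x; rewrite /poly_op /cpoly_op size_map_poly.
by apply: eq_bigr => i _; rewrite coef_map.
Qed.

Lemma cpoly_opD p q A x : cpoly_op (p + q) A x = cpoly_op p A x + cpoly_op q A x.
Proof.
pose n := maxn (size p) (size q).
rewrite !(@cpoly_op_widen _ _ _ n) ?leq_maxl ?leq_maxr ?size_polyD// -big_split.
by apply: eq_bigr => i _; rewrite coefD scalerDl.
Qed.

Lemma cpoly_opZ a p A x : cpoly_op (a *: p) A x = a *: cpoly_op p A x.
Proof.
rewrite (@cpoly_op_widen _ _ _ (size p)) ?size_scale_leq// scaler_sumr.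
by apply: eq_bigr => i _; rewrite coefZ scalerA.
Qed.

Lemma cpoly_opC a A x : cpoly_op a%:P A x = a *: x.
Proof. by rewrite (@cpoly_op_widen _ _ _ 1) ?size_polyC_leq1// big_ord1 coefC. Qed.

Lemma cpoly_op0 A x : cpoly_op 0 A x = 0.
Proof. by rewrite /cpoly_op size_poly0 big_ord0. Qed.

Lemma cpoly_opMX p A x : cpoly_op (p * 'X) A x = cpoly_op p A (A x).
Proof.
rewrite (@cpoly_op_widen _ _ _ (size p).+1); last first.
  by have [->|p0] := eqVneq p 0; rewrite ?mul0r ?size_poly0// size_mulX.
rewrite big_ord_recl coefMX scale0r add0r.
by apply: eq_bigr => i _; rewrite coefMX lift0 /= -iterSr.
Qed.

Lemma cpoly_opX A x : cpoly_op 'X A x = A x.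
Proof. by rewrite -[X in cpoly_op X]mul1r cpoly_opMX cpoly_opC scale1r. Qed.

Lemma iter_linear A n : linear A -> linear (iter n A).
Proof. by move=> lA; elim: n => [|n IH] a x y //=; rewrite IH lA. Qed.

Lemma cpoly_op_linear p A : linear A -> linear (cpoly_op p A).
Proof.
move=> lA a x y; rewrite /cpoly_op scaler_sumr -big_split; apply: eq_bigr => i _.
by rewrite (iter_linear i lA) scalerDr !scalerA mulrC.
Qed.

Lemma cpoly_op_comm p A x : linear A -> cpoly_op p A (A x) = A (cpoly_op p A x).
Proof.
move=> lA; rewrite /cpoly_op linop_sum//; apply: eq_bigr => i _.
by rewrite linopZ// -iterSr.
Qed.

Lemma cpoly_opM p q A x : linear A -> cpoly_op (p * q) A x = cpoly_op p A (cpoly_op q A x).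
Proof.
move=> lA; elim/poly_ind: p x => [|p c IH] x; first by rewrite mul0r !cpoly_op0.
rewrite mulrDl mulrAC !cpoly_opD !cpoly_opMX IH cpoly_op_comm//.
by rewrite mul_polyC cpoly_opZ cpoly_opC.
Qed.

Lemma bounded0 : bounded_operator (fun=> 0 : H).
Proof.
apply/boundedP; split; first by move=> a x y; rewrite scaler0 addr0.
by exists 0 => // x; rewrite hnorm0 mul0r.
Qed.

Lemma cpoly_op_bounded p A : bounded_operator A -> bounded_operator (cpoly_op p A).
Proof.
move=> bA; elim/poly_ind: p => [|p c IH].
  by have -> : cpoly_op 0 A = fun=> 0; [apply/funext => x; rewrite cpoly_op0|exact: bounded0].
have -> : cpoly_op (p * 'X + c%:P) A = (cpoly_op p A \o A) \+ (fun x => c *: x).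
  by apply/funext => x; rewrite cpoly_opD cpoly_opMX cpoly_opC.
apply: bounded_add; first exact: bounded_comp.
exact: bounded_scale bounded_id.
Qed.

Lemma poly_op_selfadj (q : {poly R}) A : selfadj A -> selfadj (poly_op q A).
Proof.
move=> [bA hA]; split; first by rewrite poly_opE; exact: cpoly_op_bounded.
have sI n x y : inner H (iter n A x) y = inner H x (iter n A y).
  by elim: n x y => [|n IH] x y //=; rewrite hA IH -iterSr.
have sumr (F : nat -> H) n x : inner H x (\sum_(i < n) F i) = \sum_(i < n) inner H x (F i).
  elim: n => [|n IH]; first by rewrite !big_ord0 inner0r.
  by rewrite !big_ord_recr /= innerDr IH.
have suml (F : nat -> H) n x : inner H (\sum_(i < n) F i) x = \sum_(i < n) inner H (F i) x.
  elim: n => [|n IH]; first by rewrite !big_ord0 inner0l.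
  by rewrite !big_ord_recr /= innerDl IH.
move=> x y; rewrite /poly_op (suml (fun i => (q`_i)%:C%C *: iter i A x))
  (sumr (fun i => (q`_i)%:C%C *: iter i A y)).
by apply: eq_bigr => i _; rewrite innerZl innerZr sI conjc_real.
Qed.

Lemma poly_op_linear (q : {poly R}) A : linear A -> linear (poly_op q A).
Proof. by move=> lA; rewrite poly_opE; exact: cpoly_op_linear. Qed.

Lemma poly_opM (q r : {poly R}) A x : linear A ->
  poly_op (q * r) A x = poly_op q A (poly_op r A x).
Proof. by move=> lA; rewrite !poly_opE rmorphM /= cpoly_opM. Qed.

Lemma poly_opB (q r : {poly R}) A x :
  poly_op (q - r) A x = poly_op q A x - poly_op r A x.
Proof.
rewrite !poly_opE rmorphB /= cpoly_opD; congr (_ + _).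
by rewrite -scaleN1r cpoly_opZ scaleN1r.
Qed.

Lemma poly_opX A x : poly_op 'X A x = A x.
Proof. by rewrite poly_opE map_polyX cpoly_opX. Qed.

Lemma poly_opC s A x : poly_op s%:P A x = s%:C%C *: x.
Proof. by rewrite poly_opE map_polyC cpoly_opC. Qed.

Lemma poly_op_eigen (q : {poly R}) A x s : linear A -> A x = s%:C%C *: x ->
  poly_op q A x = (q.[s])%:C%C *: x.
Proof.
move=> lA Ax; elim/poly_ind: q => [|q c IH].
  by rewrite poly_opC horner0.
have -> : q * 'X + c%:P = 'X * q - (- c)%:P by rewrite polyCN opprK mulrC.
rewrite poly_opB poly_opM// IH poly_opX linopZ// Ax poly_opC !hornerE scalerA.
by rewrite -scaleNr -scalerDl -rmorphM -rmorphN -rmorphD /= opprK mulrC.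
Qed.

(** A substitute for invertibility that passes to compositions, hence to products of linear
    factors. *)
Definition bounded_below B := exists2 d : R, 0 < d & forall x, d * hnorm x <= hnorm (B x).

(** Off the real axis, |Im a| |x|^2 is the modulus of the imaginary part of <(A - a) x, x>, because
    <A x, x> is real. On the axis, the bounded inverse gives the estimate. *)
Lemma resolvent_bounded_below A a : selfadj A ->
  (complex.Im a = 0 -> ~ spectrum A a) -> bounded_below (fun x => A x - a *: x).
Proof.
move=> sA hs; have [bA hA] := sA; have lA := bounded_lin bA.
have [/eqP/hs/contrapT[B [bB AB BA]]|im0] := boolP (complex.Im a == 0).
  move/boundedP: bB => [_ [C C0 hC]].
  exists (C + 1)^-1; first by rewrite invr_gt0 ltr_wpDl.
  move=> x; rewrite ler_pdivrMl ?ltr_wpDl// -{1}(AB x) (le_trans (hC _))//.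
  by rewrite ler_wpM2r ?hnorm_ge0// lerDl.
exists `|complex.Im a|; first by rewrite normr_gt0.
move=> x; have [x0|xn] := eqVneq (hnorm x) 0; first by rewrite x0 mulr0 hnorm_ge0.
have xp : 0 < hnorm x by rewrite lt_def xn hnorm_ge0.
rewrite -(ler_pM2r xp) -mulrA -expr2.
have -> : `|complex.Im a| * hnorm x ^+ 2 = `|hre (A x - a *: x) ('i%C *: x)|.
  rewrite hreBl.
  have -> : hre (A x) ('i%C *: x) = 0.
    have : inner H (A x) x = (inner H (A x) x)^*%C by rewrite {1}hA innerC.
    by rewrite innerRI => -[] e; lra.
  rewrite sub0r normrN /hre innerZr innerZl innerRI.
  have -> : hre x ('i%C *: x) = 0.
    by have := innerC x x; rewrite innerRI => -[] e; lra.
  rewrite hnormE; case: (a) => u v /=.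
  rewrite -[X in _ * X]ger0_norm ?sqr_ge0// -normrM; congr `|_|; ring.
by rewrite (le_trans (hre_abs_le _ _))// hnorm_i.
Qed.

Lemma bounded_below_comp A B :
  bounded_below A -> bounded_below B -> bounded_below (A \o B).
Proof.
move=> [d d0 hd] [e e0 he]; exists (d * e); first exact: mulr_gt0.
by move=> x /=; rewrite -mulrA (le_trans _ (hd _))// ler_wpM2l// ltW.
Qed.

(** Half of the spectral mapping theorem: [p] splits into factors 'X - z, and each of them is
    bounded below at [A], the nonreal z at no cost. *)
Lemma cpoly_op_bounded_below p A : selfadj A -> p != 0 ->
  (forall t, spectrum A t%:C%C -> ~~ root p t%:C%C) -> bounded_below (cpoly_op p A).
Proof.
move=> sA p0 hp; have lA := bounded_lin sA.1.
have [rs prs] := closed_field_poly_normal p.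
have l0 : lead_coef p != 0 by rewrite lead_coef_eq0.
have {hp} hrs (z : R[i]) : z \in rs -> complex.Im z = 0 -> ~ spectrum A z.
  case: z => u v zr /= v0; rewrite {}v0 in zr *; move=> /hp /negP; apply.
  by rewrite prs rootZ// root_prod_XsubC.
have : bounded_below (cpoly_op (\prod_(z <- rs) ('X - z%:P)) A).
  elim: rs hrs {prs} => [|z rs IH] hrs.
    rewrite big_nil; exists 1 => // x.
    by rewrite -[X in cpoly_op X]/(1%:P) cpoly_opC scale1r mul1r.
  rewrite big_cons.
  have -> : cpoly_op (('X - z%:P) * \prod_(j <- rs) ('X - j%:P)) A =
      (fun x => A x - z *: x) \o cpoly_op (\prod_(j <- rs) ('X - j%:P)) A.
    by apply/funext => x; rewrite cpoly_opM// cpoly_opD cpoly_opX -polyCN cpoly_opC scaleNr.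
  apply: bounded_below_comp; last first.
    by apply: IH => w wr; apply: hrs; rewrite inE wr orbT.
  by apply: resolvent_bounded_below => // /hrs; apply; rewrite inE eqxx.
move=> [d d0 hd]; exists (complex.Re `|lead_coef p| * d).
  apply: mulr_gt0 => //; have := l0; rewrite -normr_gt0 normc_def ltcR; exact.
move=> x; rewrite {2}prs cpoly_opZ hnormZ -mulrA ler_wpM2l//.
by rewrite normc_def /= sqrtr_ge0.
Qed.

Lemma operator_norm B : bounded_operator B -> exists2 m : R, 0 <= m &
  (forall x, hnorm (B x) <= m * hnorm x) /\
  forall c, 0 <= c -> (forall x, hnorm (B x) <= c * hnorm x) -> m <= c.
Proof.
move=> /boundedP[lB [C C0 hC]].
pose D := [set c : R | 0 <= c /\ forall x, hnorm (B x) <= c * hnorm x].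
have D0 : D !=set0 by exists C.
have Dl : has_lbound D by exists 0 => c [].
exists (inf D); first by apply: lb_le_inf => // c [].
split; last by move=> c c0 hc; apply: ge_inf.
move=> x; have [x0|xn] := eqVneq (hnorm x) 0.
  by rewrite x0 mulr0 -(mulr0 C) -x0.
have xp : 0 < hnorm x by rewrite lt_def xn hnorm_ge0.
rewrite -ler_pdivrMr//; apply: lb_le_inf => // c [c0 hc].
by rewrite ler_pdivrMr.
Qed.

(* If [m] is the norm of the self-adjoint operator [S = q(A)], then [S^2 - m^2]
   is not bounded below, so that one of the roots of [q^2 - m^2] is in the
   spectrum of [A]. *)
Lemma poly_op_norm_aux A (q : {poly R}) m x0 : selfadj A -> x0 != 0 -> 0 <= m ->
  q ^+ 2 - (m ^+ 2)%:P != 0 ->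
  (forall x, hnorm (poly_op q A x) <= m * hnorm x) ->
  (forall c, 0 <= c -> (forall x, hnorm (poly_op q A x) <= c * hnorm x) -> m <= c) ->
  exists2 t, spectrum A t%:C%C & q.[t] ^+ 2 = m ^+ 2.
Proof.
move=> sA x0n m0 r0 hm hmin; apply: contrapT => hno.
have lA := bounded_lin sA.1.
set S := poly_op q A in hm hmin.
have sS : selfadj S by exact: poly_op_selfadj.
have : bounded_below (cpoly_op (map_poly (real_complex R) (q ^+ 2 - (m ^+ 2)%:P)) A).
  apply: cpoly_op_bounded_below => //; first by rewrite map_poly_eq0.
  move=> t st; apply/negP; rewrite fmorph_root /root !hornerE subr_eq0 => /eqP e.
  by apply: hno; exists t => //; rewrite e.
rewrite -poly_opE => -[d d0 hd].
(* Expand |S (S x) - m^2 x|^2 and use |S (S x)| <= m |S x|. The resulting bound |S x|^2 <= (m^2 -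
   d^2 / m^2) |x|^2 contradicts the minimality of [m]. *)
have {}hd x : d ^+ 2 * hnorm x ^+ 2 <= m ^+ 2 * (m ^+ 2 * hnorm x ^+ 2 - hnorm (S x) ^+ 2).
  have := hd x; rewrite poly_opB expr2 poly_opM// poly_opC -/S => h.
  have {}h : (d * hnorm x) ^+ 2 <= hnorm (S (S x) - (m ^+ 2)%:C%C *: x) ^+ 2.
    by rewrite ler_sqr ?nnegrE ?hnorm_ge0// mulr_ge0// ?hnorm_ge0// ltW.
  move: h; rewrite hnormB_sqr hreZr selfadj_hre// hnormE hnormZr.
  rewrite ger0_norm ?sqr_ge0//.
  have : hnorm (S (S x)) ^+ 2 <= (m * hnorm (S x)) ^+ 2.
    by rewrite ler_sqr ?nnegrE ?hnorm_ge0// mulr_ge0// hnorm_ge0.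
  nra.
have n0 := hnorm_gt0 x0n.
have mp : 0 < m.
  rewrite lt_def m0 andbT; apply/eqP => me; have := hd x0.
  by rewrite me expr0n /= mul0r leNgt mulr_gt0// exprn_gt0.
have m2 : 0 < m ^+ 2 by rewrite exprn_gt0.
have key x : hnorm (S x) ^+ 2 <= (m ^+ 2 - d ^+ 2 / m ^+ 2) * hnorm x ^+ 2.
  have := hd x; rewrite -ler_pdivrMl// mulrA [_^-1 * _]mulrC mulrBl => h.
  lra.
have c0 : 0 <= m ^+ 2 - d ^+ 2 / m ^+ 2.
  have := le_trans (sqr_ge0 _) (key x0).
  by rewrite pmulr_lge0// exprn_gt0.
have := hmin (Num.sqrt (m ^+ 2 - d ^+ 2 / m ^+ 2)) (sqrtr_ge0 _).
have h x : hnorm (S x) <= Num.sqrt (m ^+ 2 - d ^+ 2 / m ^+ 2) * hnorm x.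
  by apply: le_sqr_hnorm; rewrite ?sqrtr_ge0// exprMn sqr_sqrtr.
move=> /(_ h); rewrite -(@ler_sqr _ m) ?nnegrE ?sqrtr_ge0// sqr_sqrtr//.
by rewrite lerBrDl gerDr leNgt divr_gt0// exprn_gt0.
Qed.

(** The case [q = 'X] of [poly_op_norm_aux]: the norm of [A] or its opposite is in the spectrum. *)
Lemma spectrum_nonempty A x0 : selfadj A -> x0 != 0 -> exists t, spectrum A t%:C%C.
Proof.
move=> sA x0n; have [m m0 [hm hmin]] := operator_norm sA.1.
have e : poly_op 'X A = A by apply/funext => x; rewrite poly_opX.
suff [t st _] : exists2 t, spectrum A t%:C%C & ('X : {poly R}).[t] ^+ 2 = m ^+ 2 by exists t.
apply: (@poly_op_norm_aux A 'X m x0) => //; rewrite ?e//.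
rewrite -size_poly_eq0 size_polyDl ?size_polyXn// size_polyN.
by rewrite (leq_ltn_trans (size_polyC_leq1 _)).
Qed.

Lemma poly_op_norm A (q : {poly R}) c : selfadj A -> 0 <= c ->
  (forall t, spectrum A t%:C%C -> `|q.[t]| <= c) ->
  forall x, hnorm (poly_op q A x) <= c * hnorm x.
Proof.
move=> sA c0 hc x.
have [->|x0] := eqVneq x 0.
  by rewrite linop0 ?hnorm0 ?mulr0//; exact: poly_op_linear (bounded_lin sA.1).
have [m m0 [hm hmin]] := operator_norm (poly_op_selfadj q sA).1.
have [t st qt] : exists2 t, spectrum A t%:C%C & q.[t] ^+ 2 = m ^+ 2.
  (* If q^2 is the constant m^2, any point of the spectrum will do, and there is one since x is
     nonzero. *)
  have [e|ne] := eqVneq (q ^+ 2 - (m ^+ 2)%:P) 0; last exact: poly_op_norm_aux x0 _ ne _ _.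
  have [t st] := spectrum_nonempty sA x0; exists t => //.
  have := congr1 (horner^~ t) e; rewrite !hornerE => /eqP.
  by rewrite subr_eq0 => /eqP.
apply: le_trans (hm x) _; rewrite ler_wpM2r ?hnorm_ge0//.
rewrite -(ger0_norm m0) (le_trans _ (hc t st))//.
by rewrite -(@ler_sqr _ `|m|) ?nnegrE// !real_normK ?num_real// qt.
Qed.

End PolynomialCalculus.

(** * Bernstein polynomials and the Weierstrass theorem *)

Section BernsteinApproximation.
Context {R : realType}.
Implicit Types (x a c M : R) (phi psi f : nat -> R).

(* Pascal's rule for the Bernstein operator
   [sum_(k <= n) phi k * 'C(n, k) * 'X^k * (1 - 'X)^(n - k)]. *)
Fixpoint bernstein n phi : {poly R} :=
  if n is m.+1 then (1 - 'X) * bernstein m phi + 'X * bernstein m (phi \o S)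
  else (phi 0)%:P.

Lemma bernsteinS n phi x : (bernstein n.+1 phi).[x] =
  (1 - x) * (bernstein n phi).[x] + x * (bernstein n (phi \o S)).[x].
Proof. by rewrite /= !hornerE. Qed.

Lemma bernstein_le n phi psi x : 0 <= x <= 1 ->
  (forall k, (k <= n)%N -> phi k <= psi k) -> (bernstein n phi).[x] <= (bernstein n psi).[x].
Proof.
move=> /andP[x0 x1]; elim: n phi psi => [|n IH] phi psi h; first by rewrite !hornerC h.
rewrite !bernsteinS lerD// ler_wpM2l ?subr_ge0//; apply: IH => k kn.
  by apply: h; rewrite ltnW.
exact: h.
Qed.

Lemma bernstein_affine n phi a c x :
  (bernstein n (fun k => a * phi k + c)).[x] = a * (bernstein n phi).[x] + c.
Proof.
elim: n phi => [|n IH] phi; first by rewrite !hornerC.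
rewrite !bernsteinS IH.
have -> : bernstein n ((fun k => a * phi k + c) \o S) =
  bernstein n (fun k => a * (phi \o S) k + c) by [].
by rewrite IH; ring.
Qed.

(** The second moment about [a] of a binomial variable: its variance plus the squared deviation of
    its mean. *)
Lemma bernstein_sqr n a x : (bernstein n (fun k => (k%:R - a) ^+ 2)).[x] =
  n%:R * x * (1 - x) + (n%:R * x - a) ^+ 2.
Proof.
elim: n a => [|n IH] a; first by rewrite hornerC; ring.
rewrite bernsteinS IH.
have -> : bernstein n ((fun k => (k%:R - a) ^+ 2) \o S) =
    bernstein n (fun k => (k%:R - (a - 1)) ^+ 2).
  by congr bernstein; apply/funext => k /=; rewrite -natr1; ring.
by rewrite IH -natr1; ring.
Qed.

(** A quadratic majorant can be pushed through the monotone Bernstein operator, whose value on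
    squares is explicit, without splitting sums. Near points use continuity; for far points the
    quadratic term exceeds the oscillation [B]. *)
Lemma continuous_quadratic_modulus (f : R -> R) M (e : R) : 0 <= M -> 0 < e ->
  {within `[0, M], continuous f} ->
  exists2 C : R, 0 <= C & forall s t, s \in `[0, M] -> t \in `[0, M] ->
    `|f s - f t| <= e + C * (s - t) ^+ 2.
Proof.
move=> M0 e0 cf.
have [tM _ hM] := EVT_max M0 cf; have [tm _ hm] := EVT_min M0 cf.
pose B := f tM - f tm.
have hB s t : s \in `[0, M] -> t \in `[0, M] -> `|f s - f t| <= B.
  move=> sI tI; rewrite /B ler_norml.
  by have := hM _ sI; have := hm _ sI; have := hM _ tI; have := hm _ tI; lra.
(* Compactness turns the constants found near each t into a single one. *)
have /compact_near_coveringP/near_covering_withinP nc := @segment_compact R 0 M.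
have : \forall n \near \oo, `[0, M]%classic `<=` (fun t => forall s, s \in `[0, M] ->
    `|f s - f t| <= e + n%:R * (s - t) ^+ 2).
  apply: nc => t tI.
  move/subspace_continuousP: (cf) => /(_ t tI)/cvgrPdist_le/(_ (e / 2)).
  rewrite divr_gt0// => /(_ isT); rewrite near_withinE => /nbhs_ballP[d /= d0 hd].
  have [K hK] : exists K : nat, B <= K%:R * (d / 2) ^+ 2.
    exists (Num.truncn (B / (d / 2) ^+ 2)).+1.
    by rewrite -ler_pdivrMr ?exprn_gt0 ?divr_gt0//; exact/ltW/truncnS_gt.
  exists (ball t (d / 2), [set n | (K <= n)%N]).
    by split; [exact: nbhsx_ballx (divr_gt0 d0 _)|exists K].
  move=> [t' n] /= [bt Kn] t'I s sI.
  have n0 : 0 <= n%:R * (s - t') ^+ 2 by rewrite mulr_ge0// sqr_ge0.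
  have [near|far] := ltP `|t' - s| (d / 2).
    have h1 : `|f t - f s| <= e / 2.
      apply: hd; last by [].
      by apply: (@ball_split _ _ t') => //; rewrite -ball_normE.
    have h2 : `|f t - f t'| <= e / 2.
      apply: hd; last by [].
      by apply: le_ball bt; rewrite ler_pdivrMr// mulr_natr mulr2n lerDl ltW.
    rewrite -[f s - f t'](subrKA (f t)) (le_trans (ler_normD _ _))//.
    by rewrite distrC; lra.
  apply: le_trans (hB _ _ sI t'I) _; apply: le_trans hK _.
  apply: (@le_trans _ _ (n%:R * (s - t') ^+ 2)); last by rewrite lerDr ltW.
  apply: ler_pM; rewrite ?ler_nat ?sqr_ge0//.
  rewrite -(real_normK (num_real (s - t'))) ler_sqr ?nnegrE//.
    by rewrite distrC.
  by rewrite divr_ge0// ltW.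
move=> [K _ hK]; exists K%:R => // s t sI tI.
by apply: (hK K) => //=.
Qed.

Lemma weierstrass_approximation (f : R -> R) M (e : R) : 0 < M -> 0 < e ->
  {within `[0, M], continuous f} ->
  exists q : {poly R}, forall t, t \in `[0, M] -> `|q.[t] - f t| <= e.
Proof.
move=> M0 e0 cf.
have e20 : 0 < e / 2 by rewrite divr_gt0.
have [C C0 hC] := continuous_quadratic_modulus (ltW M0) e20 cf.
have [n n0 hn] : exists2 n : nat, (0 < n)%N & C * M ^+ 2 / n%:R <= e / 2.
  exists (Num.truncn (C * M ^+ 2 / (e / 2))).+1 => //.
  rewrite ler_pdivrMr// -ler_pdivrMl// [leLHS]mulrC.
  exact/ltW/truncnS_gt.
have nn0 : 0 < n%:R :> R by rewrite ltr0n.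
pose phi (k : nat) := f (M * (k%:R / n%:R)).
(* The composition rescales [[0, M]] to [[0, 1]]. The error is [e / 2] plus [D] times the variance n
   x (1 - x), a term at most C M^2 / n. *)
exists (bernstein n phi \Po (M^-1 *: 'X)) => t; rewrite in_itv /= => /andP[t0 tM].
rewrite horner_comp !hornerE; set x := M^-1 * t.
have x01 : 0 <= x <= 1.
  by rewrite /x mulr_ge0 ?invr_ge0 ?(ltW M0)//= mulrC ler_pdivrMr// mul1r.
have tx : t = M * x by rewrite /x mulVKf// gt_eqF.
have /andP[x0 x1] := x01.
pose D := C * M ^+ 2 / n%:R ^+ 2.
have hphi k : (k <= n)%N ->
    `|phi k - f t| <= D * (k%:R - n%:R * x) ^+ 2 + e / 2.
  move=> kn; rewrite /phi tx (le_trans (hC _ _ _ _))//.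
  - rewrite in_itv /= !mulr_ge0 ?(ltW M0) ?invr_ge0//= -[leRHS]mulr1 ler_wpM2l ?(ltW M0)//.
    by rewrite ler_pdivrMr// mul1r ler_nat.
  - by rewrite in_itv /= -tx t0.
  - rewrite addrC lerD2r /D.
    have -> : M * (k%:R / n%:R) - M * x = M / n%:R * (k%:R - n%:R * x).
      by field; rewrite gt_eqF.
    by rewrite exprMn expr_div_n !mulrA.
have hD : D * (n%:R * x * (1 - x)) <= e / 2.
  apply: le_trans hn; rewrite /D.
  have -> : C * M ^+ 2 / n%:R ^+ 2 * (n%:R * x * (1 - x)) = C * M ^+ 2 / n%:R * (x * (1 - x)).
    by field; rewrite gt_eqF.
  apply: ler_piMr; last by nra.
  by rewrite !mulr_ge0// ?invr_ge0 ?exprn_ge0// ltW.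
rewrite ler_norml; apply/andP; split.
  have h k : (k <= n)%N -> - D * (k%:R - n%:R * x) ^+ 2 + (f t - e / 2) <= phi k.
    by move=> /hphi; rewrite ler_norml => /andP[h _]; lra.
  have := bernstein_le x01 h; rewrite bernstein_affine bernstein_sqr subrr; lra.
have h k : (k <= n)%N -> phi k <= D * (k%:R - n%:R * x) ^+ 2 + (f t + e / 2).
  by move=> /hphi; rewrite ler_norml => /andP[_ h]; lra.
have := bernstein_le x01 h; rewrite bernstein_affine bernstein_sqr subrr; lra.
Qed.

End BernsteinApproximation.

(** * Continuous functional calculus and location of the spectrum *)

Section ContinuousCalculus.
Context {R : realType} {H : hilbertSpace R}.
Implicit Types (x y z : H) (a : R[i]) (s t c M : R) (A B C D T S : H -> H) (q : {poly R})
  (f g h : R -> R).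

Lemma opnorm_leP T c : linear T -> 0 <= c ->
  (opnorm T <= c%:E)%E <-> forall x, hnorm (T x) <= c * hnorm x.
Proof.
move=> lT c0; split=> [h x|h].
  have [->|x0] := eqVneq x 0; first by rewrite linop0// hnorm0 mulr0.
  have xp := hnorm_gt0 x0.
  have : ((complex.Re `|T ((hnorm x)^-1%:C%C *: x)|)%:E <= c%:E)%E.
    apply: le_trans h; apply: ereal_sup_ubound; exists ((hnorm x)^-1%:C%C *: x) => //=.
    by rewrite normE hnormZr ger0_norm ?invr_ge0 ?hnorm_ge0// mulVf ?gt_eqF.
  rewrite lee_fin -/(hnorm _) linopZ// hnormZr ger0_norm ?invr_ge0 ?hnorm_ge0//.
  by rewrite ler_pdivrMl// mulrC.
apply: ge_ereal_sup => _ [x /= x1 <-]; rewrite lee_fin -/(hnorm _).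
apply: le_trans (h x) _; rewrite -[leRHS]mulr1 ler_wpM2l//.
by move: x1; rewrite normE lecR.
Qed.

Lemma opnorm_ge0 T : linear T -> (0 <= opnorm T)%E.
Proof.
move=> lT; apply: le_ereal_sup_tmp; exists (complex.Re `|T 0|)%:E.
  by exists 0 => //=; rewrite normr0.
by rewrite lee_fin hnorm_ge0.
Qed.

(** Epsilon form of [is_cfc], with one polynomial per tolerance; [is_cfcP] shows the equivalence for
    linear [A]. *)
Definition cfc_approx f A B := bounded_operator B /\
  forall e : R, 0 < e -> exists q, (forall t, spectrum A t%:C%C -> `|q.[t] - f t| <= e) /\
    forall x, hnorm (poly_op q A x - B x) <= e * hnorm x.

Lemma is_cfcP f A B : linear A -> is_cfc f A B <-> cfc_approx f A B.
Proof.
move=> lA; split=> -[bB].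
  move=> [q [qf qB]]; split=> // e e0.
  have lD n : linear (poly_op (q n) A \- B).
    by move=> a x y /=; rewrite poly_op_linear// (bounded_lin bB) scalerBr opprD addrACA.
  have U : \forall n \near \oo, forall t, spectrum A t%:C%C -> `|(q n).[t] - f t| <= e.
    apply: (qf [set h | forall t, spectrum A t%:C%C -> `|h t - f t| <= e]).
    apply/uniform_nbhs; exists [set xy | ball xy.1 e xy.2]; split.
      exact: (entourage_ball _ (PosNum e0)).
    by move=> h hh t /hh; rewrite -ball_normE /= distrC => /ltW.
  have V : \forall n \near \oo, (opnorm (poly_op (q n) A \- B)%R <= e%:E)%E.
    move/fine_cvgP: qB => [fin /cvgrPdist_le/(_ e e0) cv].
    apply: filterS2 fin cv => n fn; rewrite sub0r normrN => h.
    by rewrite -(fineK fn) lee_fin (le_trans (ler_norm _) h).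
  have [N _ hN] : \forall n \near \oo, (forall t, spectrum A t%:C%C -> `|(q n).[t] - f t| <= e)
      /\ (opnorm (poly_op (q n) A \- B)%R <= e%:E)%E by exact: filterS2 U V.
  have [h1 h2] := hN N (leqnn N).
  by exists (q N); split=> //; exact/(opnorm_leP (lD N) (ltW e0)).
move=> hB; split=> //.
have /choice[q hq] (n : nat) : exists q, (forall t, spectrum A t%:C%C -> `|q.[t] - f t| <= n.+1%:R^-1) /\
    forall x, hnorm (poly_op q A x - B x) <= n.+1%:R^-1 * hnorm x.
  by apply: hB; rewrite invr_gt0.
have lD n : linear (poly_op (q n) A \- B).
  by move=> a x y /=; rewrite poly_op_linear// (bounded_lin bB) scalerBr opprD addrACA.
exists q; split; last first.
  apply: (@squeeze_cvge _ _ _ _ (fun=> 0%E) _ (fun n => (harmonic n)%:E)).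
  - near=> n; rewrite opnorm_ge0//=; apply/opnorm_leP => //; last exact: (hq n).2.
  - exact: cvg_cst.
  - exact: cvge_harmonic.
move=> P /uniform_nbhs[E [entE EP]].
move: entE; rewrite -entourage_ballE => -[e /= e0 eE].
have [K hK] : exists K : nat, K.+1%:R^-1 < e.
  exists (Num.truncn e^-1); rewrite -[ltRHS]invrK ltf_pV2 ?posrE ?invr_gt0//.
  exact: truncnS_gt.
exists K => // n /= Kn; apply: EP => t st; apply: eE; rewrite /= -ball_normE /= distrC.
apply: le_lt_trans ((hq n).1 t st) (le_lt_trans _ hK).
by rewrite lef_pV2 ?posrE// ler_nat.
Unshelve. all: by end_near.
Qed.

(** Allows any polynomial to be compared with [B], not only those witnessing the approximation;
    [cfc_mul] applies it to a product of two of them. *)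
Lemma cfc_poly_bound f A B q c : selfadj A -> cfc_approx f A B -> 0 <= c ->
  (forall t, spectrum A t%:C%C -> `|q.[t] - f t| <= c) ->
  forall x, hnorm (poly_op q A x - B x) <= c * hnorm x.
Proof.
move=> sA [bB hB] c0 hq x.
apply/ler_addgt0Pr => e e0.
have K0 : 0 < 2 * hnorm x + 1 by rewrite ltr_wpDl// mulr_ge0// hnorm_ge0.
pose d := e / (2 * hnorm x + 1); have d0 : 0 < d by rewrite divr_gt0.
have de : d * (2 * hnorm x) <= e.
  rewrite /d mulrAC ler_pdivrMr// ler_wpM2l ?(ltW e0)//; lra.
have [r [hr1 hr2]] := hB d d0.
have := @poly_op_norm _ _ A (q - r) (c + d) sA (addr_ge0 c0 (ltW d0)) _ x.
have h t : spectrum A t%:C%C -> `|(q - r).[t]| <= c + d.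
  move=> st; rewrite hornerD hornerN -[_ - _](subrKA (f t)) (le_trans (ler_normD _ _))//.
  by rewrite lerD ?hq// distrC hr1.
move=> /(_ h); rewrite poly_opB => h1; have h2 := hr2 x.
apply: le_trans (hnormBT _ (poly_op r A x) _) _.
apply: le_trans (lerD h1 h2) _; nra.
Qed.

(** By [poly_op_norm], uniform approximation on the spectrum makes the operators Cauchy in norm; the
    limit is taken pointwise and then shown to be linear and bounded. *)
Lemma cfc_exists f A : selfadj A ->
  (forall e : R, 0 < e -> exists q, forall t, spectrum A t%:C%C -> `|q.[t] - f t| <= e) ->
  exists B, cfc_approx f A B.
Proof.
move=> sA hf; have [bA hA] := sA; have lA := bounded_lin bA.
have /choice[q hq] (n : nat) : exists q, forall t, spectrum A t%:C%C -> `|q.[t] - f t| <= n.+1%:R^-1.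
  by apply: hf; rewrite invr_gt0.
have inv0 n : 0 <= n.+1%:R^-1 :> R by rewrite invr_ge0.
have cau m n x : hnorm (poly_op (q m) A x - poly_op (q n) A x) <=
    (m.+1%:R^-1 + n.+1%:R^-1) * hnorm x.
  rewrite -poly_opB; apply: poly_op_norm => // t st.
  rewrite hornerD hornerN -[_ - _](subrKA (f t)) (le_trans (ler_normD _ _))//.
  by rewrite lerD ?hq// distrC hq.
have /choice[B hB] x : exists l, forall e : R, 0 < e -> exists N, forall n, (N <= n)%N ->
    hnorm (poly_op (q n) A x - l) <= e.
  apply: hilbert_complete => e e0.
  have K0 : 0 < 2 * hnorm x + 1 by rewrite ltr_wpDl// mulr_ge0// hnorm_ge0.
  have [N hN] := inv_succ_small (e / (2 * hnorm x + 1)) ltac:(by rewrite divr_gt0).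
  exists N => m n Nm Nn; apply: le_trans (cau m n x) _.
  have h := lerD (hN m Nm) (hN n Nn).
  apply: le_trans (ler_wpM2r (hnorm_ge0 x) h) _.
  by rewrite -mulrDl mulrAC ler_pdivrMr//; nra.
have qB n x : hnorm (poly_op (q n) A x - B x) <= n.+1%:R^-1 * hnorm x.
  apply/ler_addgt0Pr => e e0.
  have K0 : 0 < hnorm x + 1 by rewrite ltr_wpDl// hnorm_ge0.
  have [N1 hN1] := inv_succ_small (e / 2 / (hnorm x + 1)) ltac:(by rewrite !divr_gt0).
  have [N2 hN2] := hB x (e / 2) ltac:(by rewrite divr_gt0).
  pose N := maxn N1 N2.
  have h1 := hN1 N (leq_maxl _ _); have h2 := hN2 N (leq_maxr _ _).
  have h3 := cau n N x.
  have h4 : N.+1%:R^-1 * hnorm x <= e / 2.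
    apply: le_trans (ler_wpM2r (hnorm_ge0 x) h1) _.
    rewrite mulrAC ler_pdivrMr// ler_wpM2l ?divr_ge0// ?(ltW e0)//; lra.
  apply: le_trans (hnormBT _ (poly_op (q N) A x) _) _.
  apply: le_trans (lerD h3 h2) _; rewrite mulrDl -addrA lerD2l [leRHS]splitr lerD//.
have Blin : linear B.
  move=> a x y; apply/eqP; rewrite -subr_eq0; apply/eqP; apply: hnorm_eq0.
  apply/eqP; rewrite eq_le hnorm_ge0 andbT; apply/ler_addgt0Pr => e e0; rewrite add0r.
  pose K := hnorm (a *: x + y) + complex.Re `|a| * hnorm x + hnorm y.
  have a0 : 0 <= complex.Re `|a| by rewrite normc_def /= sqrtr_ge0.
  have K0 : 0 <= K by rewrite !addr_ge0 ?mulr_ge0 ?hnorm_ge0.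
  have K1 : 0 < K + 1 by rewrite ltr_wpDl.
  have [N hN] := inv_succ_small (e / (K + 1)) ltac:(by rewrite divr_gt0).
  have {hN} hN := hN N (leqnn N).
  have -> : B (a *: x + y) - (a *: B x + B y) =
     - (poly_op (q N) A (a *: x + y) - B (a *: x + y)) +
     (a *: (poly_op (q N) A x - B x) + (poly_op (q N) A y - B y)).
    by rewrite (poly_op_linear _ lA) scalerBr opprB [X in _ = _ + X]addrACA subrKA opprD.
  apply: le_trans (hnormD _ _) _; rewrite hnormN.
  apply: le_trans (lerD (qB _ _) (hnormD _ _)) _; rewrite hnormZ.
  apply: (@le_trans _ _ (N.+1%:R^-1 * K)).
    rewrite /K mulrDr mulrDr -addrA lerD2l lerD ?qB// mulrCA ler_wpM2l ?qB//.
  apply: le_trans (ler_wpM2r K0 hN) _; rewrite mulrAC ler_pdivrMr// ler_wpM2l ?(ltW e0)//; lra.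
exists B; split.
  have /boundedP[_ [C C0 hC]] := (poly_op_selfadj (q 0) sA).1.
  apply/boundedP; split=> //; exists (C + 1); first exact: addr_ge0.
  move=> x; have := qB 0 x; rewrite invr1 mul1r => h.
  rewrite -[B x](subKr (poly_op (q 0) A x)) (le_trans (hnormB _ _))// mulrDl mul1r.
  by rewrite lerD// hC.
move=> e e0; have [N hN] := inv_succ_small e e0; exists (q N); split.
  by move=> t st; apply: le_trans (hq N t st) (hN N _).
by move=> x; apply: le_trans (qB N x) _; rewrite ler_wpM2r ?hnorm_ge0// hN.
Qed.

Lemma cfcP f A : selfadj A ->
  (forall e : R, 0 < e -> exists q, forall t, spectrum A t%:C%C -> `|q.[t] - f t| <= e) ->
  cfc_approx f A (cfc f A).
Proof.
move=> sA hf; have [B hB] := cfc_exists sA hf; have lA := bounded_lin sA.1.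
apply/is_cfcP => //; apply: xgetPex; exists B; exact/is_cfcP.
Qed.

Lemma cfc_selfadj f A B : selfadj A -> cfc_approx f A B -> selfadj B.
Proof.
move=> sA [bB hB]; split=> //; apply: selfadjP => [|x y]; first exact: bounded_lin.
apply/eqP; rewrite -subr_eq0 -normr_le0; apply/ler_addgt0Pr => e e0; rewrite add0r.
have K0 : 0 < 2 * (hnorm x * hnorm y) + 1 by rewrite ltr_wpDl// !mulr_ge0// hnorm_ge0.
have [q [_ hq]] := hB (e / (2 * (hnorm x * hnorm y) + 1)) ltac:(by rewrite divr_gt0).
set d := e / _ in hq.
have sq : hre (poly_op q A x) y = hre x (poly_op q A y) by apply: selfadj_hre; exact: poly_op_selfadj.
have -> : hre (B x) y - hre x (B y) =
   hre x (poly_op q A y - B y) - hre (poly_op q A x - B x) y.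
  by rewrite hreBl hreBr sq; ring.
rewrite (le_trans (ler_normB _ _))//.
have h1 := hre_abs_le x (poly_op q A y - B y).
have h2 := hre_abs_le (poly_op q A x - B x) y.
have h3 := ler_wpM2l (hnorm_ge0 x) (hq y).
have h4 := ler_wpM2r (hnorm_ge0 y) (hq x).
apply: (@le_trans _ _ (d * (2 * (hnorm x * hnorm y)))).
  nra.
rewrite /d mulrAC ler_pdivrMr// ler_wpM2l ?(ltW e0)//; lra.
Qed.

(** Polynomials act on an eigenvector as scalars, and a nonzero eigenvector puts its eigenvalue in
    the spectrum, where they approximate [f]. *)
Lemma cfc_eigen f A B x s : selfadj A -> cfc_approx f A B -> A x = s%:C%C *: x ->
  B x = (f s)%:C%C *: x.
Proof.
move=> sA [bB hB] Ax; have lA := bounded_lin sA.1.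
have [->|x0] := eqVneq x 0; first by rewrite linop0 ?scaler0//; exact: bounded_lin.
have ss : spectrum A s%:C%C.
  move=> [C [bC AC _]]; have := AC x; rewrite Ax subrr linop0 => [e|]; last exact: bounded_lin.
  by move: x0; rewrite -e eqxx.
apply/esym/eqP; rewrite -subr_eq0; apply/eqP; apply: hnorm_eq0.
apply/eqP; rewrite eq_le hnorm_ge0 andbT; apply/ler_addgt0Pr => e e0; rewrite add0r.
have K0 : 0 < 2 * hnorm x + 1 by rewrite ltr_wpDl// mulr_ge0// hnorm_ge0.
have [q [hq1 hq2]] := hB (e / (2 * hnorm x + 1)) ltac:(by rewrite divr_gt0).
have h2 := hq2 x; have h1 := ler_wpM2r (hnorm_ge0 x) (hq1 _ ss).
rewrite (poly_op_eigen _ lA Ax) in h2.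
have h3 : hnorm ((f s)%:C%C *: x - (q.[s])%:C%C *: x) = `|q.[s] - f s| * hnorm x.
  by rewrite -scalerBl -rmorphB hnormZr distrC.
apply: le_trans (hnormBT _ ((q.[s])%:C%C *: x) _) _; rewrite h3.
apply: le_trans (lerD h1 h2) _.
by rewrite -mulrDr mulrAC ler_pdivrMr// ler_wpM2l ?(ltW e0)//; lra.
Qed.

Lemma selfadj_shift A t : selfadj A -> selfadj (fun x => A x - t%:C%C *: x).
Proof.
move=> [bA hA]; split.
  have -> : (fun x => A x - t%:C%C *: x) = A \+ (fun x => (- t%:C%C) *: x).
    by apply/funext => x /=; rewrite scaleNr.
  by apply: bounded_add => //; exact: bounded_scale bounded_id.
by move=> x y; rewrite innerDl innerDr innerNl innerNr innerZl innerZr hA conjc_real.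
Qed.

Lemma spectrum_real_bound A M t : selfadj A -> (forall x, hnorm (A x) <= M * hnorm x) ->
  spectrum A t%:C%C -> `|t| <= M.
Proof.
move=> sA hM st; rewrite leNgt; apply/negP => Mt; apply: st.
have sB := selfadj_shift t sA.
apply: (selfadj_invertible sB (d := `|t| - M)); first by rewrite subr_gt0.
move=> x; rewrite mulrBl -hnormZr lerBlDr.
have := hnormB (A x) (A x - t%:C%C *: x); rewrite subKr => /le_trans; apply.
by rewrite addrC lerD2l.
Qed.

Lemma spectrum_positive A t : positive_operator A -> spectrum A t%:C%C -> 0 <= t.
Proof.
move=> pA st; have sA := positive_selfadj pA; rewrite leNgt; apply/negP => t0; apply: st.
have sB := selfadj_shift t sA.
apply: (selfadj_invertible sB (d := - t)); first by rewrite oppr_gt0.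
move=> x; have [->|x0] := eqVneq x 0; first by rewrite hnorm0 mulr0 hnorm_ge0.
have xp := hnorm_gt0 x0.
rewrite -(ler_pM2r xp) -mulrA -expr2 -hnormE.
apply: le_trans (hre_le _ _).
by rewrite hreBl hreZl; have := positive_hre x pA; lra.
Qed.

Lemma cfc_mul f g h A B C D : selfadj A ->
  cfc_approx f A B -> cfc_approx g A C -> cfc_approx h A D ->
  (forall t, spectrum A t%:C%C -> f t * g t = h t) -> B \o C = D.
Proof.
move=> sA fB gC hD fgh; have [bA hA] := sA; have lA := bounded_lin bA.
have [bB hB] := fB; have [bC hC] := gC; have [bD _] := hD.
have [m m0 [hm _]] := operator_norm bA.
have polyb q : exists2 c, 0 <= c & forall t, spectrum A t%:C%C -> `|q.[t]| <= c.
  exists (\sum_(i < size q) `|q`_i| * m ^+ i).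
    by apply: sumr_ge0 => i _; rewrite mulr_ge0// exprn_ge0.
  move=> t st; rewrite horner_coef (le_trans (ler_norm_sum _ _ _))//.
  apply: ler_sum => i _; rewrite normrM normrX ler_wpM2l// lerXn2r ?nnegrE//.
  exact: spectrum_real_bound hm st.
have fb k E : cfc_approx k A E -> exists2 c, 0 <= c & forall t, spectrum A t%:C%C -> `|k t| <= c.
  move=> [_ /(_ 1 ltac:(by []))[q [hq _]]]; have [c c0 hc] := polyb q.
  exists (c + 1) => [|t st]; first exact: addr_ge0.
  rewrite -[k t](subKr q.[t]) (le_trans (ler_normB _ _))// lerD ?hc ?hq//.
have [cf cf0 hcf] := fb _ _ fB; have [cg cg0 hcg] := fb _ _ gC.
have /boundedP[lB [mB mB0 hmB]] := bB.
have /boundedP[_ [mC mC0 hmC]] := bC.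
apply/funext => x /=; apply/eqP; rewrite -subr_eq0; apply/eqP; apply: hnorm_eq0.
apply/eqP; rewrite eq_le hnorm_ge0 andbT; apply/ler_addgt0Pr => e e0; rewrite add0r.
(* The estimates [h2] and [h1] below add up to [d * (K - 1)]; [d <= 1] serves to bound [r] by [g]
   plus 1. *)
pose K := (mC + 2 + mB + cg + cf) * hnorm x + 1.
have K0 : 0 < K.
  by rewrite ltr_wpDl// mulr_ge0 ?hnorm_ge0//; lra.
pose d := Num.min 1 (e / K).
have d0 : 0 < d by rewrite lt_min ltr01 divr_gt0.
have d1 : d <= 1 by rewrite ge_min lexx.
have [q [hq1 hq2]] := hB d d0; have [r [hr1 hr2]] := hC d d0.
have h1 : hnorm (poly_op (q * r) A x - D x) <= (d * (cg + 1) + cf * d) * hnorm x.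
  apply: (cfc_poly_bound sA hD).
    by rewrite addr_ge0 ?mulr_ge0 ?addr_ge0// ltW.
  move=> t st; rewrite -fgh// hornerM.
  have -> : q.[t] * r.[t] - f t * g t = (q.[t] - f t) * r.[t] + f t * (r.[t] - g t) by ring.
  rewrite (le_trans (ler_normD _ _))// !normrM lerD// ler_pM ?hq1 ?hr1 ?hcf//.
  rewrite -[r.[t]](subrK (g t)) addrC (le_trans (ler_normD _ _))// lerD ?hcg//.
  exact: le_trans (hr1 _ st) d1.
have h2 : hnorm (B (C x) - poly_op (q * r) A x) <= (d * (mC + 1) + mB * d) * hnorm x.
  rewrite poly_opM//.
  apply: le_trans (hnormBT _ (B (poly_op r A x)) _) _; rewrite -linopB// addrC.
  rewrite mulrDl; apply: lerD.
    rewrite hnormBC; apply: le_trans (hq2 _) _; rewrite -mulrA ler_wpM2l ?(ltW d0)//.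
    rewrite -[poly_op r A x](subrK (C x)) (le_trans (hnormD _ _))// addrC mulrDl lerD ?hmC//.
    by apply: le_trans (hr2 _) _; rewrite ler_wpM2r ?hnorm_ge0.
  by apply: le_trans (hmB _) _; rewrite -mulrA ler_wpM2l// hnormBC hr2.
apply: le_trans (hnormBT _ (poly_op (q * r) A x) _) (le_trans (lerD h2 h1) _).
have -> : (d * (mC + 1) + mB * d) * hnorm x + (d * (cg + 1) + cf * d) * hnorm x = d * (K - 1).
  by rewrite /K; ring.
have dK : d * K <= e by rewrite -ler_pdivlMr// ge_min lexx orbT.
by lra.
Qed.

Lemma cfc_id A : bounded_operator A -> cfc_approx id A A.
Proof.
move=> bA; split=> // e e0; exists 'X; split=> [t _|x].
  by rewrite hornerX subrr normr0 ltW.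
by rewrite poly_opX subrr hnorm0 mulr_ge0 ?hnorm_ge0// ltW.
Qed.

Lemma cfc_continuous f A : positive_operator A ->
  {within `[0, +oo[, continuous f} -> cfc_approx f A (cfc f A).
Proof.
move=> pA cf; have sA := positive_selfadj pA; apply: cfcP => // e e0.
have [m m0 [hm _]] := operator_norm sA.1.
(* [m + 1] instead of [m] keeps the interval nondegenerate when [m] is 0. *)
have [||q hq] := @weierstrass_approximation R f (m + 1) e _ e0.
- by rewrite ltr_wpDl.
- apply: continuous_subspaceW cf => t /=; rewrite !in_itv /= => /andP[-> _] //.
exists q => t st; apply: hq; rewrite in_itv /= (spectrum_positive pA st) /=.
have := spectrum_real_bound sA hm st; rewrite ger0_norm ?(spectrum_positive pA st)//.
by move=> /le_trans; apply; rewrite lerDl.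
Qed.

End ContinuousCalculus.

(** * Polar decomposition *)

Section PolarDecomposition.
Context {R : realType} {H : hilbertSpace R}.
Implicit Types (x y z u p : H) (a : R[i]) (s t c e : R) (A B T S U : H -> H).

Lemma selfadj_sqr_positive B : selfadj B -> positive_operator (B \o B).
Proof.
move=> [bB hB]; split; first exact: bounded_comp.
by move=> x /=; rewrite hB innerE exprn_ge0.
Qed.

(** The square root is the square of a self-adjoint fourth root, and is therefore positive. *)
Lemma positive_sqrt A : positive_operator A ->
  exists B, positive_operator B /\ B \o B = A.
Proof.
move=> pA; have sA := positive_selfadj pA.
have cs (D : set R) : {within D, continuous (@Num.sqrt R)}.
  exact/continuous_subspaceT/sqrt_continuous.
have hB := cfc_continuous pA (cs `[0, +oo[%classic).
have hC : cfc_approx (fun t => Num.sqrt (Num.sqrt t)) A (cfc (fun t => Num.sqrt (Num.sqrt t)) A).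
  apply: cfc_continuous => //; apply: continuous_subspaceT => t.
  by apply: continuous_comp; exact: sqrt_continuous.
exists (cfc Num.sqrt A); split.
  have <- := cfc_mul (h := Num.sqrt) sA hC hC hB _.
    exact: selfadj_sqr_positive (cfc_selfadj sA hC).
  by move=> t _; rewrite -expr2 sqr_sqrtr// sqrtr_ge0.
apply: (cfc_mul sA hB hB (cfc_id sA.1)) => t st.
by rewrite -expr2 sqr_sqrtr// (spectrum_positive pA).
Qed.

Lemma absopP T : bounded_operator T -> is_absop T (absop T).
Proof.
move=> bT; apply: xgetPex.
have pT : positive_operator (adjoint T \o T).
  split; first exact: bounded_comp (adjoint_bounded bT) bT.
  by move=> x /=; rewrite innerC -adjoint_inner// innerE conj_ge0 exprn_ge0.
by have [B [pB BB]] := positive_sqrt pT; exists B.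
Qed.

Lemma absop_positive T : bounded_operator T -> positive_operator (absop T).
Proof. by move=> /absopP[]. Qed.

Lemma absop_sqr T x : bounded_operator T -> absop T (absop T x) = adjoint T (T x).
Proof. by move=> /absopP[_ /(congr1 (fun f => f x))]. Qed.

Lemma absop_norm T x : bounded_operator T -> hnorm (absop T x) = hnorm (T x).
Proof.
move=> bT; apply/eqP; rewrite -(@eqrXn2 _ 2) ?hnorm_ge0//; apply/eqP.
rewrite -!hnormE (selfadj_hre _ _ (positive_selfadj (absop_positive bT))) absop_sqr//.
by rewrite /hre adjoint_inner.
Qed.

Lemma kernel_closed_subspace U : bounded_operator U -> closed_subspace [set x | U x = 0].
Proof.
move=> /boundedP[lU [C C0 hC]]; split=> /=.
- exact: linop0.
- by move=> a x y x0 y0; rewrite lU x0 y0 scaler0 addr0.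
move=> x hx; apply: hnorm_eq0; apply/eqP; rewrite eq_le hnorm_ge0 andbT.
apply/ler_addgt0Pr => e e0; rewrite add0r.
have C1 : 0 < C + 1 by rewrite ltr_wpDl.
have [y /= y0 xy] := hx (e / (C + 1)) ltac:(by rewrite divr_gt0).
rewrite -[U x]subr0 -y0 -linopB// (le_trans (hC _))//.
apply: le_trans (ler_wpM2l C0 xy) _; rewrite mulrCA ger_pMr// ler_pdivrMr// mul1r; lra.
Qed.

Lemma hnorm_pythagoras x y : inner H x y = 0 -> hnorm (x + y) ^+ 2 = hnorm x ^+ 2 + hnorm y ^+ 2.
Proof. by move=> /inner_eq0P[xy _]; rewrite hnormD_sqr xy mulr0 addr0. Qed.

(** Subtracting from x its projection onto ker U does not change U x, shortens x, and leaves a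
    vector on which [U] is isometric. *)
Lemma partial_isometry_le U x : partial_isometry U -> hnorm (U x) <= hnorm x.
Proof.
move=> [bU iU]; have lU := bounded_lin bU.
have [k /= k0 hk] := projection x (kernel_closed_subspace bU).
have Ux : U x = U (x - k) by rewrite linopB// k0 subr0.
have -> : hnorm (U x) = hnorm (x - k) by rewrite Ux /hnorm iU.
rewrite -(@ler_sqr _ (hnorm _)) ?nnegrE ?hnorm_ge0//.
by have := hnorm_pythagoras (hk k k0); rewrite subrK => ->; rewrite lerDl sqr_ge0.
Qed.

(** The closure of the set of pairs (A x, T x). For [A] the modulus of [T] it extends the isometry A
    x -> T x to the closure of the range of [A]; as a relation it needs no prior proof of
    well-definedness. *)
Definition closure_graph A T p z :=
  forall e, 0 < e -> exists x, hnorm (p - A x) <= e /\ hnorm (z - T x) <= e.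

Lemma closure_graph_linear A T a p z p' z' : linear A -> linear T ->
  closure_graph A T p z -> closure_graph A T p' z' ->
  closure_graph A T (a *: p + p') (a *: z + z').
Proof.
move=> lA lT h h' e e0.
have a0 : 0 <= complex.Re `|a| by rewrite normc_def /= sqrtr_ge0.
have a1 : 0 < complex.Re `|a| + 1 by rewrite ltr_wpDl.
have d0 : 0 < e / (complex.Re `|a| + 1) by rewrite divr_gt0.
have [x [x1 x2]] := h _ d0; have [y [y1 y2]] := h' _ d0.
exists (a *: x + y); rewrite lA lT.
have aux v w v' w' : hnorm (v - w) <= e / (complex.Re `|a| + 1) ->
    hnorm (v' - w') <= e / (complex.Re `|a| + 1) ->
    hnorm (a *: v + v' - (a *: w + w')) <= e.
  move=> h1 h2; rewrite opprD addrACA -scalerBr (le_trans (hnormD _ _))// hnormZ.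
  apply: le_trans (lerD (ler_wpM2l a0 h1) h2) _.
  by rewrite -[X in _ + X]mul1r -mulrDl mulrCA divff ?mulr1// gt_eqF.
by split; exact: aux.
Qed.

Lemma closure_graph_norm A T p z : (forall x, hnorm (A x) = hnorm (T x)) ->
  closure_graph A T p z -> hnorm z = hnorm p.
Proof.
move=> AT h; apply/eqP; rewrite -subr_eq0 -normr_le0; apply/ler_addgt0Pr => e e0.
rewrite add0r; have [x [x1 x2]] := h (e / 2) ltac:(by rewrite divr_gt0).
have h1 := hnormBT z (T x) 0; have h2 := hnormBT (T x) z 0.
have h3 := hnormBT p (A x) 0; have h4 := hnormBT (A x) p 0.
move: h1 h2 h3 h4; rewrite !subr0 AT [hnorm (T x - z)]hnormBC [hnorm (A x - p)]hnormBC.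
by rewrite ler_norml; lra.
Qed.

Lemma range_closure_subspace A : linear A ->
  closed_subspace [set y | forall e, 0 < e -> exists x, hnorm (y - A x) <= e].
Proof.
move=> lA; split=> /=.
- by move=> e e0; exists 0; rewrite linop0// subrr hnorm0 ltW.
- move=> a x y hx hy e e0.
  have gx : closure_graph A A x x by move=> d d0; have [w hw] := hx d d0; exists w.
  have gy : closure_graph A A y y by move=> d d0; have [w hw] := hy d d0; exists w.
  by have [w [hw _]] := closure_graph_linear a lA lA gx gy e0; exists w.
- move=> y hy e e0.
  have e20 : 0 < e / 2 by rewrite divr_gt0.
  have [z hz yz] := hy _ e20; have [x hx] := hz _ e20; exists x.
  by rewrite (le_trans (hnormBT _ z _))// [leRHS]splitr lerD.
Qed.

Lemma range_closure_orthogonal A u p : selfadj A -> A u = 0 ->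
  (forall e, 0 < e -> exists x, hnorm (p - A x) <= e) -> inner H u p = 0.
Proof.
move=> sA Au hp.
have key v : A v = 0 -> hre v p = 0.
  move=> Av; apply/eqP; rewrite -normr_le0; apply/ler_addgt0Pr => e e0; rewrite add0r.
  have v1 : 0 < hnorm v + 1 by rewrite ltr_wpDl// hnorm_ge0.
  have [x hx] := hp (e / (hnorm v + 1)) ltac:(by rewrite divr_gt0).
  have -> : hre v p = hre v (p - A x) by rewrite hreBr -selfadj_hre// Av hre0l subr0.
  apply: le_trans (hre_abs_le _ _) _.
  apply: le_trans (ler_wpM2l (hnorm_ge0 v) hx) _.
  rewrite mulrCA ger_pMr// ler_pdivrMr// mul1r; lra.
have lA := bounded_lin sA.1.
apply/inner_eq0P; split; first exact: key.
have -> : hre u ('i%C *: p) = - hre ('i%C *: u) p.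
  by rewrite /hre innerZr innerZl; case: (inner _ _ _) => r i /=; ring.
by rewrite key ?oppr0// linopZ// Au scaler0.
Qed.

Lemma polar_exists T : bounded_operator T -> exists U, is_polar T U.
Proof.
move=> bT; pose A := absop T.
have pA : positive_operator A by exact: absop_positive.
have sA := positive_selfadj pA; have lA := bounded_lin sA.1; have lT := bounded_lin bT.
have nA x : hnorm (A x) = hnorm (T x) by exact: absop_norm.
pose M := [set y : H | forall e, 0 < e -> exists x, hnorm (y - A x) <= e].
have cM : closed_subspace M by exact: range_closure_subspace.
(* z is the image of y under the polar factor: project y onto the closure of the range of [A], then
   apply the extended isometry. *)
pose P y z := exists p, [/\ M p, forall m, M m -> inner H (y - p) m = 0 & closure_graph A T p z].
have Pex y : exists z, P y z.
  have [p Mp hp] := projection y cM.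
  have /choice[u hu] (n : nat) : exists x, hnorm (p - A x) <= n.+1%:R^-1.
    by apply: Mp; rewrite invr_gt0.
  have [z hz] : exists l, forall e : R, 0 < e -> exists N, forall n, (N <= n)%N ->
      hnorm (T (u n) - l) <= e.
    apply: hilbert_complete => e e0; have [N hN] := inv_succ_small (e / 2) ltac:(by rewrite divr_gt0).
    exists N => m n Nm Nn; rewrite -linopB// -nA linopB//.
    apply: le_trans (hnormBT _ p _) _; rewrite hnormBC [leRHS]splitr lerD//.
      exact: le_trans (hu m) (hN m Nm).
    exact: le_trans (hu n) (hN n Nn).
  exists z, p; split=> // e e0; have [N1 hN1] := inv_succ_small e e0; have [N2 hN2] := hz e e0.
  exists (u (maxn N1 N2)); split.
    exact: le_trans (hu _) (hN1 _ (leq_maxl _ _)).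
  by rewrite hnormBC hN2// leq_maxr.
have Plin a x y z w : P x z -> P y w -> P (a *: x + y) (a *: z + w).
  move=> [p [Mp hp gp]] [q [Mq hq gq]]; have [_ ML _] := cM.
  exists (a *: p + q); split; [exact: ML| |exact: closure_graph_linear].
  move=> m Mm; rewrite opprD addrACA -scalerBr innerDl innerZl hp// hq//.
  by rewrite mulr0 addr0.
have Ple y z : P y z -> hnorm z <= hnorm y.
  move=> [p [Mp hp gp]]; rewrite (closure_graph_norm nA gp).
  rewrite -(@ler_sqr _ (hnorm _)) ?nnegrE ?hnorm_ge0//.
  by have := hnorm_pythagoras (hp p Mp); rewrite subrK => ->; rewrite lerDr sqr_ge0.
(* [P] is linear and contractive, so two images of y differ by an image of 0. *)
have Puniq y z w : P y z -> P y w -> z = w.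
  move=> hz hw; have := Plin (-1) _ _ _ _ hz hw; rewrite !scaleN1r addNr => /Ple.
  rewrite hnorm0 => h; apply/esym/eqP; rewrite -subr_eq0 addrC; apply/eqP; apply: hnorm_eq0.
  by apply/eqP; rewrite eq_le h hnorm_ge0.
have /choice[U hU] := Pex.
have lU : linear U by move=> a x y; apply: Puniq (hU _) _; exact: Plin.
have bU : bounded_operator U.
  by apply/boundedP; split=> //; exists 1 => // x; rewrite mul1r Ple.
have UA x : U (A x) = T x.
  apply: Puniq (hU _) _; exists (A x); split.
  - by move=> e e0; exists x; rewrite subrr hnorm0 ltW.
  - by move=> m _; rewrite subrr inner0l.
  - by move=> e e0; exists x; rewrite !subrr hnorm0 ltW.
have TA x : T x = 0 <-> A x = 0.
  by split=> h; apply: hnorm_eq0; [rewrite nA|rewrite -nA]; rewrite h hnorm0.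
have kerU x : U x = 0 <-> T x = 0.
  rewrite TA; split=> hx.
    have [p [Mp hp gp]] := hU x; move: gp; rewrite hx => /(closure_graph_norm nA).
    rewrite hnorm0 => /esym/hnorm_eq0 p0; rewrite p0 subr0 in hp.
    apply: inner_ext => z; rewrite inner0r -sA.2 innerC hp ?conjc0//.
    by move=> e e0; exists z; rewrite subrr hnorm0 ltW.
  apply: Puniq (hU _) _; exists 0; split; first by have [] := cM.
    by move=> m Mm; rewrite subr0; exact: range_closure_orthogonal Mm.
  by move=> e e0; exists 0; rewrite (linop0 lA) (linop0 lT) subrr hnorm0 ltW.
exists U; split=> //.
- split=> // x hx.
  have [p [Mp hp gp]] := hU x.
  have Axp : A (x - p) = 0.
    apply: inner_ext => z; rewrite inner0r -sA.2 innerC hp ?conjc0//.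
    by move=> e e0; exists z; rewrite subrr hnorm0 ltW.
  (* [x - p] lies in ker U, so it is orthogonal to x by assumption; it is orthogonal to p by the
     choice of p. *)
  have xp : x = p.
    apply/eqP; rewrite -subr_eq0; apply/eqP; apply: hnorm_eq0.
    apply/eqP; rewrite -sqrf_eq0 -hnormE hreBl {1}/hre hx; last exact/kerU/TA.
    by rewrite hreC /hre hp// subr0.
  by rewrite !normE (closure_graph_norm nA gp) xp.
- by apply/funext => x /=; rewrite -UA.
Qed.

Lemma polarP T : bounded_operator T -> is_polar T (polar T).
Proof. by move=> bT; apply: xgetPex; exact: polar_exists. Qed.

End PolarDecomposition.

(** * Orthonormal bases *)

Section NonnegativeSums.
Context {R : realType} {T : choiceType}.
Implicit Types (E : set T) (a b : T -> R) (F G : seq T).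

Lemma sum_subset_le a F G : uniq F -> uniq G -> {subset F <= G} ->
  (forall x, x \in G -> 0 <= a x) -> \sum_(x <- F) a x <= \sum_(x <- G) a x.
Proof.
move=> uF uG FG a0; rewrite [leRHS](bigID (mem F)) /= -[X in _ <= X + _]big_filter.
rewrite [X in _ <= X + _](perm_big F) ?lerDl; last first.
  apply: uniq_perm => //; first exact: filter_uniq.
  by move=> x; rewrite mem_filter; case: (boolP (x \in F)) => //= /FG.
by rewrite big_seq_cond; apply: sumr_ge0 => x /andP[/a0].
Qed.

Lemma le_esum_bound E a (M : \bar R) :
  (forall F, uniq F -> (forall x, x \in F -> E x) -> ((\sum_(x <- F) a x)%:E <= M)%E) ->
  (\esum_(x in E) (a x)%:E <= M)%E.
Proof.
move=> h; apply: ge_ereal_sup => _ [A [finA AE] <-].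
rewrite fsbig_finite// sumEFin; apply: h; first exact: finmap.fset_uniq.
by move=> x xA; apply: AE; rewrite -[A]fset_setK.
Qed.

Lemma ge_esum_seq E a F : uniq F -> (forall x, x \in F -> E x) ->
  ((\sum_(x <- F) a x)%:E <= \esum_(x in E) (a x)%:E)%E.
Proof.
move=> uF FE; apply: ereal_sup_ubound; exists [set` F].
  by split=> //; exact: finite_seq.
by rewrite -fsbig_seq// sumEFin.
Qed.

Lemma esum_eq_sup E a (M : R) :
  (forall F, uniq F -> (forall x, x \in F -> E x) -> \sum_(x <- F) a x <= M) ->
  (forall e : R, 0 < e -> exists F, [/\ uniq F, forall x, x \in F -> E x
     & M - e <= \sum_(x <- F) a x]) ->
  \esum_(x in E) (a x)%:E = M%:E.
Proof.
move=> hle hge; apply/eqP; rewrite eq_le; apply/andP; split.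
  by apply: le_esum_bound => F uF FE; rewrite lee_fin hle.
apply/lee_addgt0Pr => e e0; have [F [uF FE hF]] := hge e e0.
apply: (@le_trans _ _ (\sum_(x <- F) a x + e)%:E).
  by rewrite lee_fin -lerBlDr.
by rewrite EFinD leeD2r// ge_esum_seq.
Qed.

Lemma esumZl E a (c : R) : 0 <= c -> (forall x, E x -> 0 <= a x) ->
  (\esum_(x in E) (c * a x)%:E = c%:E * \esum_(x in E) (a x)%:E)%E.
Proof.
have half (d : R) b : 0 < d -> (forall x, E x -> 0 <= b x) ->
    (\esum_(x in E) (d * b x)%:E <= d%:E * \esum_(x in E) (b x)%:E)%E.
  move=> d0 b0; apply: le_esum_bound => F uF FE; rewrite -mulr_sumr EFinM.
  by apply: lee_wpmul2l; [rewrite lee_fin ltW|exact: ge_esum_seq].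
move=> c0 a0; move: c0; rewrite le_eqVlt => /orP[/eqP <-|c0].
  by rewrite mul0e esum1// => x _; rewrite mul0r.
apply/eqP; rewrite eq_le half//=.
(* The reverse inequality is [half] for [c^-1]. *)
have ci : 0 < c^-1 by rewrite invr_gt0.
have h := @half c^-1 (fun x => c * a x) ci.
rewrite -(@lee_pmul2l _ c^-1%:E)// ?lte_fin// muleA -EFinM mulVf ?gt_eqF// mul1e.
apply: le_trans (h _); last by move=> x Ex; rewrite mulr_ge0 ?a0// ltW.
by apply: le_esum => x _; rewrite mulKf// gt_eqF.
Qed.

End NonnegativeSums.

Lemma exchange_esum (R : realType) (T1 T2 : choiceType) (I : set T1) (J : set T2)
    (a : T1 -> T2 -> \bar R) : (forall i j, I i -> J j -> (0 <= a i j)%E) ->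
  \esum_(i in I) \esum_(j in J) a i j = \esum_(j in J) \esum_(i in I) a i j.
Proof.
move=> a0; rewrite !esum_esum//; last by move=> j i Jj Ii; exact: a0.
rewrite (reindex_esum (I `*` J) _ (fun k => (k.2, k.1)))//.
split=> [[i j] [/= Ii Jj]|[i j] [k l] _ _ [-> ->]|[j i] [/= Jj Ii]] //.
by exists (i, j).
Qed.

(** * Bessel, Parseval and diagonal quadratic forms *)

Section OrthonormalBasis.
Context {R : realType} {H : hilbertSpace R}.
Implicit Types (x y z u p : H) (a : R[i]) (s t c e : R) (A B T S U D : H -> H) (E : set H)
  (F G : seq H).

(** The squared modulus of [inner H x y] as a real number; see [csqE]. *)
Definition csq x y : R := hre x y ^+ 2 + hre x ('i%C *: y) ^+ 2.

Lemma csq_ge0 x y : 0 <= csq x y.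
Proof. by rewrite addr_ge0 ?sqr_ge0. Qed.

Lemma csqE x y : (csq x y)%:C%C = inner H x y * conjc (inner H x y).
Proof.
rewrite [in RHS]innerRI /csq; apply/eqP; rewrite eq_complex /=.
by apply/andP; split; apply/eqP; ring.
Qed.

Lemma csqC x y : csq x y = csq y x.
Proof.
by apply: (@complexI R); rewrite !csqE (innerC y x) conjcK mulrC.
Qed.

Definition orthonormal E := forall u v, E u -> E v -> inner H u v = (u == v)%:R.

(** For orthonormal [F], the component of x orthogonal to the span of [F]. *)
Definition residual F x := x - \sum_(e <- F) inner H x e *: e.

Lemma residual_cons v F x : residual (v :: F) x = residual F x - inner H x v *: v.
Proof. by rewrite /residual big_cons opprD addrA addrAC. Qed.

Lemma residual_inner E F x v : orthonormal E -> E v -> (forall u, u \in F -> E u) ->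
  v \notin F -> inner H (residual F x) v = inner H x v.
Proof.
move=> oE Ev; elim: F => [|u F IH] FE; first by rewrite /residual big_nil subr0.
rewrite inE negb_or => /andP[vu vF]; rewrite residual_cons innerDl innerNl innerZl.
have Eu : E u by apply: FE; rewrite inE eqxx.
rewrite (oE u v Eu Ev) eq_sym (negPf vu) mulr0 subr0 IH// => w wF.
by apply: FE; rewrite inE wF orbT.
Qed.

(** Pythagoras for a form that is diagonal on [E]. The case [D = id] yields Bessel's inequality; a
    general [D] yields [diagonal_form]. *)
Lemma residual_form E (d : H -> R) D F x : orthonormal E -> selfadj D ->
  (forall u, E u -> D u = (d u)%:C%C *: u) -> uniq F -> (forall u, u \in F -> E u) ->
  hre (D (residual F x)) (residual F x) = hre (D x) x - \sum_(u <- F) d u * csq x u.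
Proof.
move=> oE sD dD; have lD := bounded_lin sD.1.
elim: F => [|v F IH] /= => [_ _|/andP[vF uF] FE].
  by rewrite /residual !big_nil !subr0.
have Ev : E v by apply: FE; rewrite inE eqxx.
have FE' u : u \in F -> E u by move=> uF'; apply: FE; rewrite inE uF' orbT.
have {IH} := IH uF FE'; rewrite residual_cons big_cons.
set y := residual F x => IH.
have yv : inner H y v = inner H x v by exact: residual_inner oE Ev FE' vF.
set w := inner H x v *: v.
have h1 : hre (D w) w = d v * csq x v.
  rewrite /w linopZ// dD// scalerA mulrC -scalerA hreZl; congr (_ * _).
  by rewrite /hre innerZl innerZr (oE v v Ev Ev) eqxx mulr1 -csqE.
have h2 : hre (D y) w = d v * csq x v.
  rewrite /w /hre innerZr (sD.2) dD// innerZr yv conjc_real.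
  rewrite mulrCA [X in _ * X]mulrC -csqE -rmorphM //.
clearbody w y.
rewrite linopB// hreBl !hreBr [hre (D w) y](_ : _ = hre (D y) w); last first.
  by rewrite selfadj_hre// hreC.
by rewrite h1 h2 IH; ring.
Qed.

Lemma residual_norm E F x : orthonormal E -> uniq F -> (forall u, u \in F -> E u) ->
  hnorm (residual F x) ^+ 2 = hnorm x ^+ 2 - \sum_(u <- F) csq x u.
Proof.
move=> oE uF FE; have sI : selfadj (@id H) by split=> //; exact: bounded_id.
have := residual_form x oE sI (d := fun=> 1) _ uF FE.
rewrite !hnormE => -> => [|u _]; last by rewrite scale1r.
by congr (_ - _); apply: eq_bigr => u _; rewrite mul1r.
Qed.

Lemma residual_linear F a x y : residual F (a *: x + y) = a *: residual F x + residual F y.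
Proof.
rewrite /residual scalerBr addrACA -opprD; congr (_ - _).
rewrite scaler_sumr -big_split; apply: eq_bigr => u _ /=.
by rewrite innerDl innerZl scalerDl scalerA.
Qed.

Lemma residual_le E F x : orthonormal E -> uniq F -> (forall u, u \in F -> E u) ->
  hnorm (residual F x) <= hnorm x.
Proof.
move=> oE uF FE; rewrite -(@ler_sqr _ (hnorm _)) ?nnegrE ?hnorm_ge0//.
by rewrite (residual_norm _ oE)// gerBl sumr_ge0// => u _; exact: csq_ge0.
Qed.

Lemma residual_antimono E F G x : orthonormal E -> uniq F -> uniq G ->
  (forall u, u \in G -> E u) -> {subset F <= G} ->
  hnorm (residual G x) <= hnorm (residual F x).
Proof.
move=> oE uF uG GE FG; rewrite -(@ler_sqr _ (hnorm _)) ?nnegrE ?hnorm_ge0//.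
rewrite !(residual_norm _ oE)// => [|u /FG]; last exact: GE.
by rewrite lerD2l lerN2 sum_subset_le// => u _; exact: csq_ge0.
Qed.

(** The vectors with arbitrarily small residuals form a closed subspace containing [E]; x minus its
    projection there is orthogonal to [E], hence zero. *)
Lemma orthonormal_basis_dense E x e : orthonormal_basis E -> 0 < e ->
  exists F, [/\ uniq F, forall u, u \in F -> E u & hnorm (residual F x) <= e].
Proof.
move=> [oE tE].
pose M := [set x : H | forall e, 0 < e ->
  exists F, [/\ uniq F, forall u, u \in F -> E u & hnorm (residual F x) <= e]].
have cM : closed_subspace M.
  split.
  - move=> d d0; exists [::]; split=> //.
    by rewrite /residual big_nil subr0 hnorm0 ltW.
  - move=> a y z hy hz d d0.
    have a0 : 0 <= complex.Re `|a| by rewrite normc_def /= sqrtr_ge0.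
    have a1 : 0 < complex.Re `|a| + 1 by rewrite ltr_wpDl.
    have d1 : 0 < d / (complex.Re `|a| + 1) by rewrite divr_gt0.
    have [F [uF FE hF]] := hy _ d1; have [G [uG GE hG]] := hz _ d1.
    have KE u : u \in undup (F ++ G) -> E u.
      by rewrite mem_undup mem_cat => /orP[/FE|/GE].
    exists (undup (F ++ G)); split=> //; first exact: undup_uniq.
    rewrite residual_linear (le_trans (hnormD _ _))// hnormZ.
    have h1 : hnorm (residual (undup (F ++ G)) y) <= d / (complex.Re `|a| + 1).
      apply: le_trans (residual_antimono _ oE uF (undup_uniq _) KE _) hF.
      by move=> u uF'; rewrite mem_undup mem_cat uF'.
    have h2 : hnorm (residual (undup (F ++ G)) z) <= d / (complex.Re `|a| + 1).
      apply: le_trans (residual_antimono _ oE uG (undup_uniq _) KE _) hG.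
      by move=> u uF'; rewrite mem_undup mem_cat uF' orbT.
    apply: le_trans (lerD (ler_wpM2l a0 h1) h2) _.
    by rewrite -[X in _ + X]mul1r -mulrDl mulrCA divff ?mulr1// gt_eqF.
  - move=> y hy d d0; have d2 : 0 < d / 2 by rewrite divr_gt0.
    have [z hz yz] := hy _ d2; have [F [uF FE hF]] := hz _ d2.
    exists F; split=> //.
    have -> : residual F y = residual F (y - z) + residual F z.
      by have := residual_linear F 1 (y - z) z; rewrite !scale1r subrK.
    rewrite (le_trans (hnormD _ _))// [leRHS]splitr lerD//.
    exact: le_trans (residual_le _ oE uF FE) yz.
move=> e0; have [p Mp hp] := projection x cM.
have EM u : E u -> M u.
  move=> Eu d d0; exists [:: u]; split=> // [v|]; first by rewrite inE => /eqP ->.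
  by rewrite /residual big_seq1 oE// eqxx scale1r subrr hnorm0 ltW.
have -> : x = p.
  by apply/eqP; rewrite -subr_eq0; apply/eqP; apply: tE => u /EM; exact: hp.
exact: Mp.
Qed.

Lemma diagonal_form E (d : H -> R) D x : orthonormal_basis E -> selfadj D ->
  (forall u, E u -> D u = (d u)%:C%C *: u) -> (forall u, E u -> 0 <= d u) ->
  \esum_(u in E) (d u * csq x u)%:E = (hre (D x) x)%:E.
Proof.
move=> bE sD dD d0; have [oE _] := bE.
have [m m0 [hm _]] := operator_norm sD.1.
have small e : 0 < e -> exists2 k, 0 < k & forall F,
    hnorm (residual F x) <= k -> `|hre (D (residual F x)) (residual F x)| <= e.
  move=> e0; have m1 : 0 < m + 1 by rewrite ltr_wpDl.
  pose k := Num.min 1 (e / (m + 1)).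
  have k0 : 0 < k by rewrite lt_min ltr01 divr_gt0.
  exists k => // F hF; apply: le_trans (hre_abs_le _ _) _.
  have k1 : k <= 1 by rewrite ge_min lexx.
  have ke : k * (m + 1) <= e by rewrite -ler_pdivlMr// ge_min lexx orbT.
  have h := hm (residual F x); have n0 := hnorm_ge0 (residual F x).
  have n2 : hnorm (residual F x) * hnorm (residual F x) <= k by nra.
  apply: le_trans (ler_wpM2r n0 h) _; rewrite -mulrA.
  by apply: le_trans (ler_wpM2l m0 n2) _; nra.
apply: esum_eq_sup => [F uF FE|e e0]; last first.
  have [k k0 hk] := small e e0; have [F [uF FE hF]] := orthonormal_basis_dense x bE k0.
  exists F; split=> //.
  by have := hk _ hF; rewrite (residual_form x oE sD dD uF FE) ler_norml; lra.
(* Enlarging [F] by a family [G] with small residual adds only nonnegative terms and makes the form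
   at the residual small. *)
apply/ler_addgt0Pr => e e0; have [k k0 hk] := small e e0.
have [G [uG GE hG]] := orthonormal_basis_dense x bE k0.
pose K := undup (F ++ G); have uK : uniq K by exact: undup_uniq.
have KE u : u \in K -> E u by rewrite mem_undup mem_cat => /orP[/FE|/GE].
have FK : {subset F <= K} by move=> u uF'; rewrite mem_undup mem_cat uF'.
have GK : {subset G <= K} by move=> u uG'; rewrite mem_undup mem_cat uG' orbT.
have hK := hk _ (le_trans (residual_antimono x oE uG uK KE GK) hG).
apply: (@le_trans _ _ (\sum_(u <- K) d u * csq x u)).
  by apply: sum_subset_le => // u uK'; rewrite mulr_ge0 ?csq_ge0//; apply/d0/KE.
by move: hK; rewrite (residual_form x oE sD dD uK KE) ler_norml; lra.
Qed.

Lemma parseval E x : orthonormal_basis E ->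
  \esum_(u in E) (csq x u)%:E = (hnorm x ^+ 2)%:E.
Proof.
move=> bE; have sI : selfadj (@id H) by split=> //; exact: bounded_id.
rewrite -hnormE -(diagonal_form x bE sI (d := fun=> 1)) => [|u _|//].
  by apply: eq_esum => u _; rewrite mul1r.
by rewrite scale1r.
Qed.

Lemma bessel E x : orthonormal E -> (\esum_(u in E) (csq x u)%:E <= (hnorm x ^+ 2)%:E)%E.
Proof.
move=> oE; apply: le_esum_bound => F uF FE; rewrite lee_fin.
by have := sqr_ge0 (hnorm (residual F x)); rewrite (residual_norm _ oE)// subr_ge0.
Qed.

End OrthonormalBasis.

(** * Compact operators *)

Section CompactOperators.
Context {R : realType} {H : hilbertSpace R}.
Implicit Types (x y z u p v : H) (a : R[i]) (s t c e : R) (A B T S U D : H -> H) (E M : set H)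
  (F G : seq H).

(** Compactness through finite nets for the image of the unit ball; the net points need not lie in
    that image. *)
Definition totally_bounded_op T := forall e, 0 < e ->
  exists F, forall x, hnorm x <= 1 -> exists2 y, y \in F & hnorm (T x - y) <= e.

Lemma hball_nbhs x e : 0 < e -> nbhs x [set y | hnorm (x - y) < e].
Proof.
move=> e0; apply/nbhs_ballP; exists (e%:C%C); first by rewrite /= ltcR.
by move=> y; rewrite -ball_normE /= normE ltcR.
Qed.

Lemma pos_complexE (e : R[i]) : 0 < e -> e = (complex.Re e)%:C%C.
Proof. by move=> e0; apply/esym; rewrite RRe_real// realE (ltW e0). Qed.

Lemma hnorm_le1 : [set x : H | `|x| <= 1] = [set x | hnorm x <= 1].
Proof. by apply/seteqP; split=> x /=; rewrite normE lecR. Qed.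

Lemma compact_totally_bounded T : compact_operator T -> totally_bounded_op T.
Proof.
move=> [lT]; rewrite precompactE compact_cover hnorm_le1 => cT e e0.
have [||F _ hF] := cT H setT (fun y => [set z | hnorm (y - z) < e]).
- move=> y _; have -> : [set z | hnorm (y - z) < e] = ball y (e%:C%C).
    by rewrite -ball_normE; apply/seteqP; split=> z /=; rewrite normE ltcR.
  exact: ball_open.
- by move=> y _; exists y => //=; rewrite subrr hnorm0.
exists (finmap.enum_fset F) => x x1.
have [|y /= yF hy] := hF (T x); first by apply: subset_closure; exists x.
by exists y => //; rewrite hnormBC ltW.
Qed.

Lemma ultra_cover (F : set_system H) (s : seq H) (B : H -> set H) : UltraFilter F ->
  F [set x | exists2 y, y \in s & B y x] -> exists2 y, y \in s & F (B y).
Proof.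
move=> UF; have FF : ProperFilter F := ultra_proper; elim: s => [|z s IH] hF.
  by have [x [y]] := filter_ex hF.
have [hz|hz] := in_ultra_setVsetC (B z) UF; first by exists z => //; rewrite inE eqxx.
have [|y ys hy] := IH; last by exists y => //; rewrite inE ys orbT.
apply: filterS2 hF hz => x [y + By] nBz; rewrite inE => /orP[/eqP yz|ys]; last by exists y.
by case: nBz; rewrite -yz.
Qed.

(** By [ultra_cover], an ultrafilter on the closure of the image contains a ball of every radius, so
    it is Cauchy and converges. *)
Lemma totally_bounded_compact T : linear T -> totally_bounded_op T -> compact_operator T.
Proof.
move=> lT tT; split=> //; rewrite precompactE hnorm_le1 compact_ultra => F UF FK.
have FF : ProperFilter F := ultra_proper.
have /cauchy_cvg/cvg_ex[l Fl] : cauchy F.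
  apply: cauchy_exP => e e0.
  have e0' : 0 < complex.Re e by move: (e0); rewrite {1}(pos_complexE e0) ltcR.
  have e20 : 0 < complex.Re e / 2 by rewrite divr_gt0.
  have [s hs] := tT _ (divr_gt0 e20 (ltr0n _ 2)).
  have [|y _ Fy] := @ultra_cover F s (fun y => [set z | hnorm (y - z) < complex.Re e]) UF.
    apply: filterS FK => z /(_ _ (hball_nbhs z e20))[_ [[x /= x1 <-] /= zx]].
    have [y ys hy] := hs x x1; exists y => //=.
    rewrite hnormBC (le_lt_trans (hnormBT _ (T x) _))//.
    by move: hy zx; move: (hnorm _) (hnorm _) => u w; lra.
  by exists y; rewrite (pos_complexE e0); apply: filterS Fy => z /= hz; rewrite -ball_normE /= normE ltcR.
exists l; split=> //.
move=> B Bl; have /filter_ex[y [Ky By]] : F (closure [set T x | x in [set x | hnorm x <= 1]] `&` (B°)).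
  by apply: filterI => //; apply: Fl; exact: nbhs_interior.
have [z [Kz Bz]] := Ky _ By.
by exists z.
Qed.

Lemma compact_bounded_op T : compact_operator T -> bounded_operator T.
Proof.
move=> cT; have [lT _] := cT; apply/boundedP; split=> //.
have [F hF] := compact_totally_bounded cT ltr01.
pose M := \sum_(y <- F) hnorm y + 1.
have M0 : 0 <= M by rewrite addr_ge0// sumr_ge0// => y _; exact: hnorm_ge0.
have hM y : y \in F -> hnorm y <= \sum_(y <- F) hnorm y.
  by move=> yF; rewrite (big_rem y yF) lerDl sumr_ge0// => z _; exact: hnorm_ge0.
exists M => // x; have [->|x0] := eqVneq x 0; first by rewrite linop0// hnorm0 mulr0.
have xp := hnorm_gt0 x0.
have [|y yF hy] := hF ((hnorm x)^-1%:C%C *: x).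
  by rewrite hnormZr ger0_norm ?invr_ge0 ?hnorm_ge0// mulVf ?gt_eqF.
have : hnorm (T ((hnorm x)^-1%:C%C *: x)) <= M.
  rewrite -[T _](subrK y) (le_trans (hnormD _ _))// addrC lerD// hM//.
rewrite linopZ// hnormZr ger0_norm ?invr_ge0 ?hnorm_ge0//.
by rewrite ler_pdivrMl// mulrC.
Qed.

Lemma totally_bounded_comp T B : linear T -> totally_bounded_op T -> bounded_operator B ->
  totally_bounded_op (T \o B).
Proof.
move=> lT tT /boundedP[lB [C C0 hC]] e e0.
have C1 : 0 < C + 1 by rewrite ltr_wpDl.
have [F hF] := tT (e / (C + 1)) ltac:(by rewrite divr_gt0).
exists [seq (C + 1)%:C%C *: y | y <- F] => x x1.
have [|y yF hy] := hF (((C + 1)^-1)%:C%C *: B x).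
  rewrite hnormZr ger0_norm ?invr_ge0 ?(ltW C1)// ler_pdivrMl// mulr1.
  apply: le_trans (hC x) _; have := ler_wpM2l C0 x1; rewrite mulr1; lra.
exists ((C + 1)%:C%C *: y); first exact: map_f.
have -> : T (B x) - (C + 1)%:C%C *: y =
    (C + 1)%:C%C *: (T (((C + 1)^-1)%:C%C *: B x) - y).
  by rewrite scalerBr (linopZ lT) scalerA -rmorphM mulfV ?gt_eqF// scale1r.
by rewrite hnormZr gtr0_norm// -ler_pdivlMl// mulrC.
Qed.

Lemma compact_add S T : compact_operator S -> compact_operator T -> compact_operator (S \+ T).
Proof.
move=> cS cT; have [lS _] := cS; have [lT _] := cT.
apply: totally_bounded_compact.
  by move=> a x y /=; rewrite lS lT scalerDr addrACA.
move=> e e0; have e20 : 0 < e / 2 by rewrite divr_gt0.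
have [F hF] := compact_totally_bounded cS e20.
have [G hG] := compact_totally_bounded cT e20.
exists [seq y + z | y <- F, z <- G] => x x1.
have [y yF hy] := hF x x1; have [z zG hz] := hG x x1.
exists (y + z); first by apply/allpairsP; exists (y, z).
by rewrite /= opprD addrACA (le_trans (hnormD _ _))// [leRHS]splitr lerD.
Qed.

Lemma compact_scale a T : compact_operator T -> compact_operator (fun x => a *: T x).
Proof.
move=> cT; have [lT _] := cT; apply: totally_bounded_compact.
  by move=> b x y; rewrite lT scalerDr !scalerA mulrC.
move=> e e0.
have a0 : 0 <= complex.Re `|a| by rewrite normc_def /= sqrtr_ge0.
have a1 : 0 < complex.Re `|a| + 1 by rewrite ltr_wpDl.
have [F hF] := compact_totally_bounded cT (divr_gt0 e0 a1).
exists [seq a *: y | y <- F] => x x1; have [y yF hy] := hF x x1.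
exists (a *: y); first exact: map_f.
rewrite -scalerBr hnormZ; apply: le_trans (ler_wpM2l a0 hy) _.
by rewrite mulrCA ger_pMr// ler_pdivrMr// mul1r lerDl.
Qed.

(** Since |T^* z|^2 = <T (T^* z), z>, finite nets for [T \o adjoint T] at scale e^2 give nets for
    [adjoint T] at scale e. *)
Lemma compact_adjoint T : compact_operator T -> compact_operator (adjoint T).
Proof.
move=> cT; have bT := compact_bounded_op cT; have [lT _] := cT.
have bA := adjoint_bounded bT; have lA := bounded_lin bA.
apply: totally_bounded_compact => // e e0.
have tb := totally_bounded_comp lT (compact_totally_bounded cT) bA.
have [F hF] := tb (e ^+ 2 / 4) ltac:(by rewrite divr_gt0// exprn_gt0).
(* A net point need not be a value of [T \o adjoint T]; one that approximates such a value gets a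
   nearby value at some [w] in the unit ball, and any other gets the default 0. *)
have /choice[w hw] y : exists w, (exists2 x, hnorm x <= 1 & hnorm (T (adjoint T x) - y) <= e ^+ 2 / 4) ->
    hnorm w <= 1 /\ hnorm (T (adjoint T w) - y) <= e ^+ 2 / 4.
  by have [[x x1 hx]|nx] := pselect (exists2 x, hnorm x <= 1 & hnorm (T (adjoint T x) - y) <= e ^+ 2 / 4);
    [exists x|exists 0].
exists [seq adjoint T (w y) | y <- F] => x x1; have [y yF hy] := hF x x1.
exists (adjoint T (w y)); first exact: map_f.
have [w1 hwy] := hw y (ex_intro2 _ _ x x1 hy).
rewrite -linopB// -(@ler_sqr _ (hnorm _)) ?nnegrE ?hnorm_ge0 ?(ltW e0)//.
rewrite -hnormE /hre -adjoint_inner// -/(hre _ _) (le_trans (hre_le _ _))//.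
have h1 : hnorm (T (adjoint T (x - w y))) <= e ^+ 2 / 2.
  rewrite !linopB// (le_trans (hnormBT _ y _))// [hnorm (y - _)]hnormBC.
  by move: hy hwy => /=; move: (e ^+ 2) (hnorm _) (hnorm _) => ? ? ?; lra.
have h2 : hnorm (x - w y) <= 2 by rewrite (le_trans (hnormB _ _))//; lra.
by have := ler_pM (hnorm_ge0 _) (hnorm_ge0 _) h1 h2; lra.
Qed.

Lemma compact0 : compact_operator (fun=> 0 : H).
Proof.
apply: totally_bounded_compact => [|e e0]; first by move=> a x y; rewrite scaler0 addr0.
by exists [:: 0] => x _; exists 0; rewrite ?inE// subrr hnorm0 ltW.
Qed.

Lemma closure_hnorm (K : set H) x e : closure K x -> 0 < e -> exists2 y, K y & hnorm (x - y) <= e.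
Proof.
by move=> /(_ _ (hball_nbhs x _))h e0; have [y [Ky /= /ltW xy]] := h _ e0; exists y.
Qed.

(* The largest value [c] of [hnorm (S y)] on the compact closure of
   [S (M /\ unit ball)] is the square of the norm of [S] on [M]. *)
Lemma compact_eigenvector S M x0 : selfadj S -> compact_operator S -> closed_subspace M ->
  (forall x, M x -> M (S x)) -> M x0 -> x0 != 0 ->
  exists v l, [/\ M v, v != 0 & S v = l%:C%C *: v].
Proof.
move=> sS [lS cS] cM SM Mx0 x00; have [bS hS] := sS.
have [M0 ML Mc] := cM.
move/boundedP: bS => [_ [C C0 hC]].
pose K := closure (S @` [set x | M x /\ hnorm x <= 1]).
have cK : compact K.
  rewrite -precompactE; apply: precompact_subset cS; rewrite hnorm_le1.
  by move=> _ [x [_ x1] <-]; exists x.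
have K0 : K !=set0 by exists (S 0); apply: subset_closure; exists 0; rewrite //= hnorm0.
have cf : {within K, continuous (fun y => hnorm (S y))}.
  apply: continuous_subspaceT => y; apply/cvgrPdist_le => e e0.
  have C1 : 0 < C + 1 by rewrite ltr_wpDl.
  have := hball_nbhs y (divr_gt0 e0 C1); apply: filterS => z /= yz.
  have h : hnorm (S y - S z) <= e.
    rewrite -linopB// (le_trans (hC _))//; have := ler_wpM2l C0 (ltW yz).
    move=> /le_trans; apply; rewrite mulrCA ger_pMr// ler_pdivrMr// mul1r; lra.
  have h1 := hnormBT (S y) (S z) 0; have h2 := hnormBT (S z) (S y) 0.
  move: h1 h2; rewrite !subr0 [hnorm (S z - S y)]hnormBC ler_norml; lra.
have [c cK' hc] := compact_EVT_max K0 cK cf.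
rewrite inE in cK'.
have {}hc y : K y -> hnorm (S y) <= hnorm (S c) by move=> Ky; apply: hc; rewrite inE.
set mu := hnorm (S c) in hc.
have mu0 : 0 <= mu by exact: hnorm_ge0.
(* |S x|^2 = <S (S x), x>; for a unit vector x of [M], S x is in [K], so |S (S x)| <= mu. *)
have SMle x : M x -> hnorm (S x) ^+ 2 <= mu * hnorm x ^+ 2.
  move=> Mx; have [->|xn] := eqVneq x 0; first by rewrite linop0// hnorm0 expr0n mulr0.
  have xp := hnorm_gt0 xn.
  pose y := (hnorm x)^-1%:C%C *: x.
  have y1 : hnorm y = 1.
    by rewrite hnormZr ger0_norm ?invr_ge0 ?hnorm_ge0// mulVf ?gt_eqF.
  have My : M y by have := ML (hnorm x)^-1%:C%C _ _ Mx M0; rewrite addr0.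
  have h : hnorm (S y) ^+ 2 <= mu.
    rewrite -hnormE -(selfadj_hre (S y) y sS) (le_trans (hre_le _ _))// y1 mulr1 hc//.
    by apply: subset_closure; exists y; rewrite //= y1.
  have xE : x = (hnorm x)%:C%C *: y.
    by rewrite scalerA -rmorphM mulfV ?gt_eqF// scale1r.
  rewrite {1}xE (linopZ lS) hnormZr ger0_norm ?hnorm_ge0// exprMn mulrC.
  by rewrite ler_wpM2r ?sqr_ge0.
have Mcc : M c.
  apply: Mc => e e0; have [_ [x [Mx _] <-] h] := closure_hnorm cK' e0.
  by exists (S x) => //; exact: SM.
have cmu : hnorm c ^+ 2 <= mu.
  rewrite -[leRHS]sqr_sqrtr// ler_sqr ?nnegrE ?hnorm_ge0 ?sqrtr_ge0//.
  apply/ler_addgt0Pr => e e0; have [_ [x [Mx x1] <-] h] := closure_hnorm cK' e0.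
  rewrite -[c](subrK (S x)) (le_trans (hnormD _ _))// addrC lerD//.
  rewrite -(@ler_sqr _ (hnorm _)) ?nnegrE ?hnorm_ge0 ?sqrtr_ge0// sqr_sqrtr//.
  apply: le_trans (SMle x Mx) _; by apply: ler_piMr => //; apply: exprn_ile1 => //; exact: hnorm_ge0.
(* In the expanded square, |S (S c)|^2 <= mu^3, |S c|^2 = mu^2 and |c|^2 <= mu leave at most mu^3 -
   2 mu^3 + mu^3 = 0. *)
have SSc : S (S c) = mu%:C%C *: c.
  apply/eqP; rewrite -subr_eq0; apply/eqP; apply: hnorm_eq0.
  apply/eqP; rewrite -sqrf_eq0 eq_le sqr_ge0 andbT hnormB_sqr hreZr.
  rewrite (selfadj_hre (S c) c sS) hnormE hnormZr ger0_norm// exprMn -/mu.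
  have h := SMle _ (SM _ Mcc); rewrite -/mu in h.
  have := ler_wpM2l (sqr_ge0 mu) cmu.
  by move: h; move: (hnorm (S (S c)) ^+ 2) (hnorm c ^+ 2) => u w; lra.
have [mu_eq0|mun] := eqVneq mu 0.
  exists x0, 0; split=> //; rewrite scale0r; apply: hnorm_eq0; apply/eqP.
  by rewrite -sqrf_eq0 eq_le sqr_ge0 andbT (le_trans (SMle _ Mx0))// mu_eq0 mul0r.
have c0 : c != 0.
  by apply: contra_neq mun => c0; rewrite /mu c0 (linop0 lS) hnorm0.
pose r := Num.sqrt mu.
have rr : r * r = mu by rewrite -expr2 sqr_sqrtr.
(* As r^2 = mu, (S - r) (S + r) c = 0: either S c + r c is an eigenvector for r, or it vanishes and
   c is one for -r. *)
have Sw : S (S c + r%:C%C *: c) = r%:C%C *: (S c + r%:C%C *: c).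
  by rewrite (linopD lS) SSc (linopZ lS) scalerDr scalerA -rmorphM rr addrC.
have [w0|wn] := eqVneq (S c + r%:C%C *: c) 0.
  exists c, (- r); split=> //; apply/eqP.
  by rewrite rmorphN scaleNr -addr_eq0 w0.
exists (S c + r%:C%C *: c), r; split=> //.
by rewrite addrC; apply: ML => //; exact: SM.
Qed.

(** Zorn's lemma gives a maximal orthonormal set of eigenvectors. Its orthogonal complement is
    closed and invariant, and an eigenvector in it would contradict maximality. *)
Theorem compact_eigenbasis S : selfadj S -> compact_operator S ->
  exists E (l : H -> R), orthonormal_basis E /\ forall u, E u -> S u = (l u)%:C%C *: u.
Proof.
move=> sS cS; have lS := bounded_lin sS.1.
pose P E := orthonormal E /\ forall u, E u -> exists l : R, S u = l%:C%C *: u.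
have [|E [[oE eE] maxE]] := @Zorn_bigcup H P.
  move=> F FP totF; split.
    move=> u v [A FA Au] [B FB Bv].
    have [AB|BA] := totF _ _ FA FB.
      by apply: (FP _ FB).1 => //; exact: AB.
    by apply: (FP _ FA).1 => //; exact: BA.
  by move=> u [A FA Au]; exact: (FP _ FA).2.
have /choice[l hl] u : exists l : R, E u -> S u = l%:C%C *: u.
  by have [/eE[l Su]|nE] := pselect (E u); [exists l|exists 0].
exists E, l; split=> //; split=> // x hx; apply: contrapT => /eqP xn.
pose M := [set y : H | forall u, E u -> inner H y u = 0].
have cM : closed_subspace M.
  split=> /=.
  - by move=> u _; rewrite inner0l.
  - by move=> a y z hy hz u Eu; rewrite innerDl innerZl hy// hz// mulr0 addr0.
  - move=> y hy u Eu.
    have key v : (forall z, M z -> hre z v = 0) -> hre y v = 0.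
      move=> hv; apply/eqP; rewrite -normr_le0; apply/ler_addgt0Pr => e e0; rewrite add0r.
      have v1 : 0 < hnorm v + 1 by rewrite ltr_wpDl// hnorm_ge0.
      have [z Mz yz] := hy (e / (hnorm v + 1)) ltac:(by rewrite divr_gt0).
      have -> : hre y v = hre (y - z) v by rewrite hreBl (hv z)// subr0.
      apply: le_trans (hre_abs_le _ _) _.
      apply: le_trans (ler_wpM2r (hnorm_ge0 v) yz) _.
      by rewrite mulrAC ler_pdivrMr// ler_wpM2l ?(ltW e0)//; lra.
    by apply/inner_eq0P; split; apply: key => z /(_ u Eu)/inner_eq0P[].
have SM y : M y -> M (S y).
  by move=> My u Eu; rewrite sS.2 hl// innerZr My// mulr0.
have [v [lv [Mv vn Sv]]] := compact_eigenvector sS cS cM SM hx xn.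
have vp := hnorm_gt0 vn.
pose w := (hnorm v)^-1%:C%C *: v.
have w1 : inner H w w = 1.
  rewrite innerE normE hnormZr ger0_norm ?invr_ge0 ?hnorm_ge0// mulVf ?gt_eqF//.
  by rewrite expr1n.
have Mw : M w by move=> u Eu; rewrite innerZl Mv// mulr0.
have nEw : ~ E w by move=> /Mw; rewrite w1 => /eqP; rewrite oner_eq0.
apply: (maxE (E `|` [set w])); first split.
- by move=> u Eu; left.
- by move=> /(_ w (or_intror erefl)).
split.
  move=> u u' [Eu|->] [Eu'|->]; first exact: oE.
  - rewrite innerC Mw// conjc0; case: eqP => // uw; by rewrite uw in Eu.
  - rewrite Mw//; case: eqP => // wu; by rewrite -wu in Eu'.
  - by rewrite eqxx.
move=> u [/eE//|->]; exists lv.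
by rewrite (linopZ lS) Sv !scalerA mulrC.
Qed.

(** The eigenbasis of the zero operator witnesses that an orthonormal basis exists. *)
Lemma onbP : orthonormal_basis (@onb R H).
Proof.
apply: xgetPex; have s0 : selfadj (fun=> 0 : H).
  by split=> [|x y]; [exact: bounded0|rewrite inner0l inner0r].
by have [E [l [bE _]]] := compact_eigenbasis s0 compact0; exists E.
Qed.

End CompactOperators.

(** * Schatten norms *)

Section PowerSums.
Context {R : realType}.
Implicit Types (r s t x y : R).

Lemma powR_continuous_ge0 r : 1 <= r -> {within `[0, +oo[, continuous (fun t : R => t `^ r)}.
Proof.
move=> r1; have r0 : 0 < r by exact: lt_le_trans r1.
apply/subspace_continuousP => t; rewrite /= in_itv /= andbT le_eqVlt => /orP[/eqP <-|t0].
  (* At 0 the bound s^r <= s for s in [0, 1] takes the place of differentiability. *)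
  apply/cvgrPdist_le => e e0.
  have d0 : 0 < Num.min 1 e by rewrite lt_min ltr01.
  rewrite near_withinE; apply/nbhs_ballP; exists (Num.min 1 e) => // s.
  rewrite -ball_normE /= sub0r normrN in_itv /= andbT => h s0.
  move: h; rewrite ger0_norm// lt_min => /andP[s1 se].
  change (`|0 `^ r - s `^ r| <= e).
  rewrite powR0 ?gt_eqF// sub0r normrN ger0_norm ?powR_ge0//.
  apply: le_trans (ltW se); have [->|sn] := eqVneq s 0; first by rewrite powR0 ?gt_eqF.
  rewrite -[leRHS]powRr1//; apply: ger_powR => //.
  by rewrite lt_def sn s0 ltW.
apply: cvg_within_filter.
change ((fun s : R => s `^ r) @ t --> t `^ r).
have dt : derivable (fun s : R => s `^ r) t 1.
  by apply: derivable_powR; rewrite in_itv /= t0.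
have ct : {for (t : R), continuous (fun s : R => s `^ r)}.
  by apply/differentiable_continuous/derivable1_diffP; exact: dt.
exact: ct.
Qed.

(** Young's inequality for t and 1 with exponents r and r / (r - 1). *)
Lemma bernoulli_powR r t : 1 <= r -> 0 <= t -> r * t <= t `^ r + (r - 1).
Proof.
rewrite le_eqVlt => /orP[/eqP <-|r1] t0; first by rewrite powRr1// subrr addr0 mul1r.
have r0 : 0 < r by exact: lt_trans r1.
have r10 : 0 < r - 1 by rewrite subr_gt0.
have := @conjugate_powR R t 1 r (r / (r - 1)) t0 ler01 r0 (divr_gt0 r0 r10).
rewrite powR1 mulr1 mul1r => /(_ _)h.
have {}h : t <= t `^ r / r + (r / (r - 1))^-1.
  by apply: h; field; rewrite !gt_eqF.
have := ler_wpM2l (ltW r0) h; rewrite mulrDr.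
have -> : r * (t `^ r / r) = t `^ r by field; rewrite gt_eqF.
by have -> : r * (r / (r - 1))^-1 = r - 1 by field; rewrite !gt_eqF.
Qed.

(** The graph of t^r lies above its tangent at s; the slope r s^(r-1) is written as s^r r / s. *)
Lemma powR_tangent r s t : 1 <= r -> 0 < s -> 0 <= t ->
  s `^ r * r / s * t <= t `^ r + (r - 1) * s `^ r.
Proof.
move=> r1 s0 t0; have := bernoulli_powR r1 (divr_ge0 t0 (ltW s0)).
move=> /(ler_wpM2l (powR_ge0 s r)); rewrite mulrDr.
rewrite -powRM ?divr_ge0 ?(ltW s0)//.
have -> : s * (t / s) = t by field; rewrite gt_eqF.
have -> : s `^ r * (r * (t / s)) = s `^ r * r / s * t by field; rewrite gt_eqF.
by rewrite [s `^ r * (r - 1)]mulrC.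
Qed.

Lemma powR_le2 r s t : 0 <= r -> 0 <= s -> s <= t -> s `^ r <= t `^ r.
Proof.
move=> r0 s0 st; apply: ge0_ler_powR => //; rewrite nnegrE//.
exact: le_trans st.
Qed.

Lemma powR_convex r t a b : 1 <= r -> 0 <= t <= 1 -> 0 <= a -> 0 <= b ->
  (t * a + (1 - t) * b) `^ r <= t * a `^ r + (1 - t) * b `^ r.
Proof.
move=> r1 /andP[t0 t1] a0 b0.
have r0 : 0 < r by exact: lt_le_trans r1.
set s := t * a + (1 - t) * b.
have t10 : 0 <= 1 - t by rewrite subr_ge0.
have : 0 <= s by rewrite addr_ge0 ?mulr_ge0.
rewrite le_eqVlt => /orP[/eqP <-|s0].
  by rewrite powR0 ?gt_eqF// addr_ge0 ?mulr_ge0 ?powR_ge0.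
have h1 := ler_wpM2l t0 (powR_tangent r1 s0 a0).
have h2 := ler_wpM2l t10 (powR_tangent r1 s0 b0).
have h3 : t * (s `^ r * r / s * a) + (1 - t) * (s `^ r * r / s * b) = r * s `^ r.
  transitivity (s `^ r * r / s * s); first by rewrite {7}/s; ring.
  by field; rewrite gt_eqF.
have := lerD h1 h2; rewrite h3; lra.
Qed.

Context {T1 T2 : choiceType}.
Implicit Types (E : set T1).

(** Sum the tangent inequality at s against the weights [c]. As [L] is nonnegative, total weight at
    most 1 suffices, and what remains is K s - L = s^r. *)
Lemma jensen_esum (E : set T2) (c nu : T2 -> R) r s : 1 <= r -> 0 <= s ->
  (forall k, E k -> 0 <= c k) -> (forall k, E k -> 0 <= nu k) ->
  (s%:E <= \esum_(k in E) (c k * nu k)%:E)%E ->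
  (\esum_(k in E) (c k)%:E <= 1)%E ->
  ((s `^ r)%:E <= \esum_(k in E) (c k * nu k `^ r)%:E)%E.
Proof.
move=> r1 + c0 nu0 hs hc; have r0 : 0 < r by exact: lt_le_trans r1.
rewrite le_eqVlt => /orP[/eqP s0|s0].
  rewrite -s0 powR0 ?gt_eqF//; apply: esum_ge0 => k Ek.
  by rewrite lee_fin mulr_ge0 ?c0// powR_ge0.
pose K := s `^ r * r / s; pose L := (r - 1) * s `^ r.
have K0 : 0 <= K by rewrite /K !mulr_ge0 ?powR_ge0 ?invr_ge0// ltW.
have L0 : 0 <= L by rewrite /L mulr_ge0 ?powR_ge0 ?subr_ge0.
have h1 : (\esum_(k in E) (K * (c k * nu k))%:E <=
    \esum_(k in E) ((c k * nu k `^ r)%:E + (L * c k)%:E))%E.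
  apply: le_esum => k Ek; rewrite -EFinD lee_fin.
  have := ler_wpM2l (c0 k Ek) (powR_tangent r1 s0 (nu0 k Ek)).
  rewrite -/K -/L => h; apply: le_trans (le_trans _ h) _; rewrite le_eqVlt; apply/orP; left.
    by apply/eqP; ring.
  by apply/eqP; ring.
rewrite esumZl// in h1; last by move=> k Ek; rewrite mulr_ge0 ?c0 ?nu0.
rewrite esumD in h1; last 2 first.
- by move=> k Ek; rewrite lee_fin mulr_ge0 ?c0// powR_ge0.
- by move=> k Ek; rewrite lee_fin mulr_ge0 ?c0.
rewrite (esumZl L0 c0) in h1.
have KE : (0 <= K%:E)%E by rewrite lee_fin.
have LE : (0 <= L%:E)%E by rewrite lee_fin.
have h2 := le_trans (lee_wpmul2l KE hs) h1.
have h3 := le_trans h2 (leeD2l _ (lee_wpmul2l LE hc)).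
move: h3; rewrite mule1 -EFinM -leeBlDr// -EFinB; congr (_ <= _)%E.
by congr EFin; rewrite /K /L; field; rewrite gt_eqF.
Qed.

(** Row sums enter Jensen's inequality; once the sums are exchanged, column sums bound the weight of
    each power of [nu k]. *)
Lemma substochastic_powR_le E (E' : set T2) (c : T1 -> T2 -> R) (s : T1 -> R) (nu : T2 -> R) r :
  1 <= r -> (forall j k, E j -> E' k -> 0 <= c j k) ->
  (forall j, E j -> 0 <= s j) -> (forall k, E' k -> 0 <= nu k) ->
  (forall j, E j -> ((s j)%:E <= \esum_(k in E') (c j k * nu k)%:E)%E) ->
  (forall j, E j -> (\esum_(k in E') (c j k)%:E <= 1)%E) ->
  (forall k, E' k -> (\esum_(j in E) (c j k)%:E <= 1)%E) ->
  (\esum_(j in E) (s j `^ r)%:E <= \esum_(k in E') (nu k `^ r)%:E)%E.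
Proof.
move=> r1 c0 s0 nu0 hs hrow hcol.
apply: (@le_trans _ _ (\esum_(j in E) \esum_(k in E') (c j k * nu k `^ r)%:E)).
  by apply: le_esum => j Ej; apply: jensen_esum => // [|k Ek||]; [exact: s0|exact: c0|exact: hs|exact: hrow].
rewrite exchange_esum => [|j k Ej Ek]; last by rewrite lee_fin mulr_ge0 ?c0// powR_ge0.
apply: le_esum => k Ek.
under eq_esum => j _ do rewrite mulrC.
rewrite esumZl ?powR_ge0// => [|j Ej]; last exact: c0.
have pE : (0 <= (nu k `^ r)%:E)%E by rewrite lee_fin powR_ge0.
by have := lee_wpmul2l pE (hcol k Ek); rewrite mule1.
Qed.

(** Convexity of t^r: (a + b) / (x + y) is the convex combination of a / x and b / y with weights x
    / (x + y) and y / (x + y). If x or y is 0, the corresponding terms all vanish. *)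
Lemma minkowski_esum E (a b : T1 -> R) r x y : 1 <= r -> 0 <= x -> 0 <= y ->
  (forall k, E k -> 0 <= a k) -> (forall k, E k -> 0 <= b k) ->
  (\esum_(k in E) (a k `^ r)%:E <= (x `^ r)%:E)%E ->
  (\esum_(k in E) (b k `^ r)%:E <= (y `^ r)%:E)%E ->
  (\esum_(k in E) ((a k + b k) `^ r)%:E <= ((x + y) `^ r)%:E)%E.
Proof.
move=> r1 x0 y0 a0 b0 ha hb; have r0 : 0 < r by exact: lt_le_trans r1.
have zero c : (\esum_(k in E) (c k `^ r)%:E <= (0 `^ r)%:E)%E ->
    (forall k, E k -> 0 <= c k) -> forall k, E k -> c k = 0.
  move=> hc c0 k Ek.
  have kE v : v \in [:: k] -> E v by rewrite inE => /eqP ->.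
  have := @ge_esum_seq R T1 E (fun k => c k `^ r) [:: k] isT kE.
  rewrite big_seq1 => /le_trans/(_ hc); rewrite powR0 ?gt_eqF// lee_fin => h.
  have : c k `^ r == 0 by rewrite eq_le h powR_ge0.
  by rewrite powR_eq0 => /andP[/eqP].
move: x0; rewrite le_eqVlt => /orP[/eqP xe|xp].
  rewrite -xe add0r; apply: le_trans hb; apply: le_esum => k Ek.
  by rewrite (zero a) ?add0r// xe.
move: y0; rewrite le_eqVlt => /orP[/eqP ye|yp].
  rewrite -ye addr0; apply: le_trans ha; apply: le_esum => k Ek.
  by rewrite (zero b) ?addr0// ye.
have xy : 0 < x + y by exact: addr_gt0.
pose al := (x + y) `^ r * (x / (x + y) / x `^ r).
pose be := (x + y) `^ r * (y / (x + y) / y `^ r).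
have al0 : 0 <= al by rewrite /al !mulr_ge0 ?powR_ge0 ?invr_ge0 ?powR_ge0 ?(ltW xp) ?(ltW xy).
have be0 : 0 <= be by rewrite /be !mulr_ge0 ?powR_ge0 ?invr_ge0 ?powR_ge0 ?(ltW yp) ?(ltW xy).
apply: (@le_trans _ _ (\esum_(k in E) ((al * a k `^ r)%:E + (be * b k `^ r)%:E))%E).
  apply: le_esum => k Ek; rewrite -EFinD lee_fin.
  have t01 : 0 <= x / (x + y) <= 1.
    apply/andP; split; first by apply: divr_ge0; exact: ltW.
    by rewrite ler_pdivrMr// mul1r lerDl ltW.
  have := powR_convex r1 t01 (divr_ge0 (a0 k Ek) (ltW xp)) (divr_ge0 (b0 k Ek) (ltW yp)).
  have -> : 1 - x / (x + y) = y / (x + y) by field; rewrite gt_eqF.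
  have -> : x / (x + y) * (a k / x) + y / (x + y) * (b k / y) = (a k + b k) / (x + y).
    by field; rewrite !gt_eqF.
  move=> /(ler_wpM2l (powR_ge0 (x + y) r)).
  rewrite -powRM ?divr_ge0 ?addr_ge0 ?a0 ?b0 ?(ltW xp) ?(ltW yp)//.
  have -> : (x + y) * ((a k + b k) / (x + y)) = a k + b k by field; rewrite gt_eqF.
  have dE u v : 0 <= u -> 0 < v -> (u / v) `^ r = u `^ r / v `^ r.
    move=> u0 v0; rewrite powRM ?invr_ge0 ?(ltW v0)//; congr (_ * _).
    have vr : v `^ r != 0 by rewrite gt_eqF// powR_gt0.
    by apply: (mulIf vr); rewrite (mulVf vr) -powRM ?invr_ge0 ?(ltW v0)// mulVf ?gt_eqF// powR1.
  rewrite !dE ?a0 ?b0// => /le_trans; apply; rewrite le_eqVlt; apply/orP; left; apply/eqP.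
  rewrite /al /be; ring.
rewrite esumD; last 2 first.
- by move=> k Ek; rewrite lee_fin mulr_ge0// powR_ge0.
- by move=> k Ek; rewrite lee_fin mulr_ge0// powR_ge0.
rewrite !esumZl//; try by move=> k _; exact: powR_ge0.
have alE : (0 <= al%:E)%E by rewrite lee_fin.
have beE : (0 <= be%:E)%E by rewrite lee_fin.
apply: le_trans (leeD (lee_wpmul2l alE ha) (lee_wpmul2l beE hb)) _.
rewrite -!EFinM -EFinD lee_fin le_eqVlt; apply/orP; left; apply/eqP.
have xr : x `^ r != 0 by rewrite gt_eqF// powR_gt0.
have yr : y `^ r != 0 by rewrite gt_eqF// powR_gt0.
by rewrite /al /be; field; rewrite xr yr gt_eqF.
Qed.

End PowerSums.

(** * Traces in eigenbases and diagonal estimates *)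

Section SchattenNorm.
Context {R : realType} {H : hilbertSpace R}.
Implicit Types (x y z u p v e : H) (a : R[i]) (s t c r : R) (A B T S U D N X : H -> H) (E M : set H)
  (F G : seq H) (l : H -> R).

Lemma onb_norm E u : orthonormal E -> E u -> hnorm u = 1.
Proof.
move=> oE Eu; have := oE u u Eu Eu; rewrite eqxx => h.
have : hnorm u ^+ 2 = 1 by rewrite -hnormE /hre h.
by move=> /eqP; rewrite sqrp_eq1 ?hnorm_ge0// => /eqP.
Qed.

(** From |X|^2 u = c^2 u, the vector v = |X| u - |c| u satisfies |X| v = - |c| v, so positivity of
    |X| forces v = 0 unless c = 0, in which case |X| u = 0 directly. *)
Lemma absop_eigen X u c : selfadj X -> X u = c%:C%C *: u -> absop X u = `|c|%:C%C *: u.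
Proof.
move=> sX Xu; have bX := sX.1; have pA := absop_positive bX.
have lA := bounded_lin pA.1; have lX := bounded_lin bX.
have AA : absop X (absop X u) = (c ^+ 2)%:C%C *: u.
  by rewrite absop_sqr// selfadj_adjoint// Xu linopZ// Xu scalerA -rmorphM.
pose v := absop X u - `|c|%:C%C *: u.
have Av : absop X v = - (`|c|%:C%C *: v).
  rewrite /v linopB// AA linopZ// scalerBr scalerA -rmorphM -expr2 real_normK ?num_real//.
  by rewrite opprB.
have [c0|cn] := eqVneq c 0.
  rewrite c0 normr0 scale0r; apply: hnorm_eq0; apply/eqP.
  by rewrite -sqrf_eq0 -hnormE (selfadj_hre _ _ (positive_selfadj pA)) AA c0 expr0n /= scale0r hre0r.
apply/eqP; rewrite -subr_eq0 -/v; apply/eqP; apply: hnorm_eq0.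
have := positive_hre v pA; rewrite Av hreNl hreZl hnormE oppr_ge0.
rewrite pmulr_rle0 ?normr_gt0// => h; apply/eqP; rewrite -sqrf_eq0 eq_le h; exact: sqr_ge0.
Qed.

(** Each diagonal entry over [onb] is expanded in the eigenbasis [E]; exchanging the sums leaves,
    for each eigenvector, its Parseval sum over [onb], which is 1. *)
Lemma trace_pow_eigen X E l r : 1 <= r -> selfadj X -> orthonormal_basis E ->
  (forall u, E u -> X u = (l u)%:C%C *: u) ->
  trace_pow r X = \esum_(u in E) (`|l u| `^ r)%:E.
Proof.
move=> r1 sX bE Xl; have pA := absop_positive sX.1; have sA := positive_selfadj pA.
have hC := cfc_continuous pA (powR_continuous_ge0 r1).
rewrite /trace_pow /trace; set C := cfc _ _ in hC *.
have sC := cfc_selfadj sA hC.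
have Cl u : E u -> C u = (`|l u| `^ r)%:C%C *: u.
  by move=> Eu; apply: (cfc_eigen sA hC); apply: absop_eigen => //; exact: Xl.
transitivity (\esum_(e in @onb R H) \esum_(u in E) (`|l u| `^ r * csq e u)%:E).
  apply: eq_esum => e _; rewrite (diagonal_form e bE sC Cl)// => u _; exact: powR_ge0.
rewrite exchange_esum => [|e u _ _]; last by rewrite lee_fin mulr_ge0 ?powR_ge0 ?csq_ge0.
apply: eq_esum => u Eu; rewrite esumZl ?powR_ge0// => [|e _]; last exact: csq_ge0.
under eq_esum => e _ do rewrite csqC.
by rewrite parseval; [rewrite (onb_norm bE.1 Eu) expr1n mule1|exact: onbP].
Qed.

Lemma selfadj_add A B : selfadj A -> selfadj B -> selfadj (A \+ B).
Proof.
move=> [bA hA] [bB hB]; split; first exact: bounded_add.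
by move=> x y /=; rewrite innerDl innerDr hA hB.
Qed.

Lemma selfadj_scale c A : selfadj A -> selfadj (fun x => c%:C%C *: A x).
Proof.
move=> [bA hA]; split; first exact: bounded_scale.
by move=> x y; rewrite innerZl innerZr hA conjc_real.
Qed.

(** |<X e, e>| <= <|X| e, e>, and the latter averages the |l u| with weights [csq e u], whose row
    sums are 1 by Parseval and whose column sums are at most 1 by Bessel. *)
Lemma diagonal_powR_le X E r : 1 <= r -> selfadj X -> compact_operator X -> orthonormal E ->
  (\esum_(e in E) (`|hre (X e) e| `^ r)%:E <= trace_pow r X)%E.
Proof.
move=> r1 sX cX oE; have [E' [l [bE' Xl]]] := compact_eigenbasis sX cX.
rewrite (trace_pow_eigen r1 sX bE' Xl).
have pA := absop_positive sX.1; have sA := positive_selfadj pA.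
have Al u : E' u -> absop X u = `|l u|%:C%C *: u by move=> Eu; apply: absop_eigen => //; exact: Xl.
have absle e : `|hre (X e) e| <= hre (absop X e) e.
  (* For c = 1 and c = -1 the operator |X| + c X is diagonal on [E'] with nonnegative
     eigenvalues. *)
  have key c : `|c| = 1 -> 0 <= hre (absop X e) e + c * hre (X e) e.
    move=> c1; have sS := selfadj_add sA (selfadj_scale c sX).
    have Sl u : E' u -> (absop X \+ (fun x => c%:C%C *: X x)) u = (`|l u| + c * l u)%:C%C *: u.
      by move=> Eu /=; rewrite Al// Xl// scalerA -rmorphM -scalerDl -rmorphD.
    have d0 u : E' u -> 0 <= `|l u| + c * l u.
      by move=> _; have := ler_norm (- (c * l u)); rewrite normrN normrM c1 mul1r; lra.
    have : (0 <= (hre ((absop X \+ (fun x => c%:C%C *: X x)) e) e)%:E)%E.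
      rewrite -(diagonal_form e bE' sS Sl d0); apply: esum_ge0 => u Eu.
      by rewrite lee_fin mulr_ge0 ?csq_ge0 ?d0.
    by rewrite lee_fin hreDl hreZl.
  rewrite ler_norml; apply/andP; split.
    by have := key 1 (normr1 _); lra.
  by have := key (-1) (normrN1 _); lra.
apply: (@substochastic_powR_le R _ _ E E' (fun e u => csq e u) _ (fun u => `|l u|)) => //.
- by move=> e u _ _; exact: csq_ge0.
- move=> e Ee; apply: (@le_trans _ _ (hre (absop X e) e)%:E); first by rewrite lee_fin.
  rewrite -(diagonal_form e bE' sA Al)// le_eqVlt; apply/orP; left; apply/eqP.
  by apply: eq_esum => u _; rewrite mulrC.
- by move=> e Ee; rewrite parseval// (onb_norm oE Ee) expr1n.
- move=> u Eu; under eq_esum => e _ do rewrite csqC.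
  by apply: le_trans (bessel u oE) _; rewrite (onb_norm bE'.1 Eu) expr1n.
Qed.

Lemma residual_span E F (b : H -> R[i]) u : orthonormal E -> uniq F ->
  (forall v, v \in F -> E v) -> E u ->
  inner H (\sum_(v <- F) b v *: v) u = if u \in F then b u else 0.
Proof.
move=> oE + + Eu; elim: F => [|w F IH] /= => [_ _|/andP[wF uF] FE].
  by rewrite big_nil inner0l.
have Ew : E w by apply: FE; rewrite inE eqxx.
rewrite big_cons innerDl innerZl (oE w u Ew Eu) IH// => [|v vF]; last first.
  by apply: FE; rewrite inE vF orbT.
rewrite inE eq_sym; have [->|uw] := eqVneq u w; first by rewrite (negPf wF) mulr1 addr0.
by rewrite mulr0 add0r.
Qed.

(* With [c e u = |<A e, u>|^2 / nu_u], both the rows and the columns of [c] sum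
   to at most [1]: the columns because [|A^* u|^2 <= <N u, u> = nu_u], and the
   rows by applying [|A^* w|^2 <= <N w, w>] to [w = sum_u (<A e, u> / nu_u) u]. *)
Lemma dominated_powR_le A B N E E' l r : 1 <= r ->
  (forall x y, inner H (A x) y = inner H x (B y)) ->
  selfadj N -> orthonormal_basis E' -> (forall u, E' u -> N u = (l u)%:C%C *: u) ->
  (forall v, hnorm (B v) ^+ 2 <= hre (N v) v) -> orthonormal E ->
  (\esum_(e in E) ((hnorm (A e) ^+ 2) `^ r)%:E <= \esum_(u in E') (`|l u| `^ r)%:E)%E.
Proof.
move=> r1 AB sN bE' Nl BN oE; have [oE' _] := bE'.
have lE u : E' u -> l u = hre (N u) u.
  by move=> Eu; rewrite Nl// hreZl hnormE (onb_norm oE' Eu) expr1n mulr1.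
have l0 u : E' u -> 0 <= l u by move=> Eu; rewrite lE// (le_trans _ (BN u))// sqr_ge0.
have Bu u : E' u -> hnorm (B u) ^+ 2 <= l u by move=> Eu; rewrite lE.
have csqA e u : csq (A e) u = csq e (B u) by apply: (@complexI R); rewrite !csqE AB.
pose c e u := csq (A e) u / l u.
have c0 e u : E' u -> 0 <= c e u by move=> Eu; rewrite divr_ge0 ?csq_ge0 ?l0.
(* If [l u] is 0, the quotient [c e u] is 0 by convention; this is consistent because [B u] is then
   0. *)
have cl e u : E' u -> csq (A e) u = c e u * l u.
  move=> Eu; rewrite /c; have [lu|lun] := eqVneq (l u) 0; last by rewrite divfK.
  have := Bu u Eu; rewrite lu => B0.
  have {}B0 : B u = 0.
    by apply: hnorm_eq0; apply/eqP; rewrite -sqrf_eq0 eq_le B0 sqr_ge0.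
  by rewrite mulr0 csqA B0 /csq scaler0 hre0r expr0n addr0.
apply: (@substochastic_powR_le R _ _ E E' c) => //.
- by move=> e u _; exact: c0.
- by move=> e _; exact: sqr_ge0.
- move=> e Ee; rewrite -(parseval (A e) bE').
  rewrite le_eqVlt; apply/orP; left; apply/eqP; apply: eq_esum => u Eu.
  by rewrite ger0_norm ?l0// -cl.
- move=> e Ee; apply: le_esum_bound => F uF FE.
  pose b u : R[i] := inner H (A e) u * ((l u)^-1)%:C%C.
  have bJ u : conjc (b u) = conjc (inner H (A e) u) * ((l u)^-1)%:C%C.
    have conjM (z1 z2 : R[i]) : conjc (z1 * z2) = conjc z1 * conjc z2 by exact: rmorphM.
    by rewrite conjM conjc_real.
  pose w := \sum_(u <- F) b u *: u.
  pose S := \sum_(u <- F) c e u.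
  have S0 : 0 <= S by rewrite /S big_seq sumr_ge0// => u /FE; exact: c0.
  have wE u : u \in F -> inner H w u = b u.
    by move=> uF'; rewrite (residual_span b oE' uF FE (FE u uF')) uF'.
  have rw : residual F w = 0.
    apply/eqP; rewrite /residual subr_eq0; apply/eqP; rewrite {1}/w.
    by rewrite !big_seq; apply: eq_bigr => u uF'; rewrite wE.
  have Nw : hre (N w) w = S.
    have := residual_form w oE' sN Nl uF FE; rewrite rw hre0r => /esym/eqP.
    rewrite subr_eq0 => /eqP ->; rewrite /S !big_seq; apply: eq_bigr => u uF'.
    have -> : csq w u = csq (A e) u / l u ^+ 2.
      apply: (@complexI R); rewrite csqE wE// bJ mulrACA -csqE.
      by rewrite -rmorphM -rmorphM -expr2 exprVn.
    rewrite /c; have [lu|lun] := eqVneq (l u) 0; last by field.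
    by rewrite lu invr0 !mulr0 mul0r.
  have Aw : hre (A e) w = S.
    rewrite /w (big_morph (hre (A e)) (hreDr (A e)) (hre0r (A e))) /S.
    apply: eq_bigr => u _; rewrite /hre innerZr bJ.
    by rewrite mulrAC [X in X * _]mulrC -csqE -rmorphM.
  have : S ^+ 2 <= S.
    rewrite -[leRHS]Nw (le_trans _ (BN w))//.
    have h : S <= hnorm (B w).
      by rewrite -Aw /hre AB -/(hre _ _) (le_trans (hre_le _ _))// (onb_norm oE Ee) mul1r.
    by rewrite ler_sqr ?nnegrE ?hnorm_ge0.
  rewrite lee_fin -/S => h; rewrite leNgt; apply/negP => S1.
  by nra.
- move=> u Eu; rewrite /c.
  under eq_esum => e _ do rewrite csqA csqC mulrC.
  rewrite esumZl ?invr_ge0 ?l0// => [|e _]; last exact: csq_ge0.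
  have [lu|lun] := eqVneq (l u) 0; first by rewrite lu invr0 mul0e.
  have iE : (0 <= (l u)^-1%:E)%E by rewrite lee_fin invr_ge0 l0.
  have hB : (\esum_(e in E) (csq (B u) e)%:E <= (l u)%:E)%E.
    by apply: le_trans (bessel (B u) oE) _; rewrite lee_fin Bu.
  apply: le_trans (lee_wpmul2l iE hB) _.
  by rewrite -EFinM mulVf.
Qed.

End SchattenNorm.

(** * The Aluthge transform *)

Section AluthgeBound.
Context {R : realType} {H : hilbertSpace R}.
Implicit Types (x y u v e : H) (a : R[i]) (s t c w z r : R) (A B T S U F G X Y Z N : H -> H) (E : set H).

Lemma adjoint_innerl T x y : bounded_operator T ->
  inner H (adjoint T x) y = inner H x (T y).
Proof. by move=> bT; rewrite innerC -adjoint_inner// -innerC. Qed.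

Lemma re_op_selfadj X : bounded_operator X -> selfadj (re_op X).
Proof.
move=> bX; have bA := adjoint_bounded bX; split.
  exact: bounded_scale (bounded_add bX bA).
have half : (2^-1 : R[i]) = (2^-1 : R)%:C%C by rewrite fmorphV rmorph_nat.
move=> x y; rewrite /re_op half innerZl innerZr conjc_real innerDl innerDr.
by rewrite (adjoint_innerl _ _ bX) -(adjoint_inner _ _ bX) addrC.
Qed.

Lemma re_op_compact X : compact_operator X -> compact_operator (re_op X).
Proof.
move=> cX; exact: compact_scale (compact_add cX (compact_adjoint cX)).
Qed.

Lemma re_op_form X v : bounded_operator X -> hre (re_op X v) v = hre (X v) v.
Proof.
move=> bX; rewrite /re_op.
have -> : (2^-1 : R[i]) = (2^-1 : R)%:C%C by rewrite fmorphV rmorph_nat.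
rewrite hreZl hreDl.
have -> : hre (adjoint X v) v = hre (X v) v.
  by rewrite [RHS]/hre adjoint_inner// -/(hre _ _) hreC.
by field.
Qed.

(** Polarization at v and y, where y is X v rescaled to the length of v; the parallelogram law
    bounds the difference of the two forms by 4 c |v|^2. *)
Lemma selfadj_form_le X c : selfadj X -> 0 <= c ->
  (forall v, `|hre (X v) v| <= c * hnorm v ^+ 2) -> forall v, hnorm (X v) <= c * hnorm v.
Proof.
move=> sX c0 hX v; have lX := bounded_lin sX.1.
have [v0|vn] := eqVneq (hnorm v) 0.
  by rewrite (hnorm_eq0 v0) linop0// hnorm0 mulr0.
have [Xv0|Xvn] := eqVneq (hnorm (X v)) 0; first by rewrite Xv0 mulr_ge0// hnorm_ge0.
have vp : 0 < hnorm v by rewrite lt_def vn hnorm_ge0.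
have Xvp : 0 < hnorm (X v) by rewrite lt_def Xvn hnorm_ge0.
pose k := hnorm v / hnorm (X v).
pose y := k%:C%C *: X v.
have ny : hnorm y = hnorm v.
  by rewrite /y hnormZr ger0_norm ?divr_ge0 ?hnorm_ge0// /k divfK.
have h1 : hre (X v) y = hnorm v * hnorm (X v).
  by rewrite /y hreZr hnormE /k; field.
have h2 : 4 * hre (X v) y = hre (X (v + y)) (v + y) - hre (X (v - y)) (v - y).
  have sy : hre (X y) v = hre (X v) y by rewrite selfadj_hre// hreC.
  clearbody y; rewrite linopD// linopB// !hreDl !hreNl !hreDr !hreNr sy; ring.
have h3 := hX (v + y); have h4 := hX (v - y).
have h5 : hnorm (v + y) ^+ 2 + hnorm (v - y) ^+ 2 = 4 * hnorm v ^+ 2.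
  by rewrite hnormD_sqr hnormB_sqr ny; ring.
have h6 : 4 * (hnorm v * hnorm (X v)) <= c * (4 * hnorm v ^+ 2).
  rewrite -h1 h2 -h5 mulrDr.
  by move: h3 h4; rewrite !ler_norml => /andP[_ h3] /andP[h4 _]; lra.
rewrite -(ler_pM2l vp); have -> : hnorm v * (c * hnorm v) = c * hnorm v ^+ 2 by ring.
lra.
Qed.

(** The bound passes from [B] to its adjoint [A]: |A v|^2 <= |v| |B (A v)| and |B (A v)|^2 <= c |A
    v|^2. *)
Lemma dominated_norm_le A B N c :
  (forall x y, inner H (A x) y = inner H x (B y)) ->
  (forall v, hnorm (B v) ^+ 2 <= hre (N v) v) -> 0 <= c ->
  (forall v, hre (N v) v <= c * hnorm v ^+ 2) -> forall v, hnorm (A v) ^+ 2 <= c * hnorm v ^+ 2.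
Proof.
move=> AB BN c0 Nc v.
have h1 : hnorm (A v) ^+ 2 <= hnorm v * hnorm (B (A v)).
  by rewrite -hnormE /hre AB -/(hre _ _) hre_le.
have h2 : hnorm (B (A v)) ^+ 2 <= c * hnorm (A v) ^+ 2 := le_trans (BN _) (Nc _).
have [v0|vn] := eqVneq (hnorm (A v)) 0; first by rewrite v0 expr0n mulr_ge0// sqr_ge0.
have vp : 0 < hnorm (A v) ^+ 2 by rewrite exprn_gt0// lt_def vn hnorm_ge0.
rewrite -(ler_pM2r vp) -expr2.
apply: (@le_trans _ _ ((hnorm v * hnorm (B (A v))) ^+ 2)).
  by rewrite ler_sqr ?nnegrE ?sqr_ge0// mulr_ge0// hnorm_ge0.
rewrite exprMn; apply: le_trans (ler_wpM2l (sqr_ge0 _) h2) _.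
by rewrite mulrCA mulrA.
Qed.

(** With a = e^(it), the operator A for [s = 1] and B for [s = -1]. *)
Definition aluthge_factor U F G a s x := a *: F x + s%:C%C *: G (adjoint U x).

(** The adjoint of the factor when [F] and [G] are self-adjoint. *)
Definition aluthge_cofactor U F G a s x := conjc a *: F x + s%:C%C *: U (G x).

Lemma aluthge_factor_adjoint U F G a s x y : bounded_operator U -> selfadj F -> selfadj G ->
  inner H (aluthge_factor U F G a s x) y = inner H x (aluthge_cofactor U F G a s y).
Proof.
move=> bU [_ hF] [_ hG]; rewrite /aluthge_factor /aluthge_cofactor.
rewrite innerDl innerDr !innerZl !innerZr hF hG conjc_real conjcK; congr (_ + _ * _).
by rewrite innerC -adjoint_inner// -innerC.
Qed.

(** The cross term of the expanded square is the form of a F U G, the rotated Aluthge transform. *)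
Lemma aluthge_cofactor_norm U F G a s v : selfadj F -> selfadj G ->
  (forall x, hnorm (U x) <= hnorm x) -> `|a| = 1 -> s ^+ 2 = 1 ->
  hnorm (aluthge_cofactor U F G a s v) ^+ 2 <=
    hre (F (F v) + G (G v)) v + 2 * s * hre (a *: F (U (G v))) v.
Proof.
move=> sF sG hU a1 s1; rewrite hnormD_sqr hreDl !(selfadj_hre _ v sF, selfadj_hre _ v sG).
rewrite !hnormE hreZr hnormZ normcJ a1 /= mul1r hnormZr exprMn real_normK ?num_real// s1 mul1r.
have -> : hre (conjc a *: F v) (U (G v)) = hre (a *: F (U (G v))) v.
  by rewrite [RHS]hreC /hre innerZl innerZr sF.2.
have : hnorm (U (G v)) ^+ 2 <= hnorm (G v) ^+ 2 by rewrite ler_sqr ?nnegrE ?hnorm_ge0.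
lra.
Qed.

(* Polarization: the squares [A^* A] of the two factors differ by [4 Re(a T)]. *)
Lemma aluthge_factor_polarization U F G a v : bounded_operator U -> selfadj G ->
  hnorm (aluthge_factor U F G a 1 v) ^+ 2 - hnorm (aluthge_factor U F G a (-1) v) ^+ 2 =
  4 * hre (a *: U (G (F v))) v.
Proof.
move=> bU sG; rewrite /aluthge_factor !hnormD_sqr !hreZr !hnormZr normrN1 normr1.
have -> : hre (a *: F v) (G (adjoint U v)) = hre (a *: U (G (F v))) v.
  by rewrite /hre !innerZl (adjoint_inner _ _ bU) sG.2.
ring.
Qed.

(** Each eigenvalue is <Z u, u> + 2 s <Y u, u>, so Minkowski's inequality for diagonal entries
    stands in for the triangle inequality of the Schatten norm. *)
Lemma sum_powR_le Z Y E (l : H -> R) s z w r : 1 <= r -> s ^+ 2 = 1 -> 0 <= z -> 0 <= w ->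
  selfadj Z -> compact_operator Z -> selfadj Y -> compact_operator Y ->
  (trace_pow r Z <= (z `^ r)%:E)%E -> (trace_pow r Y <= (w `^ r)%:E)%E ->
  orthonormal E -> (forall u, E u -> Z u + (2 * s)%:C%C *: Y u = (l u)%:C%C *: u) ->
  (\esum_(u in E) (`|l u| `^ r)%:E <= ((z + 2 * w) `^ r)%:E)%E.
Proof.
move=> r1 s1 z0 w0 sZ cZ sY cY hZ hY oE hl; have r0 : 0 <= r by exact: le_trans r1.
have ns : `|s| = 1.
  by apply/eqP; rewrite -(@eqrXn2 _ 2)// real_normK ?num_real// s1 expr1n.
apply: (@le_trans _ _ (\esum_(u in E) ((`|hre (Z u) u| + 2 * `|hre (Y u) u|) `^ r)%:E)).
  apply: le_esum => u Eu; rewrite lee_fin; apply: powR_le2 => //.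
  have -> : l u = hre (Z u) u + 2 * s * hre (Y u) u.
    by rewrite -hreZl -hreDl hl// hreZl hnormE (onb_norm oE Eu) expr1n mulr1.
  by apply: le_trans (ler_normD _ _) _; rewrite !normrM ns mulr1 (ger0_norm (ltW (ltr0n _ 2))).
apply: minkowski_esum => //.
- by rewrite mulr_ge0.
- exact: le_trans (diagonal_powR_le r1 sZ cZ oE) hZ.
under eq_esum => u _ do rewrite powRM//.
rewrite esumZl ?powR_ge0//.
rewrite powRM// EFinM; apply: lee_wpmul2l; first by rewrite lee_fin powR_ge0.
exact: le_trans (diagonal_powR_le r1 sY cY oE) hY.
Qed.

(** A difference of nonnegative numbers is at most the larger one in absolute value, so no convexity
    factor 2^(r-1) enters. *)
Lemma powR_diff_le r t c d : 1 <= r -> 0 <= c -> 0 <= d -> 4 * t = c - d ->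
  `|t| `^ r <= 4^-1 `^ r * (c `^ r + d `^ r).
Proof.
move=> r1 c0 d0 e; have r0 : 0 <= r by exact: le_trans r1.
have cr := powR_ge0 c r; have dr := powR_ge0 d r.
have [cd|dc] := leP c d.
  apply: (@le_trans _ _ ((4^-1 * d) `^ r)).
    by apply: powR_le2 => //; rewrite ler_norml; lra.
  by rewrite powRM// ler_wpM2l ?powR_ge0// lerDr.
apply: (@le_trans _ _ ((4^-1 * c) `^ r)).
  by apply: powR_le2 => //; rewrite ler_norml; lra.
by rewrite powRM// ler_wpM2l ?powR_ge0// lerDl.
Qed.

(** * Bounds on X for one fixed phase [a] *)

Section Bounds.
Context (T U F G : H -> H) (a : R[i]).
Context (bU : bounded_operator U) (hU : forall x, hnorm (U x) <= hnorm x)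
  (sF : selfadj F) (sG : selfadj G) (TE : forall x, T x = U (G (F x))) (a1 : `|a| = 1).

Let X := re_op (fun x => a *: T x).
Let Y := re_op (fun x => a *: F (U (G x))).
Let Z := (F \o F) \+ (G \o G).

Let bT : bounded_operator T.
Proof.
have -> : T = U \o (G \o F) by apply/funext => x; rewrite TE.
exact: bounded_comp bU (bounded_comp sG.1 sF.1).
Qed.

Let bX : bounded_operator (fun x => a *: T x).
Proof. exact: bounded_scale. Qed.

Let bY : bounded_operator (fun x => a *: F (U (G x))).
Proof. exact: bounded_scale (bounded_comp sF.1 (bounded_comp bU sG.1)). Qed.

Let sZ : selfadj Z.
Proof.
exact: selfadj_add (positive_selfadj (selfadj_sqr_positive sF))
  (positive_selfadj (selfadj_sqr_positive sG)).
Qed.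

Let N s : H -> H := Z \+ (fun x => (2 * s)%:C%C *: Y x).

Let N_selfadj s : selfadj (N s).
Proof. exact: selfadj_add sZ (selfadj_scale _ (re_op_selfadj bY)). Qed.

Let N_dominates s v : s ^+ 2 = 1 ->
  hnorm (aluthge_cofactor U F G a s v) ^+ 2 <= hre (N s v) v.
Proof.
move=> s1; apply: le_trans (aluthge_cofactor_norm v sF sG hU a1 s1) _.
by rewrite /N /= [leRHS]hreDl hreZl re_op_form.
Qed.

Let X_form v : 4 * hre (X v) v =
  hnorm (aluthge_factor U F G a 1 v) ^+ 2 - hnorm (aluthge_factor U F G a (-1) v) ^+ 2.
Proof. by rewrite re_op_form// aluthge_factor_polarization// TE. Qed.

Lemma aluthge_opnorm_le z w : 0 <= z -> 0 <= w ->
  (forall x, hnorm (Z x) <= z * hnorm x) -> (forall x, hnorm (Y x) <= w * hnorm x) ->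
  forall x, hnorm (X x) <= (z + 2 * w) / 4 * hnorm x.
Proof.
move=> z0 w0 hZ hY; have K0 : 0 <= z + 2 * w by rewrite addr_ge0 ?mulr_ge0.
apply: selfadj_form_le => [||v]; first exact: re_op_selfadj.
  by rewrite divr_ge0.
have key s : s ^+ 2 = 1 -> hnorm (aluthge_factor U F G a s v) ^+ 2 <= (z + 2 * w) * hnorm v ^+ 2.
  move=> s1; have ns : `|s| = 1.
    by apply/eqP; rewrite -(@eqrXn2 _ 2)// real_normK ?num_real// s1 expr1n.
  apply: (dominated_norm_le (B := aluthge_cofactor U F G a s) (N := N s)) => //.
  - by move=> x y; exact: aluthge_factor_adjoint.
  - by move=> x; exact: N_dominates.
  move=> x; rewrite /N /= hreDl hreZl.
  have h1 := le_trans (hre_le (Z x) x) (ler_wpM2r (hnorm_ge0 x) (hZ x)).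
  have h2 := le_trans (hre_abs_le (Y x) x) (ler_wpM2r (hnorm_ge0 x) (hY x)).
  have h3 : s * hre (Y x) x <= `|hre (Y x) x|.
    by apply: le_trans (ler_norm _) _; rewrite normrM ns mul1r.
  lra.
have sN1 : (-1 : R) ^+ 2 = 1 by rewrite sqrrN expr1n.
have h1 := key 1 (expr1n _ _); have h2 := key (-1) sN1; have e := X_form v.
have p1 := sqr_ge0 (hnorm (aluthge_factor U F G a 1 v)).
have p2 := sqr_ge0 (hnorm (aluthge_factor U F G a (-1) v)).
have -> : (z + 2 * w) / 4 * hnorm v ^+ 2 = (z + 2 * w) * hnorm v ^+ 2 / 4 by ring.
by rewrite ler_norml; lra.
Qed.

Lemma aluthge_trace_le r z w : 1 <= r -> 0 <= z -> 0 <= w ->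
  compact_operator T -> compact_operator Z -> compact_operator Y ->
  (trace_pow r Z <= (z `^ r)%:E)%E -> (trace_pow r Y <= (w `^ r)%:E)%E ->
  (trace_pow r X <= (2 * ((z + 2 * w) / 4) `^ r)%:E)%E.
Proof.
move=> r1 z0 w0 cT cZ cY hZ hY; have K0 : 0 <= z + 2 * w by rewrite addr_ge0 ?mulr_ge0.
have sX : selfadj X by exact: re_op_selfadj.
have cX : compact_operator X by apply: re_op_compact; exact: compact_scale.
have sY : selfadj Y by exact: re_op_selfadj.
have [E [l [bE Xl]]] := compact_eigenbasis sX cX.
have [oE _] := bE.
rewrite (trace_pow_eigen r1 sX bE Xl).
have key s : s ^+ 2 = 1 ->
    (\esum_(e in E) ((hnorm (aluthge_factor U F G a s e) ^+ 2) `^ r)%:E <=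
      ((z + 2 * w) `^ r)%:E)%E.
  move=> s1; have cN : compact_operator (N s) := compact_add cZ (compact_scale _ cY).
  have [E' [l' [bE' Nl]]] := compact_eigenbasis (N_selfadj s) cN.
  apply: le_trans (sum_powR_le r1 s1 z0 w0 sZ cZ sY cY hZ hY bE'.1 Nl).
  apply: (dominated_powR_le (B := aluthge_cofactor U F G a s) (N := N s)) => //.
  - by move=> x y; exact: aluthge_factor_adjoint.
  - by move=> x; exact: N_dominates.
have lE u : E u -> l u = hre (X u) u.
  by move=> Eu; rewrite Xl// hreZl hnormE (onb_norm oE Eu) expr1n mulr1.
apply: (@le_trans _ _ (\esum_(e in E) (4^-1 `^ r *
    ((hnorm (aluthge_factor U F G a 1 e) ^+ 2) `^ r +
     (hnorm (aluthge_factor U F G a (-1) e) ^+ 2) `^ r))%:E)).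
  apply: le_esum => e Ee; rewrite lee_fin lE//.
  by apply: powR_diff_le => //; rewrite ?sqr_ge0.
rewrite esumZl ?powR_ge0// => [|e _]; last by rewrite addr_ge0// powR_ge0.
under eq_esum => e _ do rewrite EFinD.
rewrite esumD; last 2 first.
- by move=> e _; rewrite lee_fin powR_ge0.
- by move=> e _; rewrite lee_fin powR_ge0.
have pE : (0 <= (4^-1 `^ r)%:E :> \bar R)%E by rewrite lee_fin powR_ge0.
have sN1 : (-1 : R) ^+ 2 = 1 by rewrite sqrrN expr1n.
apply: le_trans (lee_wpmul2l pE (leeD (key 1 (expr1n _ _)) (key (-1) sN1))) _.
(* With K = z + 2 w, the two equal sums give 4^(-r) (K^r + K^r) = 2 (K / 4)^r. *)
rewrite -EFinD -EFinM lee_fin mulrC [X in _ <= 2 * X]powRM ?invr_ge0//.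
by rewrite le_eqVlt; apply/orP; left; apply/eqP; ring.
Qed.

End Bounds.

End AluthgeBound.

(** * Consequences of a finite Schatten norm *)

Section SchattenNormFacts.
Context {R : realType} {H : hilbertSpace R}.
Implicit Types (X : H -> H) (r w : R) (p : \bar R).

Lemma trace_pow_ge0 X r : 1 <= r -> selfadj X -> compact_operator X -> (0 <= trace_pow r X)%E.
Proof.
move=> r1 sX cX; have [E [l [bE Xl]]] := compact_eigenbasis sX cX.
rewrite (trace_pow_eigen r1 sX bE Xl); apply: esum_ge0 => u _.
by rewrite lee_fin powR_ge0.
Qed.

Lemma schatten_norm_ge0 p X : (0 <= schatten_norm p X)%E.
Proof.
rewrite /schatten_norm; case: asboolP => // hX; move: p hX => [r _|bX|[]].
  exact: poweR_ge0.
exact: opnorm_ge0 (bounded_lin bX).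
Qed.

Lemma schatten_norm_finite_class p X w : (schatten_norm p X <= w%:E)%E -> schatten_class p X.
Proof. by rewrite /schatten_norm; case: asboolP. Qed.

Lemma schatten_norm_trace X r w : 1 <= r -> 0 <= w -> selfadj X ->
  (schatten_norm r%:E X <= w%:E)%E ->
  compact_operator X /\ (trace_pow r X <= (w `^ r)%:E)%E.
Proof.
move=> r1 w0 sX hX; have [cX _] := schatten_norm_finite_class hX.
have r0 : 0 < r by exact: lt_le_trans r1.
split=> //; have t0 := trace_pow_ge0 r1 sX cX.
move: hX; rewrite /schatten_norm; case: asboolP => // _ hX.
have -> : trace_pow r X = ((trace_pow r X `^ r^-1) `^ r)%E.
  by rewrite -poweRrM mulVf ?gt_eqF// poweRe1.
rewrite -poweR_EFin; apply: gt0_ler_poweR => //; first exact: ltW.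
  by rewrite in_itv /= poweR_ge0 leey.
by rewrite in_itv /= lee_fin w0 leey.
Qed.

Lemma schatten_norm_opnorm X w : 0 <= w -> (schatten_norm +oo%E X <= w%:E)%E ->
  forall x, hnorm (X x) <= w * hnorm x.
Proof.
move=> w0 hX; have bX := schatten_norm_finite_class hX.
apply/opnorm_leP => //; first exact: bounded_lin bX.
by move: hX; rewrite /schatten_norm; case: asboolP.
Qed.

End SchattenNormFacts.

Theorem theorem2p1 (R : realType) (H : hilbertSpace R) (p : \bar R)
    (T : H -> H) (f g : R -> R) :
  separable H -> (1 <= p)%E -> schatten_class p T ->
  {within `[0, +oo[, continuous f} -> {within `[0, +oo[, continuous g} ->
  (forall x, 0 <= x -> 0 <= f x) -> (forall x, 0 <= x -> 0 <= g x) ->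
  (forall x, 0 <= x -> f x * g x = x) ->
  (numerical_radius p T <=
     (2 `^ (inv_exponent p - 1))%:E * numerical_radius p (aluthge f g T) +
     (2 `^ (inv_exponent p - 2))%:E *
       schatten_norm p ((cfc f (absop T) \o cfc f (absop T)) \+
                        (cfc g (absop T) \o cfc g (absop T)))%R)%E.
Proof.
move=> _ p1 cT cf cg _ _ fg.
have bT : bounded_operator T.
  by case: p p1 cT => [r _ [cT _]|//|]; [exact: compact_bounded_op|].
have pA := absop_positive bT; have sA := positive_selfadj pA.
have hF := cfc_continuous pA cf; have hG := cfc_continuous pA cg.
have sF := cfc_selfadj sA hF; have sG := cfc_selfadj sA hG.
(* Written as G F, so that T = U G F and the transform F U G arises by moving F to the front. *)
have GF : cfc g (absop T) \o cfc f (absop T) = absop T.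
  apply: (cfc_mul sA hG hF (cfc_id sA.1)) => t st.
  by rewrite mulrC fg// (spectrum_positive pA).
have [iU TU _] := polarP bT.
have bU := iU.1; have hU x := partial_isometry_le x iU.
have TE x : T x = polar T (cfc g (absop T) (cfc f (absop T) x)).
  by rewrite [LHS](congr1 (fun k => k x) TU) /= -{1}GF.
set Z := (_ \+ _)%R; set W := numerical_radius p (aluthge f g T).
have W0 : (0 <= W)%E.
  apply: le_ereal_sup_tmp; exists (schatten_norm p (re_op (fun x => (cos 0 +i* sin 0)%C *: aluthge f g T x))).
    by exists 0.
  exact: schatten_norm_ge0.
have z0 := schatten_norm_ge0 p Z.
have c1 : 0 < 2 `^ (inv_exponent p - 1) :> R by rewrite powR_gt0.
have c2 : 0 < 2 `^ (inv_exponent p - 2) :> R by rewrite powR_gt0.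
(* An infinite term on the right makes the bound trivial, since the other summand is nonnegative. *)
have [Wy|Wy] := eqVneq W +oo%E.
  rewrite Wy gt0_muley ?lte_fin// addye ?leey//.
  by rewrite gt_eqF// (lt_le_trans ltNy0)// mule_ge0// lee_fin ltW.
have [zy|zy] := eqVneq (schatten_norm p Z) +oo%E.
  rewrite zy gt0_muley ?lte_fin// addey ?leey//.
  by rewrite gt_eqF// (lt_le_trans ltNy0)// mule_ge0// lee_fin ltW.
have [w wE] : exists w, W = w%:E by move: W W0 Wy => [w||] //; exists w.
have [z zE] : exists z, schatten_norm p Z = z%:E.
  by move: (schatten_norm p Z) z0 zy => [z||] //; exists z.
rewrite wE zE; rewrite wE lee_fin in W0; rewrite zE lee_fin in z0.
apply: ge_ereal_sup => _ [t _ <-].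
set a := (cos t +i* sin t)%C.
have a1 : `|a| = 1 by rewrite normc_def /= cos2Dsin2 sqrtr1.
have hY : (schatten_norm p (re_op (fun x => a *: aluthge f g T x)) <= w%:E)%E.
  by rewrite -wE; apply: ereal_sup_ubound; exists t.
have hZ : (schatten_norm p Z <= z%:E)%E by rewrite zE.
have bY : bounded_operator (fun x => a *: aluthge f g T x).
  exact: bounded_scale (bounded_comp (bounded_comp sF.1 bU) sG.1).
have bX : bounded_operator (fun x => a *: T x) by exact: bounded_scale.
rewrite -!EFinM -EFinD.
(* With 2^(1/p) factored out, the right-hand side is 2^(1/p) (z + 2 w) / 4, the form of both bounds
   on X. *)
have pw1 : 2 `^ (inv_exponent p - 1) = 2 `^ inv_exponent p / 2 :> R.
  by rewrite powRB ?powRr1// pnatr_eq0 implybT.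
have pw2 : 2 `^ (inv_exponent p - 2) = 2 `^ inv_exponent p / 4 :> R.
  rewrite powRB ?pnatr_eq0 ?implybT// (powR_mulrn 2)//; congr (_ / _); ring.
rewrite pw1 pw2.
have -> : 2 `^ inv_exponent p / 2 * w + 2 `^ inv_exponent p / 4 * z =
  2 `^ inv_exponent p * ((z + 2 * w) / 4) by field.
have K0 : 0 <= (z + 2 * w) / 4 by rewrite divr_ge0// addr_ge0// mulr_ge0.
move: p p1 cT hY hZ {c1 c2 Wy zy wE zE W pw1 pw2} => [r r1 cT hY hZ|_ _ hY hZ|//] /=; last first.
  (* For infinite [p] the convention 1/p = 0 makes the factor 2^(1/p) equal to 1. *)
  have hX := aluthge_opnorm_le bU hU sF sG TE a1 z0 W0
    (schatten_norm_opnorm z0 hZ) (schatten_norm_opnorm W0 hY).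
  have bR := (re_op_selfadj bX).1.
  rewrite /schatten_norm asboolT// powRr0 mul1r.
  by apply/opnorm_leP => //; exact: bounded_lin bR.
rewrite lee_fin in r1; have [cT' _] := cT.
have r0 : 0 < r by exact: lt_le_trans r1.
have sZ : selfadj Z.
  exact: selfadj_add (positive_selfadj (selfadj_sqr_positive sF))
    (positive_selfadj (selfadj_sqr_positive sG)).
have [cZ tZ] := schatten_norm_trace r1 z0 sZ hZ.
have [cY tY] := schatten_norm_trace r1 W0 (re_op_selfadj bY) hY.
have tX := aluthge_trace_le bU hU sF sG TE a1 r1 z0 W0 cT' cZ cY tZ tY.
have cX : compact_operator (re_op (fun x => a *: T x)).
  by apply: re_op_compact; exact: compact_scale.
rewrite /schatten_norm asboolT; last by split=> //; exact: le_lt_trans tX (ltry _).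
have ri : 0 <= r^-1 by rewrite invr_ge0 ltW.
(* The r-th root turns the factor 2 of [tX] into 2^(1/r). *)
apply: le_trans (gt0_ler_poweR ri _ _ tX) _.
- by rewrite in_itv /= (trace_pow_ge0 r1 (re_op_selfadj bX) cX) leey.
- by rewrite in_itv /= lee_fin mulr_ge0 ?powR_ge0// leey.
by rewrite poweR_EFin lee_fin powRM ?powR_ge0// -powRrM mulfV ?gt_eqF// powRr1.
Qed.
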